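(* (Existence of solutions) Consider the constrained optimal control Problem B and its discretization Problem $B^N$ (both defined in the context). Suppose Problem B has a feasible trajectory $(x(t),u(t))$ in which $(x_r(t))^{(m)}$ has bounded variation for some integer $m\ge2$. In Problem $B^N$, let $m_1$ be any integer and $\beta$ any real number satisfying $1\le m_1\le m-1$ and $0<\beta<(m-m_1)-\frac34$, and let the bounds $\underline b,\bar b,\underline b_j,\bar b_j,d$ be large enough in the sense of the context. Then there exists $N_1>0$ so that, for all $N\ge N_1$, Problem $B^N$ has a feasible trajectory $(\bar x^N,\bar u^N)$, i.e. one satisfying all of the constraints (1)–(6) of Problem $B^N$. Furthermore, $(x(t),u(t))$ and the interpolation $(x^N(t),u^N(t))$ of $(\bar x^N,\bar u^N)$ satisfy, with a constant $M>0$ independent of $N$, $$\|x_i^N(t)-x_i(t)\|_\infty\le\frac{M\|x_r\|_{W^{m,2}}}{(N-r-m_1+1)^{(m-m_1)-3/4}},\quad i=1,\dots,r,$$ $$\|(x_r^N(t))^{(l)}-(x_r(t))^{(l)}\|_\infty\le\frac{M\|x_r\|_{W^{m,2}}}{(N-r-m_1+1)^{(m-m_1)-3/4}},\quad l=1,\dots,m_1,$$ $$\|u^N(t)-u(t)\|_\infty\le\frac{M\|x_r\|_{W^{m,2}}}{(N-r-m_1+1)^{(m-m_1)-3/4}},$$ and the spectral coefficients of $(x_r^N)^{(m_1)}(t)$ satisfy $$|a_n^N(m_1)|\le\frac{6\left(U(x_r^{(m_1+1)})+V(x_r^{(m_1+1)})\right)}{\sqrt\pi\,n^{3/2}},\quad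 n=1,2,\dots,N-r-1.$$
   Context: Derivatives are weak derivatives unless ''strong'' is specified. $\|\xi\|_{W^{m,p}}=\sum_{j=0}^m\|\xi^{(j)}\|_{L^p}$ on $[-1,1]$. $U(h)$ is an upper bound of $|h|$ and $V(h)$ the total variation of $h$ on $[-1,1]$. **Problem B.** Determine the state-control function pair $(x(t),u(t))$, $x\in\mathbb{R}^r$, $u\in\mathbb{R}$, $t\in[-1,1]$, minimizing $$J(x(\cdot),u(\cdot))=\int_{-1}^1F(x(t),u(t))\,dt+E(x(-1),x(1))$$ subject to the state equation $\dot x_1=x_2,\ \dots,\ \dot x_{r-1}=x_r,\ \dot x_r=f(x)+g(x)u$, the endpoint condition $e(x(-1),x(1))=0$, and the state-control constraint $h(x(t),u(t))\le0$. Here $F:\mathbb{R}^r\times\mathbb{R}\to\mathbb{R}$, $E:\mathbb{R}^r\times\mathbb{R}^r\to\mathbb{R}$, $f,g:\mathbb{R}^r\to\mathbb{R}$, $e:\mathbb{R}^r\times\mathbb{R}^r\to\mathbb{R}^{N_e}$, $h:\mathbb{R}^r\times\mathbb{R}\to\mathbb{R}^{N_h}$ are Lipschitz continuous in their arguments and $g(x)\ne0$ for all $x$. A feasible trajectory is a pair satisfying these constraints. **LGL nodes, weights, differentiation matrix.** $L_N$ is the Legendre polynomial of degree $N$. The nodes are $t_0=-1$, $t_N=1$, and $t_1<\dots<t_{N-1}$ the roots of $\dot L_N$. The weights are $w_k=\frac{2}{N(N+1)}\frac{1}{L_N(t_k)^2}$. $D$ is the $(N+1)\times(N+1)$ matrix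 with entries $D_{ik}=\frac{L_N(t_i)}{L_N(t_k)}\frac{1}{t_i-t_k}$ for $i\neq k$, $D_{00}=-\frac{N(N+1)}4$, $D_{NN}=\frac{N(N+1)}4$, and $0$ otherwise; it maps the nodal values of a polynomial of degree $\le N$ to the nodal values of its derivative. **Discrete variables and interpolation.** $\bar x^{Nk}=(\bar x_1^{Nk},\dots,\bar x_r^{Nk})^T\in\mathbb{R}^r$, $\bar u^{Nk}\in\mathbb{R}$, $k=0,\dots,N$; $\bar x_i^N=[\bar x_i^{N0}\ \cdots\ \bar x_i^{NN}]$ (row vector). The interpolation of $(\bar x^N,\bar u^N)$ is the pair $(x^N(t),u^N(t))$ where $x_i^N(t)$ is the polynomial of degree $\le N$ with $x_i^N(t_k)=\bar x_i^{Nk}$ for all $k$, and $u^N(t)=\frac{\dot x_r^N(t)-f(x^N(t))}{g(x^N(t))}$. **Spectral coefficients.** For an integer $m_1\ge1$ and $0\le n\le N-r-m_1+1$, $$a_n^N(m_1)=\left(n+\tfrac12\right)\sum_{k=0}^N L_n(t_k)\,w_k\,\left(D^{m_1}(\bar x_r^N)^T\right)_k ,$$ the Legendre coefficients of the polynomial interpolating $\bar x_r^N(D^T)^{m_1}$, i.e. of $(x_r^N)^{(m_1)}(t)$, whose degree is at most $N-r-m_1+1$ under constraint (1) (coefficients of larger index are zero). **Problem $B^N$.** Find $\bar x^{Nk}\in\mathbb{R}^r$, $\bar u^{Nk}\in\mathbb{R}$, $k=0,\dots,N$, minimizing $$\bar J^N(\bar x^N,\bar u^N)=\sum_{k=0}^NF(\bar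 x^{Nk},\bar u^{Nk})w_k+E(\bar x^{N0},\bar x^{NN})$$ subject to: (1) $D(\bar x_i^N)^T=(\bar x_{i+1}^N)^T$ for $1\le i\le r-1$, and $(D(\bar x_r^N)^T)_k=f(\bar x^{Nk})+g(\bar x^{Nk})\bar u^{Nk}$ for $0\le k\le N$; (2) $\|e(\bar x^{N0},\bar x^{NN})\|_\infty\le(N-r-1)^{-\beta}$; (3) $h(\bar x^{Nk},\bar u^{Nk})\le(N-r-1)^{-\beta}\cdot\mathbf 1$ componentwise for $0\le k\le N$, with $\mathbf 1$ the all-ones vector; (4) $\underline b\le(\bar x^{Nk},\bar u^{Nk})\le\bar b$ componentwise for $0\le k\le N$; (5) if $m_1\ge2$: $\underline b_j\le[1\ 0\ \cdots\ 0]D^j(\bar x_r^N)^T\le\bar b_j$ for $1\le j\le m_1-1$; (6) $\sum_{n=0}^{N-r-m_1+1}|a_n^N(m_1)|\le d$. Here $\underline b,\bar b\in\mathbb{R}^{r+1}$ and $\underline b_j,\bar b_j,d\in\mathbb{R}$ are fixed, independent of $N$. **''Bounds large enough''.** There are thresholds, depending on Problem B, the given trajectory $(x,u)$, $m$ and $m_1$ but not on $N$, such that the assertion holds whenever $\bar b,\bar b_j,d$ lie (componentwise) above and $\underline b,\underline b_j$ below the corresponding thresholds. In particular, $(x(t),u(t))$ lies in the interior of the box $[\underline b,\bar b]$, $(x_r(t))^{(j)}$ lies in the interior of $[\underline b_j,\bar b_j]$, and $d>\frac6{\sqrt\pi}\left(U(x_r^{(m_1+1)})+V(x_r^{(m_1+1)})\right)\zeta(3/2)$,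 where $\zeta(s)=\sum_{k\ge1}k^{-s}$. *)

(* Defs.v *)
From HB Require Import structures.
From mathcomp Require Import all_boot all_order all_algebra.
From mathcomp Require Import polyrcf.
From mathcomp Require Import all_classical all_reals all_analysis.

Set Implicit Arguments.
Unset Strict Implicit.
Unset Printing Implicit Defensive.

Import Order.TTheory GRing.Theory Num.Theory.
Import numFieldNormedType.Exports.

Local Open Scope classical_set_scope.
Local Open Scope ring_scope.

Section WeakDerivatives.
Context {R : realType}.
Local Notation mu := (@lebesgue_measure R).

Definition test_function (phi : R -> R) : Prop :=
  (forall n t, derivable (derive1n n phi) t 1) /\
  exists a b : R, [/\ -1 < a, b < 1 & forall t, t \notin `[a, b] -> phi t = 0].

(* eta is a weak derivative of order j of xi on ]-1, 1[; for j = 0 this says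
   that xi and eta coincide almost everywhere. *)
Definition weak_derivative (j : nat) (xi eta : R -> R) : Prop :=
  [/\ locally_integrable `]-1, 1[%classic xi,
      locally_integrable `]-1, 1[%classic eta
    & forall phi, test_function phi ->
        \int[mu]_(t in `]-1, 1[) (xi t * derive1n j phi t) =
        (-1) ^+ j * \int[mu]_(t in `]-1, 1[) (eta t * phi t)].

(* y j is the weak derivative of order j of xi, for 0 <= j <= m.  When the one
   of order m has bounded variation, those of lower order have a (unique)
   continuous representative on [-1, 1]; y j denotes that representative, so
   that pointwise values and total variations of y j are meaningful. *)
Definition weak_derivatives (m : nat) (xi : R -> R) (y : nat -> R -> R) : Prop :=
  (forall j, (j <= m)%N -> weak_derivative j xi (y j)) /\
  (forall j, (j < m)%N -> {within `[-1, 1], continuous (y j)}).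

Definition Lp_norm (p : \bar R) (xi : R -> R) : \bar R :=
  ('N[mu]_p [EFin \o (xi \_ `[-1, 1])%R])%E.

(* Norm of W^{m,p}(-1, 1) of a function with weak derivatives y 0, ..., y m. *)
Definition sobolev_norm (m : nat) (p : \bar R) (y : nat -> R -> R) : \bar R :=
  (\sum_(j < m.+1) Lp_norm p (y j))%E.

Definition zeta (s : R) : \bar R :=
  (\sum_(1 <= k <oo) ((k%:R : R) `^ (- s))%R%:E)%E.

End WeakDerivatives.

Section LGL.
Context {R : realType}.

(* Rodrigues' formula *)
Definition legendre (n : nat) : {poly R} :=
  ((2 ^ n * n`!)%N%:R)^-1 *: derivn n (('X ^+ 2 - 1) ^+ n).

(* rootsR lists the distinct real roots in increasing order. *)
Definition node (N : nat) (k : 'I_N.+1) : R :=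
  nth 0 (-1 :: rcons (rootsR (deriv (legendre N))) 1) k.

Definition weight (N : nat) (k : 'I_N.+1) : R :=
  2 / (N * N.+1)%N%:R / (legendre N).[node k] ^+ 2.

Definition lgl_diff (N : nat) : 'M[R]_N.+1 :=
  \matrix_(i, k)
    if i != k then
      (legendre N).[node i] / (legendre N).[node k] / (node i - node k)
    else if i == ord0 then - ((N * N.+1)%N%:R / 4)
    else if i == ord_max then (N * N.+1)%N%:R / 4
    else 0.

(* The n-th Legendre coefficient, computed by the LGL quadrature, of the m1-th
   derivative of the polynomial with nodal values v. *)
Definition spectral_coef (N m1 : nat) (v : 'cV[R]_N.+1) (n : nat) : R :=
  (n%:R + 1 / 2) *
  \sum_(k < N.+1)
    (legendre n).[node k] * weight k * (lgl_diff N ^+ m1 *m v) k ord0.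

End LGL.

(* Throughout, the state dimension is r = q.+1, hence r >= 1; the component x_i
   has index i - 1 and x_r has index ord_max. *)

(* Data of the optimal control problem: running cost F, endpoint cost E,
   dynamics f and g, endpoint constraint e, path constraint h.  The costs play
   no role in feasibility. *)
Record problemB (R : realType) (q Ne Nh : nat) := ProblemB {
  runF : 'cV[R]_q.+1 * R -> R ;
  endE : 'cV[R]_q.+1 * 'cV[R]_q.+1 -> R ;
  dynf : 'cV[R]_q.+1 -> R ;
  dyng : 'cV[R]_q.+1 -> R ;
  ende : 'cV[R]_q.+1 * 'cV[R]_q.+1 -> 'cV[R]_Ne ;
  pathh : 'cV[R]_q.+1 * R -> 'cV[R]_Nh ;
  runF_lipschitz : lipschitz runF ;
  endE_lipschitz : lipschitz endE ;
  dynf_lipschitz : lipschitz dynf ;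
  dyng_lipschitz : lipschitz dyng ;
  ende_lipschitz : lipschitz ende ;
  pathh_lipschitz : lipschitz pathh ;
  dyng_neq0 : forall x, dyng x != 0 }.

(* The bounds of the discrete problem: [box_lo, box_hi] for (x, u) in R^r * R,
   [der_lo j, der_hi j] for the derivatives of x_r at -1, and d. *)
Record bounds (R : realType) (q : nat) := Bounds {
  box_lo : 'cV[R]_q.+1 * R ;
  box_hi : 'cV[R]_q.+1 * R ;
  der_lo : nat -> R ;
  der_hi : nat -> R ;
  coef_hi : R }.

Section Problems.
Context {R : realType} {q Ne Nh : nat}.
Implicit Types (P : problemB R q Ne Nh) (B T : bounds R q).
Local Notation mu := (@lebesgue_measure R).

Definition cw_le (a b : 'cV[R]_q.+1 * R) : Prop :=
  (forall i, a.1 i ord0 <= b.1 i ord0) /\ a.2 <= b.2.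

Definition cw_lt (a b : 'cV[R]_q.+1 * R) : Prop :=
  (forall i, a.1 i ord0 < b.1 i ord0) /\ a.2 < b.2.

(* Derivatives are weak.  The state is its continuous representative, so that
   x (-1) and x 1 make sense; the control is determined by the state equation
   only up to a null set, hence pointwise conditions on u hold almost
   everywhere. *)
Definition feasible P (x : R -> 'cV[R]_q.+1) (u : R -> R) : Prop :=
  [/\ {within `[-1, 1], continuous x},
      forall i j : 'I_q.+1, j = i.+1 :> nat ->
        weak_derivative 1 (fun t => x t i ord0) (fun t => x t j ord0),
      weak_derivative 1 (fun t => x t ord_max ord0)
        (fun t => dynf P (x t) + dyng P (x t) * u t),
      ende P (x (-1), x 1) = 0
    & {ae mu, forall t, t \in `[-1, 1] ->
        forall j, pathh P (x t, u t) j ord0 <= 0}].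

(* X i k is the value of x_i at the k-th node: row i X is the vector of nodal
   values of x_i, and col k X the state at the k-th node. *)
Definition feasibleN P (m1 : nat) (beta : R) B (N : nat)
    (X : 'M[R]_(q.+1, N.+1)) (u : 'rV[R]_N.+1) : Prop :=
  let delta := (N%:R - q.+1%:R - 1) `^ (- beta) in
  let xr := (row ord_max X)^T in
  [/\ (forall i j : 'I_q.+1, j = i.+1 :> nat ->
         lgl_diff N *m (row i X)^T = (row j X)^T) /\
      (forall k, (lgl_diff N *m xr) k ord0 =
         dynf P (col k X) + dyng P (col k X) * u ord0 k),
      `|ende P (col ord0 X, col ord_max X)| <= delta,
      forall k j, pathh P (col k X, u ord0 k) j ord0 <= delta,
      forall k, cw_le (box_lo B) (col k X, u ord0 k) /\
                cw_le (col k X, u ord0 k) (box_hi B)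
    & (forall j, (1 <= j)%N -> (j <= m1 - 1)%N ->
         der_lo B j <= (lgl_diff N ^+ j *m xr) ord0 ord0 <= der_hi B j) /\
      (* the index n runs from 0 to N - r - m1 + 1 inclusive *)
      \sum_(n < N.+2 - (q.+1 + m1)) `|spectral_coef m1 xr n| <= coef_hi B].

Definition interpolates (N : nat) (X : 'M[R]_(q.+1, N.+1))
    (p : 'I_q.+1 -> {poly R}) : Prop :=
  forall i, (size (p i) <= N.+1)%N /\ forall k, (p i).[node k] = X i k.

Definition interp_state (p : 'I_q.+1 -> {poly R}) (t : R) : 'cV[R]_q.+1 :=
  \col_i (p i).[t].

Definition interp_control P (p : 'I_q.+1 -> {poly R}) (t : R) : R :=
  ((deriv (p ord_max)).[t] - dynf P (interp_state p t)) /
  dyng P (interp_state p t).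

Definition beyond (m1 : nat) T B : Prop :=
  [/\ cw_le (box_lo B) (box_lo T), cw_le (box_hi T) (box_hi B),
      forall j, (1 <= j)%N -> (j <= m1 - 1)%N ->
        der_lo B j <= der_lo T j /\ der_hi T j <= der_hi B j
    & coef_hi T <= coef_hi B].

(* U is an upper bound of the absolute value of y m1.+1 on [-1, 1]. *)
Definition admits (m1 : nat) T (x : R -> 'cV[R]_q.+1) (u : R -> R)
    (y : nat -> R -> R) (U : R) : Prop :=
  [/\ {ae mu, forall t, t \in `[-1, 1] ->
        cw_lt (box_lo T) (x t, u t) /\ cw_lt (x t, u t) (box_hi T)},
      forall j, (1 <= j)%N -> (j <= m1 - 1)%N -> forall t, t \in `[-1, 1] ->
        der_lo T j < y j t < der_hi T j
    & ((6 / Num.sqrt pi)%:E * (U%:E + total_variation (-1) 1 (y m1.+1)) *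
        zeta (3 / 2) < (coef_hi T)%:E)%E].

End Problems.

(* Main.v *)
From HB Require Import structures.
Require Import Defs.
From mathcomp Require Import all_boot all_order all_algebra.
From mathcomp Require Import polyrcf.
From mathcomp Require Import all_classical all_reals all_analysis.
From mathcomp Require Import measurable_realfun ess_sup_inf.
From mathcomp Require Import ring lra zify.

(** The differentiation matrix D is exact on polynomials of degree at most N
    (lgl_diff_correct), so that nodal values satisfy the discrete dynamics as soon
    as they are those of polynomials each of which is the derivative of the
    previous one, the control being read off the last state equation.  A discrete
    trajectory is therefore built from below.  Write z for the m1-th derivative of
    the last state and r for the number of states.  The Legendre series of z is cut
    at K = N - r - m1 + 1 and the partial sum is integrated m1 + r - 1 times, each
    time from the value at -1 of the function to be approximated (candidate).  The
    degree ends up at most N, the derivatives of the last state at -1 are those of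
    the given trajectory, and each integration at most doubles the error
    (approx_error): all errors, including that of the control, are bounded by a
    constant times the uniform error of the partial sum.  For large N this error
    beats the tolerance (N - r - 1)^(-beta), and the Lipschitz constraints follow
    from those of the given trajectory (candidate_feasible).

    The uniform error is a sum of Legendre coefficients.  Since (2n+1) L_n is the
    derivative of L_(n+1) - L_(n-1), an integration by parts expresses the n-th
    coefficient of z by two coefficients of z' and gains a factor 1/n (lcoef_step).
    When the last derivative has bounded variation V, its coefficients are at most
    V / sqrt n, because |L_(n+1) - L_(n-1)| <= 2 / sqrt n (legendre_diff_bound,
    proved by monotone energies of the Legendre equation).  So the coefficients of
    z are O(n^(-(m-m1)-1/2)) and their tail from K on is O(K^(-(m-m1)+1/2)), which
    is better than the required exponent (projection_rate).  That the series
    converges to z itself is seen by testing against nonnegative polynomials peaked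
    at a point (partial_sum_uniform).  The same two steps with explicit constants
    give the bound on the spectral coefficients (lcoef_explicit): these are genuine
    Legendre coefficients, as the quadrature is exact up to degree 2N - 1
    (quadrature_exact, spectral_coef_approx).

    It remains to read the weak hypotheses pointwise.  Smooth bumps whose
    derivative concentrates near two points show that a continuous function with a
    locally integrable weak derivative is an integral of it
    (weak_derivative_integral); the state equations become integral relations on
    [-1, 1], and the control agrees almost everywhere with a continuous function
    (control_ae).

    The factor given by the Sobolev norm enters only through its vanishing: M may
    depend on the trajectory, and when the norm is 0 so is z, in which case the
    approximation is exact (absorb_norm, sobolev_eq0). *)

Set Implicit Arguments.
Unset Strict Implicit.
Unset Printing Implicit Defensive.

Import Order.TTheory GRing.Theory Num.Theory.
Import numFieldNormedType.Exports.

Local Open Scope classical_set_scope.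
Local Open Scope ring_scope.

(** * Legendre polynomials: recurrences and bounds *)

Section LegendreAlgebra.
Context {R : realType}.
Implicit Types (n : nat) (p : {poly R}).

(** Its n-th derivative is L n.  The recurrences below all come from commuting
    that derivative with the multiplication by 'X in rodriguesS_deriv. *)
Definition rodrigues n : {poly R} :=
  ((2 ^ n * n`!)%N%:R)^-1 *: ('X ^+ 2 - 1) ^+ n.

(** The Legendre polynomials, locked: the scaling at the head of Rodrigues'
    formula would otherwise be seen through by rewriting. *)
Definition leg n : {poly R} := locked (@legendre R n).
Local Notation L := leg.

Lemma legE n : @legendre R n = L n.
Proof. by rewrite /leg -lock. Qed.

Lemma legendreE n : L n = derivn n (rodrigues n).
Proof. by rewrite -legE /legendre /rodrigues derivnZ. Qed.

Let c n : R := ((2 ^ n * n`!)%N%:R)^-1.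

Let cS n : c n = c n.+1 * (2 * n.+1%:R).
Proof.
rewrite /c expnS factS !natrM.
have h1 : (n.+1%:R : R) != 0 by rewrite pnatr_eq0.
have h2 : ((2 ^ n)%N%:R : R) != 0 by rewrite pnatr_eq0 expn_eq0.
have h3 : ((n`!)%N%:R : R) != 0 by rewrite pnatr_eq0 -lt0n fact_gt0.
move: h1 h2 h3; move: (n.+1%:R) ((2 ^ n)%N%:R) (n`!%:R) => x y z hx hy hz.
by field; rewrite hx hy hz.
Qed.

Let derivW n :
  (('X ^+ 2 - 1 : {poly R}) ^+ n.+1)^`() = (2 * n.+1%:R)%:P * ('X * ('X ^+ 2 - 1) ^+ n).
Proof.
rewrite deriv_exp /= derivB derivXn derivC subr0 -mulr_natr polyCM !polyC_natr.
by rewrite /= -mulr_natl expr1; ring.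
Qed.

Lemma rodriguesS_deriv n : (rodrigues n.+1)^`() = 'X * rodrigues n.
Proof.
rewrite /rodrigues derivZ derivW -/(c n.+1) -/(c n) (cS n) -!mul_polyC polyCM.
by ring.
Qed.

Lemma derivnXM k p : derivn k.+1 ('X * p) = 'X * derivn k.+1 p + derivn k p *+ k.+1.
Proof.
elim: k => [|k IH]; first by rewrite /= derivM derivX mul1r addrC mulr1n.
rewrite derivnS IH derivD derivM derivX mul1r derivMn -!derivnS.
by rewrite [X in X + _]addrC -addrA -mulrS.
Qed.

Lemma legendreS_deriv n : (L n.+1)^`() = 'X * (L n)^`() + n.+1%:R *: L n.
Proof.
rewrite !legendreE -derivnS derivSn rodriguesS_deriv derivnXM.
by rewrite scaler_nat -derivnS.
Qed.

(** Makes L n.+1 a multiple of (L n.+2 - L n)^`(), the form in which integrals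
    against L n.+1 are integrated by parts. *)
Lemma legendreS2_deriv n :
  (L n.+2)^`() = (2 * n.+1%:R + 1) *: L n.+1 + (L n)^`().
Proof.
rewrite !legendreE -derivnS derivSn rodriguesS_deriv derivSn.
rewrite derivM derivX mul1r rodriguesS_deriv mulrA -expr2.
have -> : ('X^2 * rodrigues n) = (2 * n.+1%:R) *: rodrigues n.+1 + rodrigues n.
  rewrite /rodrigues -/(c n.+1) -/(c n) (cS n) -!mul_polyC !polyCM (exprS _ n) !polyC_natr.
  by ring.
by rewrite !derivnD derivnZ scalerDl scale1r addrA [X in X + _]addrC -derivnS.
Qed.

Lemma legendre0 : L 0 = 1.
Proof. by rewrite legendreE /rodrigues expr0 expn0 mul1n invr1 scale1r. Qed.

Lemma legendre1 : L 1 = 'X.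
Proof.
rewrite legendreE /= rodriguesS_deriv /rodrigues expr0 expn0 mul1n invr1.
by rewrite scale1r mulr1.
Qed.

Lemma legendre_deriv_pred n : (L n)^`() = 'X * (L n.+1)^`() - n.+1%:R *: L n.+1.
Proof.
have := legendreS2_deriv n; rewrite legendreS_deriv => /eqP.
rewrite [X in _ == X]addrC -subr_eq => /eqP <-.
by rewrite -(natr1 n.+1) -!mul_polyC !(polyCD, polyCM) polyC1; ring.
Qed.

Lemma legendre_deriv_eq n :
  (1 - 'X ^+ 2) * (L n.+1)^`() = n.+1%:R *: (L n - 'X * L n.+1).
Proof.
rewrite mulrBl mul1r expr2 -mulrA.
have -> : 'X * (L n.+1)^`() = (L n)^`() + n.+1%:R *: L n.+1.
  by rewrite (legendre_deriv_pred n) subrK.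
rewrite mulrDr (legendreS_deriv n) -!mul_polyC; ring.
Qed.

Lemma legendre_ode n :
  ((1 - 'X ^+ 2) * (L n)^`())^`() = - (n%:R * n.+1%:R) *: L n.
Proof.
case: n => [|n].
  by rewrite legendre0 derivC mulr0 deriv0 mul0r oppr0 scale0r.
rewrite legendre_deriv_eq derivZ derivB derivM derivX mul1r (legendre_deriv_pred n).
by rewrite -(natr1 n.+1) -!mul_polyC !(polyCN, polyCM, polyCD); ring.
Qed.

Lemma legendre_at1 n : (L n).[1] = 1.
Proof.
elim: n => [|n IH]; first by rewrite legendre0 hornerC.
have := congr1 (fun p => p.[1]) (legendre_deriv_eq n).
rewrite !hornerE IH expr1n subrr mul0r => /esym/eqP.
by rewrite mulf_eq0 pnatr_eq0 /= subr_eq0 => /eqP <-.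
Qed.

Lemma legendre_atN1 n : (L n).[-1] = (-1) ^+ n.
Proof.
elim: n => [|n IH]; first by rewrite legendre0 hornerC.
have := congr1 (fun p => p.[-1]) (legendre_deriv_eq n).
rewrite !hornerE IH sqrrN expr1n subrr mul0r => /esym/eqP.
rewrite mulf_eq0 pnatr_eq0 /= subr_eq0 exprS => /eqP ->.
by rewrite mulrA mulrNN !mul1r.
Qed.

(** The two sides have the same derivative, by the Legendre equation, and both
    vanish at 1. *)
Lemma legendre_diff_deriv n :
  (2 * n.+1%:R + 1) *: (('X ^+ 2 - 1) * (L n.+1)^`()) =
  (n.+1%:R * n.+2%:R) *: (L n.+2 - L n).
Proof.
set A := LHS; set B := RHS.
have dAB : (A - B)^`() = 0.
  rewrite /A /B derivB !derivZ derivB (legendreS2_deriv n) addrK.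
  rewrite -(opprB 1 ('X ^+ 2)) mulNr derivN legendre_ode -!mul_polyC.
  by rewrite !(polyCN, polyCM, polyCD); ring.
have [k Hk] : exists k, A - B = k%:P.
  exists ((A - B)`_0); apply/polyP => -[|i]; rewrite coefC //=.
  have := congr1 (fun p => p`_i) dAB; rewrite coef_deriv coef0 => /eqP.
  by rewrite mulrn_eq0 /= => /eqP.
have : (A - B).[1] = 0.
  rewrite /A /B hornerD hornerN !hornerZ hornerM !(hornerD, hornerN, hornerXn, hornerC).
  by rewrite !legendre_at1 expr1n !subrr mul0r !mulr0 subr0.
rewrite Hk hornerC => k0; move: Hk; rewrite k0.
by move/eqP; rewrite polyC0 subr_eq0 => /eqP.
Qed.

Lemma legendre_size_coef n : (size (L n) <= n.+1)%N /\ 0 < (L n)`_n.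
Proof.
elim: n => [|n [IHs IHc]].
  by rewrite legendre0 size_poly1 coef1 ltr01.
have H i : (L n.+1)`_i.+1 *+ i.+1 = ('X * (L n)^`())`_i + n.+1%:R * (L n)`_i.
  by rewrite -coef_deriv legendreS_deriv coefD coefZ.
split.
  apply/leq_sizeP => -[//|j] nj.
  have := H j; rewrite coefXM (leq_sizeP _ _ IHs j) // mulr0 addr0.
  case: j nj => [//|j] nj /=.
  rewrite coef_deriv (leq_sizeP _ _ IHs) // mul0rn => /eqP.
  by rewrite mulrn_eq0 => /eqP.
have := H n; rewrite coefXM; case: n IHs IHc H => [|n] IHs IHc H /=.
  by rewrite add0r mul1r mulr1n => ->.
rewrite coef_deriv => E; rewrite -(pmulrn_lgt0 _ (ltn0Sn n.+1)) E.
by rewrite addr_gt0 ?mulrn_wgt0 ?pmulrn_lgt0 ?mulr_gt0.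
Qed.

Lemma size_legendre n : size (L n) = n.+1.
Proof.
have [h1 h2] := legendre_size_coef n; apply/eqP; rewrite eqn_leq h1 /= ltnNge.
by apply/negP => h; rewrite (leq_sizeP _ _ h) ?ltxx in h2.
Qed.

Let hE := (horner_exp, hornerD, hornerN, hornerM, hornerZ, hornerMn, hornerX,
  hornerXn, hornerC).

Lemma poly_monotone p a b : a <= b ->
  (forall t, a < t < b -> 0 <= p^`().[t]) -> p.[a] <= p.[b].
Proof.
rewrite le_eqVlt => /predU1P[-> //|ab] H.
have [t /[!in_itv]/= tab E] := poly_mvt p ab.
by rewrite -subr_ge0 E mulr_ge0 ?H ?subr_ge0 ?ltW.
Qed.

(** With l = n (n + 1), the Legendre equation gives l L^2 + (1 - t^2) L'^2 the
    derivative 2 t L'^2: this energy is largest at the ends, where it is l. *)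
Lemma norm_legendre_le1 n t : -1 <= t <= 1 -> `|(L n).[t]| <= 1.
Proof.
case: n => [_|n /andP[t1 t2]]; first by rewrite legendre0 hornerC normr1.
pose l : R := n.+1%:R * n.+2%:R.
have l0 : 0 < l by rewrite mulr_gt0.
pose En := l *: (L n.+1) ^+ 2 + (1 - 'X ^+ 2) * (L n.+1)^`() ^+ 2.
have dE : En^`() = 2 * ('X * (L n.+1)^`() ^+ 2).
  have H := legendre_ode n.+1.
  have : (1 - 'X ^+ 2) * (L n.+1)^`()^`() = - l *: L n.+1 + 2 * ('X * (L n.+1)^`()).
    by rewrite /l -H !expr2 !(derivM, derivB, derivC, derivX); ring.
  rewrite /En !expr2 derivD derivZ !(derivM, derivB, derivC, derivX).
  rewrite -!mul_polyC polyCN => H'.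
  transitivity (l%:P * (2 * (L n.+1 * (L n.+1)^`())) - 2 * ('X * (L n.+1)^`() ^+ 2)
    + 2 * ((L n.+1)^`() * ((1 - 'X ^+ 2) * (L n.+1)^`()^`()))); first by ring.
  by rewrite H'; ring.
have : En.[t] <= l.
  have [t0|t0] := leP 0 t.
    have -> : l = En.[1].
      by rewrite /En !hE  legendre_at1 !expr1n subrr mul0r addr0 mulr1.
    apply: poly_monotone => // x /andP[x1 x2]; rewrite dE !hE.
    by rewrite mulr_ge0 // mulr_ge0 ?sqr_ge0 ?(le_trans t0) // ltW.
  have -> : l = En.[-1].
    rewrite /En !hE legendre_atN1 sqrrN expr1n subrr mul0r addr0.
    by rewrite -exprM mulnC exprM sqrrN !expr1n mulr1.
  rewrite -lerN2 -!hornerN.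
  apply: poly_monotone => // x /andP[x1 x2]; rewrite derivN dE !hE.
  rewrite -mulrN mulr_ge0 // -mulNr mulr_ge0 ?sqr_ge0 // oppr_ge0.
  by apply: ltW; apply: lt_trans t0.
rewrite /En !hE => H.
have : l * (L n.+1).[t] ^+ 2 <= l.
  apply: le_trans H; rewrite lerDl mulr_ge0 ?sqr_ge0 // subr_ge0.
  by rewrite expr2; nra.
by rewrite -[X in _ <= X]mulr1 ler_pM2l // -real_normK ?num_real // expr_le1.
Qed.

(** The left side is nonincreasing in n.  It bounds at 0 the energy used in
    legendre_diff_bound. *)
Lemma legendre_at0_step n :
  n.+1%:R * (L n).[0] ^+ 2 + n.+2%:R * (L n.+1).[0] ^+ 2 <= 1.
Proof.
have D m : (L m.+1)^`().[0] = m.+1%:R * (L m).[0].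
  have := congr1 (fun p => p.[0]) (legendre_deriv_eq m).
  by rewrite !hE expr0n /= subr0 mul1r mul0r subr0.
elim: n => [|n IH].
  by rewrite legendre0 legendre1 !hE expr0n mulr0 addr0 expr1n.
apply: le_trans IH; rewrite [leLHS]addrC lerD2r.
have := congr1 (fun p => p.[0]) (legendre_deriv_pred n.+1).
rewrite !hE D mul0r sub0r => E.
rewrite -(ler_pM2l (_ : 0 < n.+2%:R :> R)) //.
have -> : n.+2%:R * (n.+3%:R * (L n.+2).[0] ^+ 2) =
   n.+3%:R / n.+2%:R * (n.+1%:R * (L n).[0]) ^+ 2 :> R.
  by rewrite E; field.
rewrite exprMn mulrA [leRHS]mulrA ler_wpM2r ?sqr_ge0 //.
rewrite expr2 mulrA ler_wpM2r // mulrAC ler_pdivrMr // -!natrM ler_nat.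
nia.
Qed.

(** Up to a factor, L n.+2 - L n is Q = (1 - t^2) L', where L = L n.+1, and
    Q' = - l L.  The energy Q^2 + l (1 - t^2) L^2 has derivative - 2 l t L^2, hence is
    largest at 0, where legendre_at0_step applies.  The factor 1 / sqrt n gained over
    norm_legendre_le1 is the whole decay of the coefficients of a function of bounded
    variation. *)
Lemma legendre_diff_bound n t : -1 <= t <= 1 ->
  `|(L n.+2).[t] - (L n).[t]| <= 2 / Num.sqrt n.+1%:R.
Proof.
move=> /andP[t1 t2].
pose l : R := n.+1%:R * n.+2%:R.
have l0 : 0 < l by rewrite mulr_gt0.
pose Q := (1 - 'X ^+ 2) * (L n.+1)^`().
have dQ : Q^`() = - l *: L n.+1 by exact: legendre_ode.
pose G := Q ^+ 2 + l *: ((1 - 'X ^+ 2) * L n.+1 ^+ 2).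
have dG : G^`() = - (2 * l%:P * ('X * L n.+1 ^+ 2)).
  rewrite /G derivD derivZ !expr2 derivM dQ !(derivM, derivB, derivC, derivX).
  by rewrite -!mul_polyC polyCN /Q; ring.
have G0 : G.[0] <= n.+1%:R.
  have D : (L n.+1)^`().[0] = n.+1%:R * (L n).[0].
    have := congr1 (fun p => p.[0]) (legendre_deriv_eq n).
    by rewrite !hE expr0n /= subr0 mul1r mul0r subr0.
  rewrite /G /Q !hE D expr0n /= subr0 !mul1r.
  have := legendre_at0_step n; rewrite -(ler_pM2l (_ : 0 < n.+1%:R :> R)) // mulr1.
  by apply: le_trans; rewrite /l le_eqVlt; apply/orP; left; apply/eqP; ring.
have GQ : Q.[t] ^+ 2 <= n.+1%:R.
  have : G.[t] <= n.+1%:R.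
    apply: le_trans G0; have [t0|t0] := leP t 0.
      apply: poly_monotone => // x /andP[x1 x2]; rewrite dG !hE.
      rewrite oppr_ge0 mulr_ge0_le0 ?mulr_ge0 ?(ltW l0) //.
      by rewrite mulr_le0_ge0 ?sqr_ge0 // ltW.
    rewrite -lerN2 -!hornerN; apply: poly_monotone => [|x /andP[x1 x2]]; first exact: ltW.
    rewrite derivN dG opprK !hE; apply: mulr_ge0; first by rewrite mulr_ge0 ?(ltW l0).
    by rewrite mulr_ge0 ?sqr_ge0 ?(ltW x1).
  move=> H; apply: le_trans H; rewrite /G !hE lerDl.
  rewrite mulr_ge0 ?(ltW l0) // mulr_ge0 ?sqr_ge0 // subr_ge0 expr2; nra.
have E : (L n.+2).[t] - (L n).[t] = - ((2 * n.+1%:R + 1) / l) * Q.[t].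
  have := congr1 (fun p => p.[t]) (legendre_diff_deriv n).
  rewrite !hE -/l => H.
  apply: (mulfI (lt0r_neq0 l0)); rewrite -H.
  by field; rewrite ?lt0r_neq0.
have s0 : 0 < Num.sqrt n.+1%:R :> R by rewrite sqrtr_gt0.
rewrite ler_pdivlMr // -(@ler_pXn2r _ 2) ?nnegrE ?mulr_ge0 ?sqrtr_ge0 //.
rewrite exprMn sqr_sqrtr // real_normK ?num_real // E exprMn sqrrN.
have h : ((2 * n.+1%:R + 1) / l) ^+ 2 * (n.+1%:R * n.+1%:R) <= 2 ^+ 2 :> R.
  have -> : ((2 * n.+1%:R + 1) / l) ^+ 2 * (n.+1%:R * n.+1%:R) =
      ((2 * n.+1%:R + 1) / n.+2%:R) ^+ 2 :> R.
    have [h1 h2] : n.+1%:R != 0 :> R /\ n.+2%:R != 0 :> R by rewrite !pnatr_eq0.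
    rewrite /l; move: (n.+1%:R) (n.+2%:R) h1 h2 => a b ha hb.
    by field; rewrite ha hb.
  have P0 : 0 <= (2 * n.+1%:R + 1) / n.+2%:R :> R.
    by rewrite divr_ge0 // addr_ge0 // mulr_ge0.
  rewrite ler_pXn2r ?nnegrE //.
  by rewrite ler_pdivrMr // -(natr1 n.+1); lra.
apply: le_trans h; rewrite -mulrA ler_wpM2l ?sqr_ge0 //.
by rewrite ler_wpM2r.
Qed.

End LegendreAlgebra.

(** * Integration of polynomials and orthogonality *)

Section AlgebraicIntegral.
Context {R : realType}.
Implicit Types (n : nat) (p q : {poly R}).
Local Notation L := (@leg R).

Definition primp p : {poly R} :=
  \poly_(i < (size p).+1) (if i is j.+1 then p`_j / j.+1%:R else 0).

Lemma coef_primp p i : (primp p)`_i = if i is j.+1 then p`_j / j.+1%:R else 0.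
Proof.
rewrite coef_poly; case: i => [|i]; rewrite ?ltnS //.
by case: ltnP => // h; rewrite nth_default // mul0r.
Qed.

Lemma size_primp p : (size (primp p) <= (size p).+1)%N.
Proof. exact: size_poly. Qed.

Lemma deriv_primp p : (primp p)^`() = p.
Proof.
apply/polyP => i; rewrite coef_deriv coef_primp -[LHS]mulr_natr divfK // pnatr_eq0.
Qed.

Lemma primp_linear : linear primp.
Proof.
move=> a p q; apply/polyP => -[|i]; rewrite coefD coefZ !coef_primp ?mulr0 ?addr0 //.
by rewrite coefD coefZ mulrDl mulrA.
Qed.

HB.instance Definition _ :=
  GRing.isLinear.Build R {poly R} {poly R} *:%R primp primp_linear.

Lemma deriv_const p : p^`() = 0 -> p = (p`_0)%:P.
Proof.
move=> dp; apply/polyP => -[|i]; rewrite coefC //=.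
have /eqP := congr1 (fun p => p`_i) dp; rewrite coef_deriv coef0.
by rewrite mulrn_eq0 /= => /eqP.
Qed.

Lemma leq_size_deriv p : (size p^`() <= (size p).-1)%N.
Proof. by rewrite size_poly. Qed.

(** Exact algebraic version of the integral over [-1, 1]; itg_integ identifies the
    two. *)
Definition integ p : R := (primp p).[1] - (primp p).[-1].

Lemma integ_linear : linear_for *%R integ.
Proof.
move=> a p q; rewrite /integ linearP !hornerD !hornerZ; ring.
Qed.

HB.instance Definition _ :=
  GRing.isLinear.Build R {poly R} R *%R integ integ_linear.

Lemma integ0 : integ 0 = 0. Proof. exact: linear0. Qed.

Lemma integD p q : integ (p + q) = integ p + integ q.
Proof. exact: linearD. Qed.

Lemma integB p q : integ (p - q) = integ p - integ q.
Proof. exact: linearB. Qed.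

Lemma integZ a p : integ (a *: p) = a * integ p.
Proof. exact: linearZ. Qed.

Lemma integ_deriv p : integ p^`() = p.[1] - p.[-1].
Proof.
have /deriv_const : (primp p^`() - p)^`() = 0.
  by rewrite derivB deriv_primp subrr.
set k := (_`_0) => /eqP; rewrite subr_eq => /eqP E.
by rewrite /integ E !hornerD !hornerC; ring.
Qed.

Lemma integ_by_parts p q :
  integ (p^`() * q) = (p * q).[1] - (p * q).[-1] - integ (p * q^`()).
Proof. by rewrite -integ_deriv derivM integD addrK. Qed.

Lemma legendre_diff_ends n :
  ((L n.+2 - L n).[1] = 0) * ((L n.+2 - L n).[-1] = 0).
Proof.
rewrite !hornerD !hornerN !legendre_at1 !legendre_atN1 !exprS mulrA mulrNN !mul1r.
by rewrite !subrr.
Qed.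

Lemma legendre_scaled n (h : 0 < 2 * n.+1%:R + 1 :> R) :
  L n.+1 = (2 * n.+1%:R + 1)^-1 *: (L n.+2 - L n)^`().
Proof.
by rewrite derivB legendreS2_deriv addrK scalerA mulVf ?scale1r // lt0r_neq0.
Qed.

Let pos n : 0 < 2 * n.+1%:R + 1 :> R.
Proof. by rewrite addr_gt0 // mulr_gt0. Qed.

(** L n is a multiple of the derivative of L n.+1 - L n.-1, which vanishes at both
    ends: integrating by parts lowers the degree of q, and induction applies. *)
Lemma legendre_orth n q : (size q <= n)%N -> integ (L n * q) = 0.
Proof.
move=> h; have [d sd] : exists d, (size q <= d)%N by exists (size q).
elim: d n q h sd => [|d IH] n q h sd.
  by move: sd; rewrite size_poly_leq0 => /eqP ->; rewrite mulr0 integ0.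
case: n h => [|n] h.
  by move: h; rewrite size_poly_leq0 => /eqP ->; rewrite mulr0 integ0.
have [q0|q0] := eqVneq q 0; first by rewrite q0 mulr0 integ0.
have sq : (size q^`() < size q)%N by exact: lt_size_deriv.
rewrite (legendre_scaled (pos n)) -scalerAl integZ integ_by_parts.
rewrite !hornerM !legendre_diff_ends !mul0r subrr sub0r mulrBl integB.
by rewrite !IH ?subrr ?oppr0 ?mulr0 //; lia.
Qed.

Lemma legendre_norm n : integ (L n * L n) = 2 / (2 * n%:R + 1).
Proof.
case: n => [|n].
  rewrite legendre0 mulr1 mulr0 add0r divr1.
  have -> : (1 : {poly R}) = deriv 'X by rewrite derivX.
  by rewrite integ_deriv !hornerX opprK.
rewrite {1}(legendre_scaled (pos n)) -scalerAl integZ integ_by_parts.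
rewrite !hornerM !legendre_diff_ends !mul0r subrr sub0r mulrBl integB.
rewrite legendre_orth; last first.
  by rewrite (leq_trans (leq_size_deriv _)) // size_legendre.
rewrite sub0r opprK mulrC; congr (_ / _).
have : integ (L n * (L n.+1)^`()) = integ ((L n.+1)^`() * L n) by rewrite mulrC.
move=> ->; rewrite integ_by_parts legendre_orth; last first.
  by rewrite (leq_trans (leq_size_deriv _)) // size_legendre.
rewrite subr0 !hornerM !legendre_at1 !legendre_atN1 exprS -mulrA -exprD addnn.
by rewrite -mul2n exprM sqrrN !expr1n; ring.
Qed.

(** Subtracting from q the multiple of L n with the same coefficient of degree n
    leaves a polynomial orthogonal to L n. *)
Lemma integ_legendre_lead n q : (size q <= n.+1)%N ->
  integ (L n * q) = q`_n / (L n)`_n * (2 / (2 * n%:R + 1)).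
Proof.
move=> sq; have l0 : (L n)`_n != 0 by have [_ /lt0r_neq0] := @legendre_size_coef R n.
pose a := q`_n / (L n)`_n.
have : integ (L n * (q - a *: L n)) = 0.
  apply: legendre_orth; apply/leq_sizeP => j; rewrite leq_eqVlt => /predU1P[<-|nj].
    by rewrite coefB coefZ /a divfK // subrr.
  by rewrite coefB coefZ !nth_default ?size_legendre ?(leq_trans sq) // mulr0 subrr.
rewrite mulrBr integB -scalerAr integZ legendre_norm => /eqP.
by rewrite subr_eq0 => /eqP.
Qed.

End AlgebraicIntegral.

(** * Legendre-Gauss-Lobatto nodes *)

Section Nodes.
Context {R : realType}.
Local Notation L := (@leg R).

Lemma path_lt_widen (a b : R) s : a < b -> path <%R b s -> path <%R a s.
Proof. by case: s => //= c s ab /andP[bc ->]; rewrite (lt_trans ab bc). Qed.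

(** The new roots are kept strictly between a and the last old one so that the
    lemma can be iterated. *)
Lemma rolle_seq (p : {poly R}) (a : R) (s : seq R) :
  path <%R a s -> all (root p) (a :: s) ->
  exists s', [/\ size s' = size s, path <%R a s', all (root p^`()) s'
    & all (fun x => x < last a s) s'].
Proof.
elim: s a => [|b s IH] a; first by exists [::].
move=> /= /andP[ab bs] /and3P[pa pb ps].
have [|s' [sz sp sr sl]] := IH b bs; first by rewrite /= pb.
have [|c /[!in_itv]/= /andP[ac cb] /eqP pc] := @poly_rolle _ a b p ab.
  by rewrite (eqP pa) (eqP pb).
exists (c :: s'); split => /=; first by rewrite sz.
- by rewrite ac (path_lt_widen cb sp).
- by rewrite sr andbT.
rewrite sl andbT; apply: (lt_le_trans cb).
case: s bs {IH ps sz sl} => //= d s /andP[bd ds].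
apply/ltW/(lt_le_trans bd); elim: s d ds {bd} => //= e s IHs d /andP[de es].
by rewrite (le_trans (ltW de)) ?IHs.
Qed.

Lemma derivn_exp_dvd (w : {poly R}) k j :
  exists r, derivn j (w ^+ (k + j)) = w ^+ k * r.
Proof.
elim: j k => [|j IH] k; first by exists 1; rewrite addn0 mulr1.
have [r E] := IH k.+1.
exists (w^`() * r *+ k.+1 + w * r^`()).
rewrite addnS -addSn derivnS E derivM deriv_exp /=.
have M (a : {poly R}) : a *+ k.+1 = (k.+1%:R)%:P * a by rewrite polyC_natr mulr_natl.
by rewrite !M exprS; ring.
Qed.

(** Before the N-th derivative the ends -1 and 1 remain roots, so that Rolle's
    theorem creates one more root at each step. *)
Lemma rodrigues_roots N j : (j <= N)%N ->
  exists s : seq R, [/\ size s = j, path <%R (-1) s,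
    all (root (derivn j (('X ^+ 2 - 1 : {poly R}) ^+ N))) s & all (fun x => x < 1) s].
Proof.
elim: j => [|j IH] jN; first by exists [::].
have [s [sz sp sr sl]] := IH (ltnW jN).
have ends x : x ^+ 2 = 1 -> root (derivn j (('X ^+ 2 - 1 : {poly R}) ^+ N)) x.
  move=> x2; have [r] := derivn_exp_dvd ('X ^+ 2 - 1) (N - j) j.
  rewrite subnK ?(ltnW jN) // => ->; rewrite /root hornerM horner_exp.
  rewrite hornerD hornerN hornerXn hornerC x2 subrr expr0n.
  by rewrite subn_eq0 leqNgt jN mul0r.
have [||s' [sz' sp' sr' sl']] := @rolle_seq (derivn j (('X ^+ 2 - 1) ^+ N)) (-1) (rcons s 1).
- rewrite rcons_path sp /=; case: s sl {sz sp sr} => [|a s] sl /=; first by lra.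
  by move/allP: sl; apply; rewrite mem_last.
- by rewrite /= all_rcons sr !ends ?expr1n ?sqrrN ?expr1n.
exists s'; split => //; first by rewrite sz' size_rcons sz.
by apply: sub_all sl' => x; rewrite last_rcons.
Qed.

Lemma legendre_deriv_roots N : (0 < N)%N ->
  exists s : seq R, [/\ size s = N.-1, path <%R (-1) s,
    all (root (L N)^`()) s & all (fun x => x < 1) s].
Proof.
move=> N0; have [s [sz sp sr sl]] := rodrigues_roots (leqnn N).
case: s sz sp sr sl => [|a s] sz; first by rewrite -sz in N0.
move=> /= /andP[a1 sp] sr /andP[al sl].
have rL x : root (derivn N (('X ^+ 2 - 1 : {poly R}) ^+ N)) x -> root (L N) x.
  by rewrite -legE /legendre => /eqP h; rewrite /root hornerZ h mulr0.
have rs : all (root (L N)) (a :: s).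
  by move: sr => /= /andP[/rL -> rs]; apply: sub_all rs.
have [s' [sz' sp' sr' sl']] := rolle_seq sp rs.
exists s'; split => //; first by rewrite sz' -sz.
  exact: path_lt_widen sp'.
have al1 : last a s < 1.
  have /allP h : all (fun x => x < 1) (a :: s) by rewrite /= al.
  by apply: h; rewrite mem_last.
by apply: sub_all sl' => x h; apply: lt_trans al1.
Qed.

Definition nodes N : seq R := -1 :: rcons (rootsR (L N)^`()) 1.

Lemma nodeE N k : @node R N k = nth 0 (nodes N) k.
Proof. by rewrite /node legE. Qed.

Lemma deriv_legendre_neq0 N : (0 < N)%N -> (L N)^`() != 0.
Proof.
move=> N0; apply/eqP => /(congr1 (fun p : {poly R} => p`_N.-1)).
rewrite coef_deriv coef0 prednK // => /eqP; rewrite mulrn_eq0.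
have [_ h] := @legendre_size_coef R N.
by rewrite (negbTE (lt0r_neq0 h)) orbF => /eqP h0; rewrite h0 in N0.
Qed.

(** Rolle provides N - 1 roots of L_N', as many as its degree allows. *)
Lemma rootsR_spec N : (0 < N)%N -> let s := rootsR (L N)^`() in
  [/\ size s = N.-1, path <%R (-1) s & all (fun x => x < 1) s].
Proof.
move=> N0; rewrite /=; set s := rootsR _.
have [s' [sz sp sr sl]] := legendre_deriv_roots N0.
have ss : sorted <%R s by exact: sorted_roots.
have us : uniq s by exact: lt_sorted_uniq.
have us' : uniq s' by apply: lt_sorted_uniq; case: (s') sp => //= a l /andP[].
have Lnz := deriv_legendre_neq0 N0.
have mem x : (x \in s) = root (L N)^`() x.
  by have := roots_on_rootsR Lnz => /(_ x); rewrite in_itv /= => <-.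
have sub : {subset s' <= s} by move=> x xs; rewrite mem; apply: (allP sr).
have szs : (size s <= size s')%N.
  have := @max_poly_roots _ (L N)^`() s Lnz.
  have -> : all (root (L N)^`()) s by apply/allP => x; rewrite mem.
  move=> /(_ isT us); rewrite sz => h; rewrite -ltnS prednK //.
  by apply: (leq_trans h); rewrite (leq_trans (leq_size_deriv _)) // size_legendre.
have [sz2 mem2] := uniq_min_size us' sub szs.
have -> : s = s' by apply: lt_sorted_eq => //; case: (s') sp => //= a l /andP[].
by [].
Qed.

Variable N : nat.
Hypothesis N0 : (0 < N)%N.
Local Notation t := (@node R N).

Lemma size_nodes : size (nodes N) = N.+1.
Proof. by rewrite /= size_rcons; have [-> _ _] := rootsR_spec N0; rewrite prednK. Qed.

Lemma sorted_nodes : sorted <%R (nodes N).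
Proof.
have [_ sp sl] := rootsR_spec N0; rewrite /= rcons_path sp /=.
move: sl; case: (rootsR _) => [|a s] sl /=; first by lra.
by move/allP: sl; apply; rewrite mem_last.
Qed.

Lemma node_inj : injective t.
Proof.
move=> i j; rewrite !nodeE => /eqP; rewrite nth_uniq ?size_nodes //.
  by move=> /eqP; apply: val_inj.
exact: lt_sorted_uniq sorted_nodes.
Qed.

Lemma node_first : t ord0 = -1. Proof. by []. Qed.

Lemma node_last : t ord_max = 1.
Proof.
rewrite nodeE /= /nodes; have [sz _ _] := rootsR_spec N0.
by rewrite -{2}(prednK N0) /= nth_rcons sz ltnn eqxx.
Qed.

Lemma node_interior i : i != ord0 -> i != ord_max ->
  (L N)^`().[t i] = 0.
Proof.
move=> i0 iN; rewrite nodeE /nodes; have [sz _ _] := rootsR_spec N0.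
have i1 : (0 < i)%N by rewrite lt0n; apply: contra i0 => /eqP h; apply/eqP/val_inj.
have i2 : (i < N)%N.
  by rewrite ltn_neqAle -ltnS ltn_ord andbT; apply: contra iN => /eqP h; apply/eqP/val_inj.
rewrite -(prednK i1) /= nth_rcons sz.
have -> : (i.-1 < N.-1)%N by lia.
have := roots_on_rootsR (deriv_legendre_neq0 N0).
move=> /(_ (nth 0 (rootsR (L N)^`()) i.-1)).
by rewrite in_itv /= mem_nth ?sz; [move=> /eqP|lia].
Qed.

Lemma node_bound i : -1 <= t i <= 1.
Proof.
have [sz sp sl] := rootsR_spec N0.
have [->|i0] := eqVneq i ord0; first by rewrite node_first; lra.
have [->|iN] := eqVneq i ord_max; first by rewrite node_last; lra.
rewrite nodeE /nodes.
have i1 : (0 < i)%N by rewrite lt0n; apply: contra i0 => /eqP h; apply/eqP/val_inj.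
have i2 : (i < N)%N.
  by rewrite ltn_neqAle -ltnS ltn_ord andbT; apply: contra iN => /eqP h; apply/eqP/val_inj.
rewrite -(prednK i1) /= nth_rcons sz.
have h : (i.-1 < N.-1)%N by lia.
rewrite h; have m : nth 0 (rootsR (L N)^`()) i.-1 \in rootsR (L N)^`().
  by rewrite mem_nth ?sz.
rewrite (ltW (allP sl _ m)) andbT.
by have := order_path_min lt_trans sp => /allP /(_ _ m) /ltW.
Qed.

End Nodes.

(** * Differentiation matrix and quadrature *)

Section LGLRules.
Context {R : realType}.
Local Notation L := (@leg R).
Variable N : nat.
Hypothesis N0 : (0 < N)%N.
Local Notation t := (@node R N).
Implicit Types (p q : {poly R}) (i k : 'I_N.+1).

Let lam : R := (N * N.+1)%N%:R.

Let lam_gt0 : 0 < lam.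
Proof. by rewrite ltr0n muln_gt0 N0. Qed.

(** Vanishes exactly at the nodes.  Its derivative is a multiple of L N by the
    Legendre equation, whence the closed forms of the matrix and of the weights. *)
Definition nodal : {poly R} := ('X ^+ 2 - 1) * (L N)^`().

Lemma nodal_node k : nodal.[t k] = 0.
Proof.
rewrite /nodal hornerM hornerD hornerN hornerXn hornerC.
have [->|k0] := eqVneq k ord0; first by rewrite node_first sqrrN expr1n subrr mul0r.
have [->|kN] := eqVneq k ord_max; first by rewrite node_last // expr1n subrr mul0r.
by rewrite node_interior // mulr0.
Qed.

Lemma deriv_nodal : nodal^`() = lam *: L N.
Proof.
rewrite /nodal -(opprB 1 ('X ^+ 2)) mulNr derivN legendre_ode scaleNr opprK.
by rewrite /lam natrM.
Qed.

Lemma size_deriv_legendre : size (L N)^`() = N.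
Proof.
apply/eqP; rewrite eqn_leq; apply/andP; split.
  by rewrite (leq_trans (leq_size_deriv _)) // size_legendre.
rewrite leqNgt; apply/negP => h.
have : (L N)^`()`_N.-1 = 0 by rewrite nth_default // -ltnS prednK.
rewrite coef_deriv prednK // => /eqP; rewrite mulrn_eq0.
have [_ c] := @legendre_size_coef R N.
by rewrite (negbTE (lt0r_neq0 c)) orbF eqn0Ngt N0.
Qed.

Lemma size_Xsqr_sub1 : size ('X ^+ 2 - 1 : {poly R}) = 3%N.
Proof. by rewrite -polyC1 size_XnsubC. Qed.

Lemma size_nodal : size nodal = N.+2.
Proof.
rewrite /nodal size_mul ?size_Xsqr_sub1 ?size_deriv_legendre //.
- by rewrite -size_poly_gt0 size_Xsqr_sub1.
- by rewrite -size_poly_gt0 size_deriv_legendre.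
Qed.

(** By the recurrences, a common root of L n.+1 and its derivative is also one of
    L n and its derivative; descent ends at L 0 = 1. *)
Lemma legendre_no_double_root n c : (L n).[c] = 0 -> (L n)^`().[c] = 0 -> False.
Proof.
elim: n => [|n IH] h h'.
  by move: h; rewrite legendre0 hornerC => /eqP; rewrite oner_eq0.
apply: IH.
  have := congr1 (fun p => p.[c]) (@legendre_deriv_eq R n).
  rewrite /= !hornerM hornerZ hornerD hornerN hornerM h h' !mulr0 subr0 => /esym/eqP.
  by rewrite mulf_eq0 pnatr_eq0 /= => /eqP.
rewrite legendre_deriv_pred hornerD hornerN hornerZ hornerM h h'.
by rewrite !mulr0 subr0.
Qed.

Lemma legendre_node_neq0 k : (L N).[t k] != 0.
Proof.
have [->|k0] := eqVneq k ord0.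
  by rewrite node_first legendre_atN1 expf_neq0 // oppr_eq0 oner_eq0.
have [->|kN] := eqVneq k ord_max; first by rewrite node_last // legendre_at1 oner_eq0.
by apply/eqP => h; apply: (legendre_no_double_root h); apply: node_interior.
Qed.

(** A multiple of the Lagrange basis polynomial of the k-th node. *)
Definition nodal_div k : {poly R} := nodal %/ ('X - (t k)%:P).

Lemma nodal_divE k : nodal = nodal_div k * ('X - (t k)%:P).
Proof. by rewrite divpK // dvdp_XsubCl; apply/eqP/nodal_node. Qed.

Lemma size_nodal_div k : size (nodal_div k) = N.+1.
Proof. by rewrite size_divp ?polyXsubC_eq0 // size_XsubC size_nodal subn1. Qed.

Lemma nodal_div_ne k i : i != k -> (nodal_div k).[t i] = 0.
Proof.
move=> ik; have := nodal_node i; rewrite (nodal_divE k) hornerM hornerXsubC => /eqP.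
rewrite mulf_eq0 subr_eq0 (inj_eq (@node_inj _ _ N0)) (negbTE ik) orbF.
by move/eqP.
Qed.

Lemma deriv_nodal_div k :
  nodal^`() = (nodal_div k)^`() * ('X - (t k)%:P) + nodal_div k.
Proof. by rewrite {1}(nodal_divE k) derivM derivXsubC mulr1. Qed.

Lemma nodal_div_eq k : (nodal_div k).[t k] = lam * (L N).[t k].
Proof.
have := congr1 (fun p => p.[t k]) (deriv_nodal_div k).
by rewrite deriv_nodal hornerZ hornerD hornerM hornerXsubC subrr mulr0 add0r.
Qed.

Lemma deriv_nodal_div_ne k i : i != k ->
  (nodal_div k)^`().[t i] = lam * (L N).[t i] / (t i - t k).
Proof.
move=> ik; have := congr1 (fun p => p.[t i]) (deriv_nodal_div k).
rewrite deriv_nodal hornerZ hornerD hornerM hornerXsubC nodal_div_ne // addr0 => ->.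
by rewrite mulfK // subr_eq0 (inj_eq (@node_inj _ _ N0)).
Qed.

Lemma deriv_nodal_div_eq k : (nodal_div k)^`().[t k] = lam * (L N)^`().[t k] / 2.
Proof.
have := congr1 (fun p => p^`().[t k]) (deriv_nodal_div k).
rewrite deriv_nodal derivZ hornerZ derivD derivM derivXsubC mulr1 !hornerD hornerM.
rewrite hornerXsubC subrr mulr0 add0r => ->.
by field.
Qed.

Lemma poly_eq_nodes p q : (size p <= N.+1)%N -> (size q <= N.+1)%N ->
  (forall k, p.[t k] = q.[t k]) -> p = q.
Proof.
move=> sp sq e; apply/eqP; rewrite -subr_eq0; apply: contraT => d0.
have := @max_poly_roots _ (p - q) [seq t k | k <- enum 'I_N.+1] d0.
rewrite size_map size_enum_ord map_inj_uniq ?enum_uniq; last exact: node_inj.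
have -> : all (root (p - q)) [seq t k | k <- enum 'I_N.+1].
  by apply/allP => _ /mapP[k _ ->]; rewrite /root hornerD hornerN e subrr.
move=> /(_ isT isT); rewrite ltnNge => /negP[].
by rewrite (leq_trans (size_polyD _ _)) // size_polyN geq_max sp.
Qed.

Lemma lagrange p : (size p <= N.+1)%N ->
  p = \sum_k (p.[t k] / (lam * (L N).[t k])) *: nodal_div k.
Proof.
move=> sp; apply: poly_eq_nodes => //.
  apply: (leq_trans (size_sum _ _ _)); apply/bigmax_leqP => k _.
  by rewrite (leq_trans (size_scale_leq _ _)) // size_nodal_div.
move=> k; rewrite horner_sum (bigD1 k) //= big1 ?addr0; last first.
  by move=> i ik; rewrite hornerZ nodal_div_ne 1?eq_sym // mulr0.
by rewrite hornerZ nodal_div_eq divfK // mulf_neq0 ?legendre_node_neq0 // lt0r_neq0.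
Qed.

Let ode_at c : c ^+ 2 = 1 -> 2 * c * (L N)^`().[c] = lam * (L N).[c].
Proof.
move=> c2; have d : (1 - 'X ^+ 2 : {poly R})^`() = - (2%:R)%:P * 'X.
  by rewrite expr2 derivB derivM derivX derivC polyC_natr; ring.
have := congr1 (fun p => p.[c]) (@legendre_ode R N).
rewrite derivM d hornerZ !(horner_exp, hornerD, hornerM, hornerN, hornerC, hornerX, hornerXn) c2.
rewrite subrr mul0r addr0 /lam natrM => H.
by move: H; rewrite ?(hornerMn, hornerC) => H; lra.
Qed.

Lemma deriv_legendre_at1 : (L N)^`().[1] = lam / 2 * (L N).[1].
Proof.
have := ode_at (expr1n _ 2); rewrite mulr1 => H.
by rewrite mulrAC -H; field.
Qed.

Lemma deriv_legendre_atN1 : (L N)^`().[-1] = - (lam / 2 * (L N).[-1]).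
Proof.
have := @ode_at (-1); rewrite sqrrN expr1n => /(_ erefl) H.
by rewrite mulrAC -H; field.
Qed.

Definition nodal_values p : 'cV[R]_N.+1 := \col_k p.[t k].

(** The entries of the matrix are the values at the nodes of the derivatives of
    the Lagrange basis, obtained by differentiating nodal = nodal_div k * ('X - t k). *)
Lemma lgl_diff_correct p : (size p <= N.+1)%N ->
  lgl_diff N *m nodal_values p = nodal_values p^`().
Proof.
move=> sp; apply/colP => i; rewrite !mxE.
rewrite {2}(lagrange sp) (raddf_sum (@deriv R)) horner_sum; apply: eq_bigr => k _.
rewrite !mxE !legE /= derivZ hornerZ [LHS]mulrC -[RHS]mulrA; congr (_ * _).
have lk := legendre_node_neq0 k; have l0 := lt0r_neq0 lam_gt0.
case: ifPn => [ik|]; last rewrite negbK => /eqP <-.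
  rewrite deriv_nodal_div_ne //.
  have : t i - t k != 0 by rewrite subr_eq0 (inj_eq (@node_inj _ _ N0)).
  by move: l0; generalize lam => l l0 h; field; rewrite l0 lk h.
rewrite deriv_nodal_div_eq -/lam; have li := legendre_node_neq0 i.
have [->|i0] := eqVneq i ord0.
  have := legendre_node_neq0 ord0; rewrite node_first deriv_legendre_atN1.
  by move: l0; generalize lam => l l0 h; field; rewrite l0 h.
have [->|iN] := eqVneq i ord_max.
  have := legendre_node_neq0 ord_max; rewrite node_last // deriv_legendre_at1.
  by move: l0; generalize lam => l l0 h; field; rewrite l0 h.
by rewrite node_interior // !(mulr0, mul0r).
Qed.

Lemma lgl_diff_iter j p : (size p <= N.+1)%N ->
  lgl_diff N ^+ j *m nodal_values p = nodal_values (derivn j p).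
Proof.
move=> sp; elim: j => [|j IH]; first by rewrite expr0 mul1mx.
rewrite exprS -mulmxE -mulmxA IH lgl_diff_correct ?derivnS //.
elim: j {IH} => [//|j IH]; rewrite derivnS (leq_trans (leq_size_deriv _)) //.
by rewrite (leq_trans (leq_pred _)).
Qed.

Definition quadrature p : R := \sum_(k < N.+1) weight k * p.[t k].

Let coefs_lead k (s : {poly R}) : (L N) - (L N).[t k]%:P = s * ('X - (t k)%:P) ->
  s`_N.-1 = (L N)`_N /\ (size s <= N)%N.
Proof.
move=> E.
have s0 : s != 0.
  apply: contraTneq isT => s0; move: E; rewrite s0 mul0r => /eqP; rewrite subr_eq0 => /eqP E.
  have := @size_legendre R N; rewrite E => h.
  by have := size_polyC_leq1 ((L N).[t k]); rewrite h; lia.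
have sz : (size s <= N)%N.
  have : (size (s * ('X - (t k)%:P))%R <= N.+1)%N.
    rewrite -E (leq_trans (size_polyD _ _)) // size_polyN geq_max size_legendre leqnn /=.
    by rewrite (leq_trans (size_polyC_leq1 _)).
  by rewrite size_Mmonic ?monicXsubC // size_XsubC; lia.
split=> //; have := congr1 (fun p => p`_N) E.
rewrite coefB coefC eqn0Ngt N0 /= subr0 => ->.
by rewrite mulrBr coefB coefMX coefMC eqn0Ngt N0 /= [X in _ - X * _]nth_default ?mul0r ?subr0.
Qed.

Let size_deriv_mul q : (size q <= N)%N -> (size (('X ^+ 2 - 1) * q)^`() <= N.+1)%N.
Proof.
move=> sq; rewrite (leq_trans (leq_size_deriv _)) // -subn1 leq_subLR add1n.
rewrite (leq_trans (size_polyMleq _ _)) // size_Xsqr_sub1.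
by move: (size q) sq => k; lia.
Qed.

(** Integrating by parts moves the derivative of L N onto ('X ^+ 2 - 1) * q: the
    end terms vanish, and what remains has degree less than N. *)
Lemma integ_nodal q : (size q <= N.-1)%N -> integ (nodal * q) = 0.
Proof.
move=> sq; have -> : nodal * q = (L N)^`() * (('X ^+ 2 - 1) * q).
  by rewrite /nodal; ring.
rewrite integ_by_parts legendre_orth.
  rewrite !hornerM !hornerD !hornerN !hornerXn !hornerC sqrrN expr1n subrr.
  by rewrite !mul0r !mulr0 !subrr.
rewrite (leq_trans (leq_size_deriv _)) // -subn1 leq_subLR add1n.
rewrite (leq_trans (size_polyMleq _ _)) // size_Xsqr_sub1.
by move: (size q) sq => k; lia.
Qed.

(** Replacing the number L N (t k) by L N - s * ('X - t k) splits the integral into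
    one of L N against nodal_div k and one of nodal against s, both of which depend only
    on leading coefficients.  This is what produces the closed form of the weights. *)
Lemma integ_nodal_div k : integ (nodal_div k) * (L N).[t k] = 2.
Proof.
have [s E] : exists s, L N - (L N).[t k]%:P = s * ('X - (t k)%:P).
  by apply/factor_theorem; rewrite /root hornerD hornerN hornerC subrr.
have [sl sz] := coefs_lead E.
have [_ c0] := @legendre_size_coef R N; have {}c0 := lt0r_neq0 c0.
have lead : (nodal_div k)`_N = N%:R * (L N)`_N.
  have := congr1 (fun p => p`_N.+1) (nodal_divE k).
  rewrite mulrBr coefB coefMX coefMC [X in _ - X * _]nth_default ?size_nodal_div //.
  rewrite mul0r subr0 /= => <-.
  rewrite /nodal mulrBl mul1r coefB coefXnM /= [X in _ - X]nth_default; last first.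
    by rewrite size_deriv_legendre; lia.
  rewrite subr0 subn2 /= coef_deriv prednK // mulr_natl.
  by case: ltnP => //; lia.
have H1 : integ (L N * nodal_div k) = N%:R * (2 / (2 * N%:R + 1)).
  by rewrite integ_legendre_lead ?size_nodal_div // lead mulfK.
have H2 : integ (nodal * s) = - (N.+1%:R * (2 / (2 * N%:R + 1))).
  have -> : nodal * s = (L N)^`() * (('X ^+ 2 - 1) * s).
    by rewrite /nodal; ring.
  rewrite integ_by_parts integ_legendre_lead; last exact: size_deriv_mul.
  rewrite !hornerM !hornerD !hornerN !hornerXn !hornerC sqrrN expr1n subrr.
  rewrite !mul0r !mulr0 !subrr sub0r; congr (- (_ * _)).
  rewrite coef_deriv mulrBl mul1r coefB coefXnM /= [X in _ - X]nth_default; last first.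
    by rewrite (leq_trans sz).
  rewrite subr0 subn2 /= sl ltnS ltnNge N0 /= -(mulr_natl (L N)`_N) mulfK //.
have H3 : (L N).[t k] *: nodal_div k = L N * nodal_div k - nodal * s.
  rewrite (nodal_divE k) -mul_polyC.
  have -> : (L N).[t k]%:P = L N - s * ('X - (t k)%:P) by rewrite -E subKr.
  by rewrite mulrBl; ring.
rewrite mulrC -integZ H3 integB H1 H2 -(natr1 N).
have : 2 * N%:R + 1 != 0 :> R by rewrite lt0r_neq0 // addr_gt0 // mulr_gt0 // ltr0n.
by move: (N%:R) => x hx; field.
Qed.

(** Divide by nodal: the multiple of nodal vanishes at the nodes and integrates to
    zero, and the remainder is a combination of the Lagrange basis. *)
Lemma quadrature_exact p : (size p <= 2 * N)%N -> quadrature p = integ p.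
Proof.
move=> sp; have w0 : nodal != 0 by rewrite -size_poly_gt0 size_nodal.
pose r := p %% nodal; pose s := p %/ nodal.
have Ep : p = s * nodal + r by exact: divp_eq.
have sr : (size r <= N.+1)%N by rewrite -ltnS -size_nodal ltn_modp.
have ss : (size s <= N.-1)%N by rewrite /s size_divp // size_nodal; move: (size p) sp => k; lia.
have -> : integ p = integ r by rewrite Ep integD mulrC integ_nodal // add0r.
have -> : quadrature p = quadrature r.
  apply: eq_bigr => k _; rewrite Ep.
  by rewrite hornerD hornerM nodal_node mulr0 add0r.
rewrite [in RHS](lagrange sr).
rewrite (raddf_sum (@integ R)); apply: eq_bigr => k _.
rewrite /= integZ /weight legE -/lam.
have l0 := lt0r_neq0 lam_gt0; have lk := legendre_node_neq0 k.
have <- := integ_nodal_div k.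
by move: l0; generalize lam => l l0; field; rewrite l0 lk.
Qed.

Lemma spectral_coefE m1 p n : (size p <= N.+1)%N ->
  spectral_coef m1 (nodal_values p) n =
  (n%:R + 1 / 2) * quadrature (L n * derivn m1 p).
Proof.
move=> sp; rewrite /spectral_coef; congr (_ * _); apply: eq_bigr => k _.
by rewrite lgl_diff_iter // mxE legE hornerM; ring.
Qed.

End LGLRules.

(** * Bounded measurable functions *)

Section BoundedMeasurable.
Context {R : realType}.
Local Open Scope classical_set_scope.
Notation mu := (@lebesgue_measure R).
Implicit Types (f g : R -> R) (a b c C : R).

(** The class of integrands: it contains the highest derivative, which need not be
    continuous, is stable under products, and is integrable on every subinterval. *)
Definition bmeas f := measurable_fun `[(-1 : R), 1] f /\
  exists C, forall t, -1 <= t <= 1 -> `|f t| <= C.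

Definition itg a b f := \int[mu]_(t in `[a, b]) f t.

Lemma bmeas_integrable f a b : bmeas f -> -1 <= a -> b <= 1 ->
  mu.-integrable `[a, b] (EFin \o f).
Proof.
move=> [mf [C fC]] a1 b1; apply: measurable_bounded_integrable => //.
- by rewrite /= lebesgue_measure_itv /=; case: ifP => // _; rewrite -EFinB ltry.
- apply: measurable_funS mf => //.
  by apply: subset_itv; rewrite bnd_simp.
- exists C; split; first exact: num_real.
  move=> M CM t /=; rewrite in_itv /= => /andP[ta tb].
  by rewrite (le_trans (fC _ _)) ?(ltW CM) // (le_trans a1 ta) (le_trans tb b1).
Qed.

Lemma bmeasD f g : bmeas f -> bmeas g -> bmeas (fun t => f t + g t).
Proof.
move=> [mf [C fC]] [mg [D gD]]; split; first exact: measurable_funD.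
by exists (C + D) => t ht; rewrite (le_trans (ler_normD _ _)) ?lerD ?fC ?gD.
Qed.

Lemma bmeasM f g : bmeas f -> bmeas g -> bmeas (fun t => f t * g t).
Proof.
move=> [mf [C fC]] [mg [D gD]]; split; first exact: measurable_funM.
by exists (C * D) => t ht; rewrite normrM ler_pM ?fC ?gD.
Qed.

Lemma bmeas_cst c : bmeas (fun=> c).
Proof. by split=> //; exists `|c|. Qed.

Lemma bmeasN f : bmeas f -> bmeas (fun t => - f t).
Proof.
move=> /(bmeasM (bmeas_cst (-1))) h.
by rewrite (_ : (fun t => - f t) = (fun t => -1 * f t)) //; apply/funext => t; rewrite mulN1r.
Qed.

Lemma bmeasB f g : bmeas f -> bmeas g -> bmeas (fun t => f t - g t).
Proof. by move=> hf hg; apply: bmeasD => //; apply: bmeasN. Qed.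

Lemma bmeas_cont f : {within `[(-1 : R), 1], continuous f} -> bmeas f.
Proof.
move=> cf; split.
  by apply: subspace_continuous_measurable_fun => //; exact: measurable_itv.
have [M [_ HM]] := compact_bounded (continuous_compact cf (@segment_compact _ (-1) 1)).
exists (M + 1) => t ht; apply: (HM (M + 1)); first by rewrite ltrDl.
by exists t => //=; rewrite in_itv.
Qed.

Lemma bmeas_poly (p : {poly R}) : bmeas (horner p).
Proof. by apply: bmeas_cont; apply: continuous_subspaceT; exact: continuous_horner. Qed.

End BoundedMeasurable.

Ltac bmeas_tac := repeat first [assumption | exact: bmeas_poly | exact: bmeas_cst
  | apply: bmeasB | apply: bmeasD | apply: bmeasM | apply: bmeasN].

(** * Integration on subintervals *)

Section Integrals.
Context {R : realType}.
Local Open Scope classical_set_scope.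
Notation mu := (@lebesgue_measure R).
Implicit Types (f g : R -> R) (a b c C : R).

Section FixedBounds.
Variables a b : R.
Hypotheses (a1 : -1 <= a) (ab : a <= b) (b1 : b <= 1).

Lemma eq_itg f g : (forall t, a <= t <= b -> f t = g t) -> itg a b f = itg a b g.
Proof.
move=> fg; apply: eq_Rintegral => t; rewrite inE /= in_itv /=; exact: fg.
Qed.

Lemma itgD f g : bmeas f -> bmeas g ->
  itg a b (fun t => f t + g t) = itg a b f + itg a b g.
Proof. by move=> hf hg; apply: RintegralD => //; apply: bmeas_integrable. Qed.

Lemma itgB f g : bmeas f -> bmeas g ->
  itg a b (fun t => f t - g t) = itg a b f - itg a b g.
Proof. by move=> hf hg; apply: RintegralB => //; apply: bmeas_integrable. Qed.

Lemma itgZ c f : bmeas f -> itg a b (fun t => c * f t) = c * itg a b f.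
Proof. by move=> hf; apply: RintegralZl => //; apply: bmeas_integrable. Qed.

Lemma itg_cst c : itg a b (fun=> c) = c * (b - a).
Proof.
rewrite /itg Rintegral_cst //= lebesgue_measure_itv /= lte_fin.
move: ab; rewrite le_eqVlt => /predU1P[->|->]; last by rewrite -EFinB.
by rewrite ltxx /= subrr.
Qed.

Lemma le_itg f g : bmeas f -> bmeas g ->
  (forall t, a <= t <= b -> f t <= g t) -> itg a b f <= itg a b g.
Proof.
move=> hf hg fg; apply: le_Rintegral => //; try exact: bmeas_integrable.
Qed.

Lemma norm_itg_le f C : bmeas f -> (forall t, a <= t <= b -> `|f t| <= C) ->
  `|itg a b f| <= C * (b - a).
Proof.
move=> hf fC; rewrite ler_norml -mulNr -!itg_cst; apply/andP; split.
  apply: le_itg => //; first exact: bmeas_cst.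
  by move=> t /fC; rewrite ler_norml => /andP[].
apply: le_itg => //; first exact: bmeas_cst.
by move=> t /fC; rewrite ler_norml => /andP[].
Qed.

Lemma norm_itg_le_itg f g : bmeas f -> bmeas g ->
  (forall t, a <= t <= b -> `|f t| <= g t) -> `|itg a b f| <= itg a b g.
Proof.
move=> hf hg fg; rewrite ler_norml; apply/andP; split; last first.
  by apply: le_itg => // t /fg; rewrite ler_norml => /andP[].
rewrite lerNl -[- _]mulN1r -itgZ //; apply: le_itg => //.
  by apply: bmeasM => //; exact: bmeas_cst.
by move=> t /fg; rewrite ler_norml mulN1r lerNl => /andP[].
Qed.

End FixedBounds.

Lemma itg_chasles f a b c : bmeas f -> -1 <= a -> a <= b -> b <= c -> c <= 1 ->
  itg a c f = itg a b f + itg b c f.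
Proof.
move=> hf a1 ab bc c1.
have h := @Rintegral_itvB R f (BLeft a) (BRight c) b (bmeas_integrable hf a1 c1).
have := h; rewrite !bnd_simp => /(_ ab bc) {}h.
apply/eqP; rewrite addrC -subr_eq h; apply/eqP.
apply: Rintegral_itv_obnd_cbnd.
apply: integrableS (bmeas_integrable hf (le_trans a1 ab) c1) => //.
by apply: subset_itv; rewrite bnd_simp.
Qed.

Lemma itg_same f a : itg a a f = 0.
Proof. by rewrite /itg set_itv1 Rintegral_set1. Qed.

Lemma itg_FTC (F f : R -> R) a b : a <= b ->
  (forall t, derivable F t 1) -> (forall t, derive1 F t = f t) -> continuous f ->
  itg a b f = F b - F a.
Proof.
rewrite le_eqVlt => /predU1P[<-|ab] dF Ff cf; first by rewrite itg_same subrr.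
have cF : continuous F by move=> t; apply/differentiable_continuous/derivable1_diffP.
rewrite /itg /Rintegral (@continuous_FTC2 _ f F) //.
- exact: continuous_subspaceT.
- split; first by move=> t _.
  + by apply: cvg_at_right_filter; exact: cF.
  + by apply: cvg_at_left_filter; exact: cF.
Qed.

Lemma itg_deriv (p : {poly R}) a b : a <= b -> itg a b (horner p^`()) = p.[b] - p.[a].
Proof.
move=> ab; apply: (@itg_FTC (horner p)) => //.
- by move=> t; rewrite -derivE.
- by move=> t; exact: continuous_horner.
Qed.

Lemma itg_integ (p : {poly R}) : itg (-1) 1 (horner p) = integ p.
Proof. by rewrite -{1}(deriv_primp p) itg_deriv ?integ_deriv // lerN10. Qed.

(** On a uniform grid of n steps the increments of T telescope and the second term
    is O(1 / n).  The two integrations by parts below, where the functions need not be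
    differentiable anywhere, are instances of this estimate. *)
Lemma grid_bound (G T : R -> R) (beta C : R) : 0 <= C ->
  (forall s t, -1 <= s -> s <= t -> t <= 1 ->
    `|G t - G s| <= beta * (T t - T s) + C * (t - s) * (T t - T s)) ->
  `|G 1 - G (-1)| <= beta * (T 1 - T (-1)).
Proof.
move=> C0 H; pose V := T 1 - T (-1).
have main n : `|G 1 - G (-1)| <= beta * V + C * V * 2 / n.+1%:R.
  pose x (i : nat) : R := -1 + 2 * i%:R / n.+1%:R.
  have xS i : x i.+1 - x i = 2 / n.+1%:R by rewrite /x -natr1; field.
  have x0 : x 0%N = -1 by rewrite /x mulr0 mul0r addr0.
  have xn : x n.+1 = 1 by rewrite /x mulfK //; lra.
  have xge i : -1 <= x i by rewrite lerDl divr_ge0 ?mulr_ge0.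
  have xle i : (i <= n.+1)%N -> x i <= 1.
    move=> i_n; have : 2 * i%:R / n.+1%:R <= 2 :> R.
      by rewrite ler_pdivrMr // ler_pM2l // ler_nat.
    by rewrite /x; move: (2 * i%:R / n.+1%:R) => y h; lra.
  have d0 : 0 <= 2 / n.+1%:R :> R by rewrite divr_ge0.
  have step k : (k <= n.+1)%N -> `|G (x k) - G (x 0%N)| <=
      beta * (T (x k) - T (x 0%N)) + C * (2 / n.+1%:R) * (T (x k) - T (x 0%N)).
    elim: k => [_|k IH kn]; first by rewrite !subrr normr0 !mulr0 addr0.
    have {}IH := IH (ltnW kn).
    have xk : x k <= x k.+1 by rewrite -subr_ge0 xS.
    have := H (x k) (x k.+1) (xge _) xk (xle _ kn); rewrite xS => Hk.
    rewrite -(subrKA (G (x k))) (le_trans (ler_normD _ _)) //.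
    apply: (le_trans (lerD Hk IH)); rewrite le_eqVlt; apply/orP; left; apply/eqP; ring.
  have := step n.+1 (leqnn _); rewrite x0 xn => /le_trans; apply.
  by rewrite -/V lerD2l le_eqVlt; apply/orP; left; apply/eqP; ring.
rewrite leNgt; apply/negP => lt.
pose e := `|G 1 - G (-1)| - beta * V.
have e0 : 0 < e by rewrite subr_gt0.
have V0 : 0 <= C * V * 2.
  have := main 0%N; rewrite divr1 => h.
  have : e <= C * V * 2 by rewrite /e; lra.
  by apply: le_trans; exact: ltW.
have [n hn] : exists n, C * V * 2 / e < n.+1%:R.
  exists (Num.truncn (C * V * 2 / e)); apply: truncnS_gt.
have := main n; rewrite -lerBlDl -/e ler_pdivlMr // leNgt => /negP; apply.
by move: hn; rewrite ltr_pdivrMr // [_ * e]mulrC.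
Qed.

Lemma itg_parts (z z' : R -> R) (B : {poly R}) :
  bmeas z -> bmeas z' ->
  (forall s t, -1 <= s -> s <= t -> t <= 1 -> z t - z s = itg s t z') ->
  itg (-1) 1 (fun t => z t * B^`().[t]) =
  z 1 * B.[1] - z (-1) * B.[-1] - itg (-1) 1 (fun t => z' t * B.[t]).
Proof.
move=> hz hz' zz'.
have [_ [C' hC']] := hz'; have [_ [D' hD']] := bmeas_poly B^`().
have m11 : -1 <= (1 : R) by lra.
have C0 : 0 <= C' by apply: (le_trans (normr_ge0 _) (hC' 1 _)); rewrite m11 lexx.
have D0 : 0 <= D' by apply: (le_trans (normr_ge0 _) (hD' 1 _)); rewrite m11 lexx.
(* On [s, t] the increment of itg (-1) t h - z t * B.[t] is quadratic in t - s. *)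
pose h t := z t * B^`().[t] + z' t * B.[t].
have hB := bmeas_poly B; have hB' := bmeas_poly B^`().
have bh : bmeas h by apply: bmeasD; exact: bmeasM.
have := @grid_bound (fun t => itg (-1) t h - z t * B.[t]) id 0 (C' * D' * 2).
rewrite itg_same sub0r mul0r normr_le0.
have -> : itg (-1) 1 h = itg (-1) 1 (fun t => z t * B^`().[t]) + itg (-1) 1 (fun t => z' t * B.[t]).
  by rewrite itgD //; exact: bmeasM.
move=> main; apply/eqP; rewrite -subr_eq0.
have -> : forall a b c d : R, a - (b - c - d) = a + d - b - - c by move=> *; ring.
apply: main; first by rewrite !mulr_ge0.
move=> s t s1 st t1; rewrite mul0r add0r.
rewrite (itg_chasles bh _ s1 st t1) //.
have -> : itg s t h = itg s t (fun r => (z r - z s) * B^`().[r] + z' r * (B.[r] - B.[t]))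
    + (z s * (B.[t] - B.[s]) + B.[t] * (z t - z s)).
  rewrite zz' // -itg_deriv // -!itgZ // -!itgD //; try bmeas_tac.
  by apply: eq_itg => r _; rewrite /h; ring.
set I := itg s t _; set J := itg (-1) s h.
have -> : J + (I + (z s * (B.[t] - B.[s]) + B.[t] * (z t - z s))) - z t * B.[t]
   - (J - z s * B.[s]) = I by ring.
rewrite /I; apply: (le_trans (norm_itg_le s1 st t1 (C := C' * D' * 2 * (t - s)) _ _)) => //.
  by bmeas_tac.
move=> r /andP[sr rt]; rewrite (le_trans (ler_normD _ _)) // !normrM.
have r1 : -1 <= r <= 1 by rewrite (le_trans s1 sr) (le_trans rt t1).
have h1 : `|z r - z s| <= C' * (t - s).
  rewrite zz' //; last by case/andP: r1.
  apply: (le_trans (norm_itg_le (C := C') s1 sr _ hz' _)); first by case/andP: r1.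
    move=> v /andP[v1 v2]; apply: hC'; rewrite (le_trans s1 v1).
    by case/andP: r1 => _; apply: le_trans.
  by rewrite ler_wpM2l // lerB.
have h2 : `|B.[r] - B.[t]| <= D' * (t - s).
  rewrite distrC -itg_deriv //.
  apply: (le_trans (norm_itg_le (C := D') _ rt t1 hB' _)); first by case/andP: r1.
    move=> v /andP[v1 v2]; apply: hD'; rewrite (le_trans v2 t1) andbT.
    by case/andP: r1 => hr _; apply: le_trans v1.
  by rewrite ler_wpM2l // lerB.
apply: (le_trans (lerD (ler_pM _ _ h1 (hD' r r1)) (ler_pM _ _ (hC' r r1) h2))) => //.
by rewrite le_eqVlt; apply/orP; left; apply/eqP; ring.
Qed.

(** Integration by parts against a function of bounded variation, in the form of an
    inequality: on small intervals the increment of the left side is that of w times a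
    value of B. *)
Lemma itg_variation (w T : R -> R) (B : {poly R}) (beta : R) :
  bmeas w ->
  (forall s t, -1 <= s -> s <= t -> t <= 1 -> `|w t - w s| <= T t - T s) ->
  B.[1] = 0 -> B.[-1] = 0 -> (forall t, -1 <= t <= 1 -> `|B.[t]| <= beta) ->
  `|itg (-1) 1 (fun t => w t * B^`().[t])| <= beta * (T 1 - T (-1)).
Proof.
move=> hw wT B1 BN1 Bb.
have hB' := bmeas_poly B^`(); have [_ [D hD]] := hB'.
have m11 : -1 <= (1 : R) by lra.
have D0 : 0 <= D by apply: (le_trans (normr_ge0 _) (hD 1 _)); rewrite m11 lexx.
pose h t := w t * B^`().[t]; have bh : bmeas h by exact: bmeasM.
have := @grid_bound (fun t => itg (-1) t h - w t * B.[t]) T beta D D0.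
rewrite itg_same B1 BN1 !mulr0 !subr0; apply.
move=> s t s1 st t1; rewrite (itg_chasles bh _ s1 st t1) //.
have -> : itg s t h = itg s t (fun r => (w r - w s) * B^`().[r]) + w s * (B.[t] - B.[s]).
  rewrite -itg_deriv // -itgZ // -itgD //; try bmeas_tac.
  by apply: eq_itg => r _; rewrite /h; ring.
set I := itg s t _; set J := itg (-1) s h.
have -> : J + (I + w s * (B.[t] - B.[s])) - w t * B.[t] - (J - w s * B.[s]) =
  I - B.[t] * (w t - w s) by ring.
rewrite addrC (le_trans (ler_normD _ _)) // normrN normrM lerD //.
  by rewrite ler_pM // ?Bb ?wT // (le_trans s1 st) t1.
have -> : D * (t - s) * (T t - T s) = (T t - T s) * D * (t - s) by ring.
apply: norm_itg_le => //.
  by bmeas_tac.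
move=> r /andP[sr rt]; rewrite normrM ler_pM //; last first.
  by rewrite hD // (le_trans s1 sr) (le_trans rt t1).
apply: (le_trans (wT _ _ s1 sr (le_trans rt t1))).
have := wT r t (le_trans s1 sr) rt t1 => /(le_trans (normr_ge0 _)).
by lra.
Qed.

Lemma bernoulli (k : R) n : 0 <= k -> n%:R * k <= (1 + k) ^+ n.
Proof.
move=> k0; elim: n => [|n IH]; first by rewrite mul0r expr0.
have h : 1 <= (1 + k) ^+ n by rewrite exprn_ege1 // lerDl.
rewrite exprS -natr1 mulrDl mul1r [leRHS]mulrDl mul1r lerD //.
by rewrite ler_peMr.
Qed.

Lemma within_continuousP (d : R -> R) (s e : R) :
  {within `[(-1 : R), 1], continuous d} -> -1 <= s <= 1 -> 0 < e ->
  exists2 r, 0 < r & forall t, -1 <= t <= 1 -> `|t - s| < r -> `|d t - d s| < e.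
Proof.
move=> /subspace_continuousP cd hs e0.
have /cvgrPdist_lt /(_ e e0) : d x @[x --> within `[(-1 : R), 1] (nbhs s)] --> d s.
  by apply: cd; rewrite /= in_itv.
rewrite /within /= => /nbhs_ballP [r /= r0 H]; exists r => // t ht ts.
by rewrite distrC; apply: H; rewrite /= ?in_itv //= /ball /= distrC.
Qed.

(** The polynomials (1 + (r^2 - (t - s)^2) / 4)^n are nonnegative on [-1, 1], blow up
    around s and stay below 1 at distance more than r from s: if d s > 0, their integrals
    against d tend to infinity. *)
Lemma poly_test_le0_interior (d : R -> R) (s : R) :
  {within `[(-1 : R), 1], continuous d} ->
  (forall p : {poly R}, (forall t, -1 <= t <= 1 -> 0 <= p.[t]) ->
    itg (-1) 1 (fun t => d t * p.[t]) <= 0) ->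
  -1 < s < 1 -> d s <= 0.
Proof.
move=> cd mom /andP[s1 s2]; rewrite leNgt; apply/negP => ds.
have hd := bmeas_cont cd; have [_ [D hD]] := hd.
have [e e0 He] : exists2 e : R, 0 < e &
    forall t, -1 <= t <= 1 -> `|t - s| <= e -> d s / 2 <= d t.
  have [||e e0 He] := within_continuousP (s := s) (e := d s / 2) cd.
  - by rewrite !ltW.
  - by rewrite divr_gt0.
  exists (e / 2); first by rewrite divr_gt0.
  move=> t ht te; have : `|d t - d s| < d s / 2.
    by apply: He => //; apply: (le_lt_trans te); lra.
  by rewrite ltr_norml => /andP[h _]; lra.
pose r := Num.min e (Num.min (s + 1) (1 - s)).
have r0 : 0 < r by rewrite !lt_min e0 /=; apply/andP; split; lra.
have re : r <= e by rewrite ge_min lexx.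
have r1 : -1 <= s - r by have : r <= s + 1 by [rewrite !ge_min lexx !orbT]; lra.
have r2 : s + r <= 1 by have : r <= 1 - s by [rewrite !ge_min lexx !orbT]; lra.
have D0 : 0 <= D by apply: (le_trans (normr_ge0 _) (hD s _)); rewrite !ltW.
pose k := 3 / 16 * r ^+ 2.
have k0 : 0 < k by rewrite mulr_gt0 ?exprn_gt0.
pose q : {poly R} := (1 + r ^+ 2 / 4)%:P - 4^-1 *: ('X - s%:P) ^+ 2.
have qE t : q.[t] = 1 + (r ^+ 2 - (t - s) ^+ 2) / 4.
  rewrite /q hornerD hornerN hornerC hornerZ horner_exp hornerXsubC; ring.
have q0 t : -1 <= t <= 1 -> 0 <= q.[t].
  by move=> /andP[t1 t2]; rewrite qE; nra.
(* The left side grows with n: its source is Bernoulli's inequality for q ^+ n near s. *)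
have main n : d s / 2 * (n%:R * k) * r <= 2 * D.
  have hdq : bmeas (fun t => d t * (q ^+ n).[t]) by bmeas_tac.
  have low t : -1 <= t <= 1 -> - D <= d t * (q ^+ n).[t].
    move=> ht; rewrite horner_exp.
    have [tr|tr] := leP `|t - s| r.
      apply: (@le_trans _ _ 0); first by rewrite oppr_le0.
      rewrite mulr_ge0 ?exprn_ge0 ?q0 //.
      apply: le_trans (He _ ht (le_trans tr re)); lra.
    have : `|d t * q.[t] ^+ n| <= D.
      rewrite normrM normrX -[leRHS]mulr1 ler_pM ?exprn_ge0 ?hD //.
      rewrite exprn_ile1 // ger0_norm ?q0 // qE.
      have : r ^+ 2 <= `|t - s| ^+ 2.
        by apply: lerXn2r; rewrite ?nnegrE ?normr_ge0 ?(ltW tr) ?(ltW r0).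
      by rewrite real_normK ?num_real // => h; lra.
    by rewrite ler_norml => /andP[].
  have high t : s - r / 2 <= t <= s + r / 2 -> d s / 2 * (n%:R * k) <= d t * (q ^+ n).[t].
    move=> /andP[t1 t2]; have ht : -1 <= t <= 1 by apply/andP; split; lra.
    have tr : `|t - s| <= r / 2 by rewrite ler_norml; apply/andP; split; lra.
    have dt : d s / 2 <= d t by apply: He => //; lra.
    have qt : 1 + k <= q.[t].
      have : `|t - s| ^+ 2 <= (r / 2) ^+ 2.
        by apply: lerXn2r; rewrite ?nnegrE ?normr_ge0 ?tr ?divr_ge0 ?(ltW r0).
      by rewrite real_normK ?num_real // qE /k expr_div_n => h; lra.
    rewrite horner_exp ler_pM //; [lra|by rewrite mulr_ge0 // ltW|].
    have : (1 + k) ^+ n <= q.[t] ^+ n by rewrite lerXn2r // nnegrE; lra.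
    by apply: le_trans; apply: bernoulli; exact: ltW.
  have : itg (-1) 1 (fun t => d t * (q ^+ n).[t]) <= 0.
    by apply: mom => t ht; rewrite horner_exp exprn_ge0 ?q0.
  have h1 : -1 <= s - r / 2 by lra.
  have h2 : s - r / 2 <= s + r / 2 by lra.
  have h3 : s + r / 2 <= 1 by lra.
  rewrite (itg_chasles hdq (lexx _) h1 (le_trans h2 h3) (lexx _)).
  rewrite (itg_chasles hdq h1 h2 h3 (lexx _)).
  have i1 : - D * (s - r / 2 - -1) <= itg (-1) (s - r / 2) (fun t => d t * (q ^+ n).[t]).
    rewrite -itg_cst //; apply: le_itg => //; [by lra|by bmeas_tac|].
    by move=> t /andP[t1 t2]; apply: low; rewrite t1 /=; lra.
  have i2 : d s / 2 * (n%:R * k) * (s + r / 2 - (s - r / 2)) <=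
      itg (s - r / 2) (s + r / 2) (fun t => d t * (q ^+ n).[t]).
    by rewrite -itg_cst //; apply: le_itg => //; bmeas_tac.
  have i3 : - D * (1 - (s + r / 2)) <= itg (s + r / 2) 1 (fun t => d t * (q ^+ n).[t]).
    rewrite -itg_cst //; apply: le_itg => //; [by lra|by bmeas_tac|].
    by move=> t /andP[t1 t2]; apply: low; rewrite t2 andbT; lra.
  move: (itg _ _ _) (itg _ _ _) (itg _ _ _) i1 i2 i3 => I1 I2 I3 i1 i2 i3 E.
  move: i1 i2 i3; move: (d s / 2 * (n%:R * k)) => c i1 i2 i3.
  have : c * r + - D * (2 - r) <= 0 by apply: le_trans E; lra.
  have : 0 <= D * r by rewrite mulr_ge0 // ltW.
  by lra.
have m0 : 0 < d s / 2 * k * r by rewrite !mulr_gt0 ?divr_gt0.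
have := main (Num.truncn (2 * D / (d s / 2 * k * r))).+1.
rewrite leNgt => /negP; apply.
have := @real_truncnS_gt _ (2 * D / (d s / 2 * k * r)) (num_real _).
by rewrite ltr_pdivrMr //; move: (_.+1%:R) => x; lra.
Qed.

Lemma poly_test_le0 (d : R -> R) :
  {within `[(-1 : R), 1], continuous d} ->
  (forall p : {poly R}, (forall t, -1 <= t <= 1 -> 0 <= p.[t]) ->
    itg (-1) 1 (fun t => d t * p.[t]) <= 0) ->
  forall s, -1 <= s <= 1 -> d s <= 0.
Proof.
move=> cd mom s /andP[s1 s2]; rewrite leNgt; apply/negP => ds.
have [|r r0 H] := within_continuousP (s := s) cd _ ds; first by rewrite s1.
pose a := Num.min (1 / 2) (r / 2).
have a0 : 0 < a by rewrite lt_min !divr_gt0.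
have ar : a < r by rewrite gt_min; apply/orP; right; clear -r0; lra.
have a1 : a <= 1 / 2 by rewrite ge_min lexx.
have [t [t1 t2 t3]] : exists t, [/\ -1 < t, t < 1 & `|t - s| = a].
  clear -s1 s2 a0 a1.
  have [s0|s0] := leP s 0; [exists (s + a)|exists (s - a)]; split; try lra.
    by rewrite addrC addKr gtr0_norm.
  by rewrite addrC addKr normrN gtr0_norm.
have dt : d t <= 0 by apply: (poly_test_le0_interior cd mom); rewrite t1.
have := H t; rewrite t3 !ltW // => /(_ isT ar).
rewrite ltr_norml => /andP[h _]; clear -h dt; lra.
Qed.

End Integrals.

(** * Smooth bumps *)

Section Bumps.
Context {R : realType}.
Local Open Scope classical_set_scope.
Implicit Types (c a b s t : R) (p q : {poly R}).

(** The family is closed under differentiation (flat') and flat at 0, so that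
    products of two such functions are smooth and vanish outside an interval. *)
Definition flat c p s : R := if 0 < s then p.[s^-1] * expR (- (c / s)) else 0.

(** The exponential beats all powers of s^-1; the quadratic bound is enough for a
    zero derivative at 0. *)
Lemma flat_quadratic c p : 0 < c ->
  exists2 C, 0 <= C & forall s, `|s| <= 1 -> `|flat c p s| <= C * s ^+ 2.
Proof.
move=> c0; pose d := (size p).+1.
pose A := \sum_(i < size p) `|p`_i|.
have A0 : 0 <= A by apply: sumr_ge0.
have f0 : 0 < (d.+1`!)%:R :> R by rewrite ltr0n fact_gt0.
exists (A * ((d.+1`!)%:R / c ^+ d.+1)).
  by rewrite mulr_ge0 // divr_ge0 ?exprn_ge0 // ltW.
move=> s s1; rewrite /flat; case: ifPn => [s0|]; last first.
  by rewrite normr0 mulr_ge0 ?sqr_ge0 // mulr_ge0 // divr_ge0 ?exprn_ge0 // ltW.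
have {}s1 : s <= 1 by rewrite -(gtr0_norm s0).
have x1 : 1 <= s^-1 by rewrite invf_ge1.
have pb : `|p.[s^-1]| <= A * s^-1 ^+ (size p).
  rewrite horner_coef (le_trans (ler_norm_sum _ _ _)) // mulr_suml ler_sum // => i _.
  rewrite normrM ler_wpM2l // normrX (ger0_norm (_ : 0 <= s^-1)) ?(le_trans ler01 x1) //.
  by apply: (ler_weXn2l x1); exact: ltnW (ltn_ord i).
have eb k : expR (- (c / s)) <= (k.+1`!)%:R / c ^+ k.+1 * s ^+ k.+1.
  have k0 : 0 < (k.+1`!)%:R :> R by rewrite ltr0n fact_gt0.
  rewrite expRN.
  have cs : 0 < c / s by rewrite divr_gt0.
  have := expR_ge1Dxn k (ltW cs).
  have h0 : 0 < (c / s) ^+ k.+1 / (k.+1)`!%:R by rewrite divr_gt0 // exprn_gt0.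
  move=> h; have h1 : (c / s) ^+ k.+1 / (k.+1)`!%:R <= expR (c / s).
    by apply: le_trans h; rewrite lerDr.
  rewrite -[leRHS]invrK lef_pV2 ?posrE ?expR_gt0 //; last first.
    by rewrite invr_gt0 mulr_gt0 ?exprn_gt0 // divr_gt0 // exprn_gt0.
  apply: le_trans h1; rewrite !invfM !invrK expr_div_n.
  move: ((k.+1)`!%:R) (c ^+ k.+1) (s ^+ k.+1) => x y z.
  by have -> : x^-1 * y / z = y / z / x by rewrite -mulrA mulrC.
rewrite normrM [X in _ * X]ger0_norm ?expR_ge0 //.
apply: (le_trans (ler_pM (normr_ge0 _) (expR_ge0 _) pb (eb d))).
rewrite le_eqVlt; apply/orP; left; apply/eqP.
rewrite /d !exprS exprVn.
have : s ^+ size p != 0 by rewrite expf_neq0 // lt0r_neq0.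
have : c ^+ size p != 0 by rewrite expf_neq0 // lt0r_neq0.
have : s != 0 by rewrite lt0r_neq0.
have : c != 0 by rewrite lt0r_neq0.
move: (s ^+ size p) (c ^+ size p) => u v h1 h2 h3 h4.
by field; rewrite ?h1 ?h2 ?h3 ?h4.
Qed.

Lemma is_derive_quadratic (f : R -> R) C : f 0 = 0 ->
  (forall s, `|s| <= 1 -> `|f s| <= C * s ^+ 2) -> is_derive (0 : R) (1 : R) f (0 : R).
Proof.
move=> f0 H.
have lim : h^-1 *: (f (h *: 1 + 0) - f 0) @[h --> 0^'] --> (0 : R).
  apply/cvgrPdist_lt => e e0; near=> h.
  have h0 : h != 0 by near: h; exact: nbhs_dnbhs_neq.
  have h1 : `|h| <= 1.
    near: h; apply: dnbhs0_le; exact: ltr01.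
  have h2 : `|h| < e / (`|C| + 1).
    near: h; apply: dnbhs0_lt; by rewrite divr_gt0 // ltr_wpDl.
  rewrite f0 subr0 addr0 sub0r normrN normrZ normfV.
  have -> : h *: (1 : R) = h by rewrite /GRing.scale /= mulr1.
  rewrite mulrC ltr_pdivrMr ?normr_gt0 //.
  apply: (le_lt_trans (H h h1)).
  apply: (@le_lt_trans _ _ ((`|C| + 1) * `|h| ^+ 2)).
    rewrite real_normK ?num_real // ler_wpM2r ?sqr_ge0 //.
    by rewrite (le_trans (ler_norm C)) // lerDl.
  rewrite expr2 mulrA ltr_pM2r ?normr_gt0 //.
  by rewrite mulrC -ltr_pdivlMr // ltr_wpDl.
apply: DeriveDef; first by apply/cvg_ex; exists 0.
exact: cvg_lim lim.
Unshelve. all: by end_near. Qed.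

Definition flat' c p : {poly R} := 'X^2 * (c *: p - p^`()).

Lemma is_derive_flat c p t : 0 < c -> is_derive t 1 (flat c p) (flat c (flat' c p) t).
Proof.
move=> c0; have [t0|t0|t0] := ltgtP t 0.
- have -> : flat c (flat' c p) t = 0 by rewrite /flat ltNge (ltW t0).
  apply: (@near_eq_is_derive _ _ _ (cst 0)).
  near=> s; rewrite /flat /= ltNge ifN // negbK; apply: ltW.
  by near: s; exact: lt_nbhsl.
- have -> : flat c (flat' c p) t = (p^`().[t^-1] * expR (- (c / t))) * (- (t ^- 2))
      + p.[t^-1] * (expR (- (c / t)) * (c * t ^- 2)).
    rewrite /flat t0 /flat' hornerM hornerXn hornerD hornerN hornerZ exprVn; ring.
  apply: (@near_eq_is_derive _ _ _ (fun s => p.[s^-1] * expR (- (c / s)))).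
    by near=> s; rewrite /flat ifT //; near: s; exact: lt_nbhsr.
  have d1 : is_derive t 1 (fun s : R => s^-1) (- t ^- 2 *: 1).
    by apply: is_deriveV; rewrite lt0r_neq0.
  have dp : is_derive (t^-1) 1 (horner p) p^`().[t^-1].
    apply: DeriveDef; first exact: derivable_horner.
    by rewrite -derive1E -derivE.
  have d2 : is_derive t 1 (fun s => p.[s^-1]) (p^`().[t^-1] * (- t ^- 2 *: 1)).
    exact: (@is_derive1_comp _ (horner p) (fun s => s^-1)).
  have d3 : is_derive t 1 (fun s => expR (- (c / s)))
      (expR (- (c / t)) * (- (c *: (- t ^- 2 *: 1)))).
    have d0 : is_derive t 1 (fun s : R => - (c / s)) (- (c *: (- t ^- 2 *: 1))).
      exact: (is_deriveN (is_deriveZ c d1)).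
    exact: (@is_derive1_comp _ expR (fun s => - (c / s))).
  apply: (is_derive_eq (is_deriveM d2 d3)).
  rewrite /GRing.scale /=; ring.
- subst t; have -> : flat c (flat' c p) 0 = 0 by rewrite /flat ltxx.
  have [C C0 HC] := flat_quadratic p c0.
  apply: is_derive_quadratic HC; by rewrite /flat ltxx.
Unshelve. all: by end_near. Qed.

(** Closed under differentiation, hence made of smooth functions. *)
Inductive bumpy c a b : (R -> R) -> Prop :=
| bumpy_prod p q : bumpy c a b (fun t => flat c p (t - a) * flat c q (b - t))
| bumpy_add f g : bumpy c a b f -> bumpy c a b g -> bumpy c a b (fun t => f t + g t).

Lemma is_derive_flat_prod c a b p q t : 0 < c ->
  is_derive t 1 (fun t => flat c p (t - a) * flat c q (b - t))
   (flat c (flat' c p) (t - a) * flat c q (b - t) +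
    flat c p (t - a) * flat c (- flat' c q) (b - t)).
Proof.
move=> c0.
have d1 : is_derive t 1 (fun t => flat c p (t - a)) (flat c (flat' c p) (t - a) * 1).
  apply: (@is_derive1_comp _ (flat c p) (fun t => t - a)).
    exact: is_derive_flat.
  by apply: is_derive_eq; rewrite subr0.
have d2 : is_derive t 1 (fun t => flat c q (b - t)) (flat c (flat' c q) (b - t) * (-1)).
  apply: (@is_derive1_comp _ (flat c q) (fun t => b - t)).
    exact: is_derive_flat.
  by apply: is_derive_eq; rewrite add0r mul1r.
apply: (is_derive_eq (is_deriveM d1 d2)).
have -> : flat c (- flat' c q) (b - t) = - flat c (flat' c q) (b - t).
  by rewrite /flat; case: ifP; rewrite ?oppr0 // hornerN mulNr.
rewrite /GRing.scale /=; ring.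
Qed.

Lemma bumpy_derive c a b f : 0 < c -> bumpy c a b f ->
  (forall t, derivable f t 1) /\ bumpy c a b (derive1 f).
Proof.
move=> c0; elim=> [p q|g h _ [dg bg] _ [dh bh]].
  split; first by move=> t; have [] := is_derive_flat_prod a b p q t c0.
  have -> : derive1 (fun t => flat c p (t - a) * flat c q (b - t)) =
     fun t => flat c (flat' c p) (t - a) * flat c q (b - t) +
      flat c p (t - a) * flat c (- flat' c q) (b - t).
    by apply/funext => t; rewrite derive1E; have [_ ->] := is_derive_flat_prod a b p q t c0.
  by apply: bumpy_add; exact: bumpy_prod.
split; first by move=> t; exact: derivableD.
have -> : derive1 (fun t => g t + h t) = fun t => derive1 g t + derive1 h t.
  by apply/funext => t; rewrite !derive1E deriveD.
exact: bumpy_add.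
Qed.

Lemma bumpy_smooth c a b f : 0 < c -> bumpy c a b f ->
  forall n t, derivable (derive1n n f) t 1.
Proof.
move=> c0 bf n; have : bumpy c a b (derive1n n f).
  elim: n => [//|n IH]; rewrite derive1nS.
  by have [] := bumpy_derive c0 IH.
by move=> /(bumpy_derive c0) [].
Qed.

(** Tends to the indicator function of ]a, b[ when c tends to 0. *)
Definition bump c a b t := flat c 1 (t - a) * flat c 1 (b - t).

Lemma flat1_itv c s : 0 < c -> 0 <= flat c 1 s <= 1.
Proof.
move=> c0; rewrite /flat; case: ifP => [s0|_]; last by rewrite lexx ler01.
by rewrite hornerC mul1r expR_ge0 expR_le1 oppr_le0 divr_ge0 // ltW.
Qed.

Lemma bump_itv c a b t : 0 < c -> 0 <= bump c a b t <= 1.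
Proof.
move=> c0; have /andP[h1 h2] := flat1_itv (t - a) c0.
have /andP[h3 h4] := flat1_itv (b - t) c0.
by rewrite /bump mulr_ge0 // mulr_ile1.
Qed.

Lemma bump_out c a b t : ~~ (a < t < b) -> bump c a b t = 0.
Proof.
rewrite negb_and -!leNgt => /orP[h|h]; rewrite /bump /flat.
  by rewrite ltNge subr_le0 h mul0r.
by rewrite [X in _ * X]ifF ?mulr0 // ltNge subr_le0 h.
Qed.

Lemma bump_test c a b : 0 < c -> -1 < a -> b < 1 -> test_function (bump c a b).
Proof.
move=> c0 a1 b1; split; first by apply: (bumpy_smooth c0); exact: bumpy_prod.
exists a, b; split => // t; rewrite in_itv /= => h; apply: bump_out.
by apply: contra h => /andP[/ltW -> /ltW ->].
Qed.

Lemma bump_derivable c a b t : 0 < c -> derivable (bump c a b) t 1.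
Proof. by move=> c0; have [] := bumpy_derive c0 (bumpy_prod c a b 1 1). Qed.

Lemma bump_deriveE c a b t : 0 < c -> derive1 (bump c a b) t =
  if a < t < b then c * ((t - a) ^- 2 - (b - t) ^- 2) * bump c a b t else 0.
Proof.
move=> c0; rewrite derive1E; have [_ ->] := is_derive_flat_prod a b 1 1 t c0.
rewrite /bump /flat !subr_gt0; case: (a < t) => /=; last by rewrite !mul0r addr0.
case: (t < b) => /=; last by rewrite !mulr0 addr0.
rewrite /flat' !(hornerN, hornerM, hornerD, hornerXn, hornerZ) derivC !hornerC -!exprVn.
rewrite !hornerX; ring.
Qed.

Lemma bump_continuous_deriv c a b : 0 < c -> continuous (derive1 (bump c a b)).
Proof.
move=> c0 t; have [_ h] := bumpy_derive c0 (bumpy_prod c a b 1 1).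
have [h' _] := bumpy_derive c0 h.
exact/differentiable_continuous/derivable1_diffP.
Qed.

Lemma bump_continuous c a b : 0 < c -> continuous (bump c a b).
Proof.
by move=> c0 t; apply/differentiable_continuous/derivable1_diffP; exact: bump_derivable.
Qed.

Lemma bump_cvg a b t : a < t < b -> bump n.+1%:R^-1 a b t @[n --> \oo] --> (1 : R).
Proof.
move=> /andP[at_ tb].
have e c : bump c a b t = expR (- c * ((t - a)^-1 + (b - t)^-1)).
  rewrite /bump /flat !subr_gt0 at_ tb !hornerC !mul1r -expRD; congr expR; ring.
under eq_fun do rewrite e.
have h : - n.+1%:R^-1 * ((t - a)^-1 + (b - t)^-1) @[n --> \oo] --> (0 : R).
  rewrite -(mul0r ((t - a)^-1 + (b - t)^-1)); apply: cvgMl.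
  by rewrite -oppr0; apply: cvgN; exact: cvg_harmonic.
by have := continuous_cvg _ (@continuous_expR R 0) h; rewrite expR0; exact.
Qed.

End Bumps.

(** * Continuous functions with a weak derivative *)

Section WeakToStrong.
Context {R : realType}.
Local Open Scope classical_set_scope.
Notation mu := (@lebesgue_measure R).
Implicit Types (a b c s t : R) (eta zeta d : R -> R).

Lemma bmeas_continuous (f : R -> R) : continuous f -> bmeas f.
Proof. by move=> cf; apply: bmeas_cont; apply: continuous_subspaceT. Qed.

(** The weight g has constant sign sg.  If most of its mass lies on [p, q], where eta
    is close to v, then integrating eta against it amounts to multiplying its mass by v. *)
Lemma weight_concentrates (eta g : R -> R) (v sg e S x p q y : R) :
  bmeas eta -> bmeas g -> -1 <= x -> x <= p -> p <= q -> q <= y -> y <= 1 ->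
  (forall t, x <= t <= y -> 0 <= sg * g t) -> `|sg| = 1 ->
  (forall t, p <= t <= q -> `|eta t - v| <= e) ->
  (forall t, x <= t <= y -> `|eta t - v| <= S) ->
  `|itg x y (fun t => eta t * g t) - v * itg x y g| <=
  e * (sg * itg p q g) + S * (sg * itg x p g + sg * itg q y g).
Proof.
move=> he hg x1 xp pq qy y1 sg0 sg1 near_ far.
have p1 := le_trans x1 xp; have q1 := le_trans qy y1.
have py := le_trans pq qy; have p1' := le_trans pq q1.
have q1' := le_trans p1 pq.
have ng t : x <= t <= y -> `|g t| = sg * g t.
  by move=> ht; rewrite -(ger0_norm (sg0 t ht)) normrM sg1 mul1r.
rewrite -itgZ ?(le_trans xp) // -itgB ?(le_trans xp) //; try by bmeas_tac.
rewrite (_ : (fun t => _) = (fun t => (eta t - v) * g t)); last first.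
  by apply/funext => t; rewrite mulrBl.
have hh : bmeas (fun t => (eta t - v) * g t) by bmeas_tac.
rewrite (itg_chasles hh x1 xp py y1) (itg_chasles hh p1 pq qy y1).
have main l u C : -1 <= l -> l <= u -> u <= 1 -> x <= l -> u <= y ->
    (forall t, l <= t <= u -> `|eta t - v| <= C) ->
    `|itg l u (fun t => (eta t - v) * g t)| <= C * (sg * itg l u g).
  move=> l1 lu u1 xl uy HC; rewrite -!itgZ //; try by bmeas_tac.
  apply: norm_itg_le_itg => //; try by bmeas_tac.
  move=> t /andP[lt tu]; have ht : x <= t <= y by rewrite (le_trans xl) ?(le_trans tu).
  by rewrite normrM ng // ler_wpM2r ?sg0 // HC ?lt.
have far' l u : x <= l -> u <= y -> forall t, l <= t <= u -> `|eta t - v| <= S.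
  by move=> xl uy t /andP[lt tu]; apply: far; rewrite (le_trans xl) ?(le_trans tu).
have h1 := main x p S x1 xp p1' (lexx _) py (far' _ _ (lexx _) py).
have h2 := main p q e p1 pq q1 xp qy near_.
have h3 := main q y S q1' qy y1 (le_trans xp pq) (lexx _) (far' _ _ (le_trans xp pq) (lexx _)).
rewrite (le_trans (ler_normD _ _)) // [leRHS]addrC mulrDr -addrA lerD //.
rewrite (le_trans (ler_normD _ _)) // addrC lerD //.
Qed.

Lemma bump_deriv_sign c a b t : 0 < c -> a < b ->
  (a <= t <= (a + b) / 2 -> 0 <= derive1 (bump c a b) t) /\
  ((a + b) / 2 <= t <= b -> derive1 (bump c a b) t <= 0).
Proof.
move=> c0 ab; rewrite bump_deriveE //; case: ifPn => [/andP[at_ tb]|_]; last by split.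
have /andP[f0 _] := bump_itv a b t c0.
have ta : 0 < t - a by lra.
have bt : 0 < b - t by lra.
split=> [/andP[_ h]|/andP[h _]].
  rewrite mulr_ge0 // mulr_ge0 ?(ltW c0) // subr_ge0 lef_pV2 ?posrE ?exprn_gt0 //.
  by rewrite ler_pXn2r ?nnegrE ?(ltW ta) ?(ltW bt) //; lra.
rewrite mulr_le0_ge0 // mulr_ge0_le0 ?(ltW c0) // subr_le0 lef_pV2 ?posrE ?exprn_gt0 //.
by rewrite ler_pXn2r ?nnegrE ?(ltW ta) ?(ltW bt) //; lra.
Qed.

Let cn (n : nat) : R := n.+1%:R^-1.
Let cn0 n : 0 < cn n. Proof. by rewrite invr_gt0. Qed.

(** The derivative of a bump is positive on the left half of [a, b] and negative on
    the right half; for small c its masses are close to 1 and - 1 and located near a and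
    near b. *)
Lemma bump_deriv_estimate eta a b c (r e S : R) : bmeas eta -> 0 < c ->
  -1 < a -> a < b -> b < 1 -> 0 < r -> r <= (b - a) / 4 -> 0 <= e -> 0 <= S ->
  (forall t, a <= t <= a + r -> `|eta t - eta a| <= e) ->
  (forall t, b - r <= t <= b -> `|eta t - eta b| <= e) ->
  (forall t, a <= t <= b -> `|eta t - eta a| <= S /\ `|eta t - eta b| <= S) ->
  `|itg (-1) 1 (fun t => eta t * derive1 (bump c a b) t) -
    (eta a - eta b) * bump c a b ((a + b) / 2)| <=
  2 * e + S * ((1 - bump c a b (a + r)) + (1 - bump c a b (b - r))).
Proof.
move=> he c0 a1 ab b1 r0 r3 e0 S0 Ha Hb far; set F := bump c a b; set m := (a + b) / 2.
have [am mb] : a <= m /\ m <= b by split; rewrite /m; lra.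
have [ar arm] : a <= a + r /\ a + r <= m by split; rewrite /m; lra.
have [mbr br] : m <= b - r /\ b - r <= b by split; rewrite /m; lra.
have [a1' b1'] : -1 <= a /\ b <= 1 by rewrite !ltW.
have m1 := le_trans a1' am; have m1' := le_trans mb b1'.
set g := derive1 F.
have hg : bmeas g by apply: bmeas_continuous; exact: bump_continuous_deriv.
have FTC x y : x <= y -> itg x y g = F y - F x.
  move=> xy; apply: itg_FTC => //; first by move=> t; exact: bump_derivable.
  exact: bump_continuous_deriv.
have fa : F a = 0 by rewrite /F bump_out // ltxx.
have fb : F b = 0 by rewrite /F bump_out // ltxx andbF.
have f01 t : 0 <= F t <= 1 by exact: bump_itv.
have hh : bmeas (fun t => eta t * g t) by bmeas_tac.
have z1 : itg (-1) a (fun t => eta t * g t) = 0.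
  rewrite (@eq_itg _ _ _ _ (fun=> 0)); last first.
    by move=> t /andP[_ ta]; rewrite /g bump_deriveE // ltNge ta mulr0.
  by rewrite itg_cst ?mul0r.
have z2 : itg b 1 (fun t => eta t * g t) = 0.
  rewrite (@eq_itg _ _ _ _ (fun=> 0)); last first.
    by move=> t /andP[bt _]; rewrite /g bump_deriveE // [t < b]ltNge bt andbF mulr0.
  by rewrite itg_cst ?mul0r.
rewrite (itg_chasles hh (lexx _) a1' (le_trans am m1') (lexx _)).
rewrite (itg_chasles hh a1' am m1' (lexx _)).
rewrite (itg_chasles hh m1 mb b1' (lexx _)) z1 z2 add0r addr0.
have A1 : `|itg a m (fun t => eta t * g t) - eta a * itg a m g| <=
    e * (1 * itg a (a + r) g) + S * (1 * itg a a g + 1 * itg (a + r) m g).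
  apply: weight_concentrates => //.
  - by move=> t ht; rewrite mul1r; apply: (bump_deriv_sign t c0 ab).1.
  - by rewrite normr1.
  - by move=> t /andP[t1 t2]; apply: (far _ _).1; rewrite t1 (le_trans t2).
have A2 : `|itg m b (fun t => eta t * g t) - eta b * itg m b g| <=
    e * (-1 * itg (b - r) b g) + S * (-1 * itg m (b - r) g + -1 * itg b b g).
  apply: weight_concentrates => //.
  - by move=> t ht; rewrite mulN1r oppr_ge0; apply: (bump_deriv_sign t c0 ab).2.
  - by rewrite normrN normr1.
  - by move=> t /andP[t1 t2]; apply: (far _ _).2; rewrite t2 (le_trans am).
rewrite !FTC ?fa ?fb // in A1 A2.
have /andP[p0 p1] := f01 (a + r); have /andP[q0 q1] := f01 (b - r).
have /andP[_ k1] := f01 m.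
move: A1 A2 p0 p1 q0 q1 k1; move: (itg a m _) (itg m b _) (F m) (F (a + r)) (F (b - r)).
move: (eta a) (eta b) => u v I1 I2 k p q.
rewrite !subrr !mul1r !mulN1r ?subr0 ?sub0r ?opprK ?oppr0 ?add0r ?addr0 ?mulrN ?opprK ?opprB.
move=> A1 A2 p0 p1 q0 q1 k1.
have -> : I1 + I2 - (u - v) * k = (I1 - u * k) + (I2 + v * k) by ring.
apply: (le_trans (ler_normD _ _)); apply: (le_trans (lerD A1 A2)).
have e1 : e * p <= e by rewrite ler_piMr.
have e2 : e * q <= e by rewrite ler_piMr.
have s1 : S * (k - p) <= S * (1 - p) by rewrite ler_wpM2l // lerD2r.
have s2 : S * (k - q) <= S * (1 - q) by rewrite ler_wpM2l // lerD2r.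
by clear -e1 e2 s1 s2; lra.
Qed.

Lemma bump_deriv_cvg eta a b : {within `[(-1 : R), 1], continuous eta} ->
  -1 < a -> a < b -> b < 1 ->
  itg (-1) 1 (fun t => eta t * derive1 (bump (cn n) a b) t) @[n --> \oo]
    --> eta a - eta b.
Proof.
move=> ceta a1 ab b1; have he := bmeas_cont ceta; have [_ [K hK]] := he.
have in1 t : a <= t <= b -> -1 <= t <= 1.
  by move=> /andP[t1 t2]; rewrite (le_trans (ltW a1) t1) (le_trans t2 (ltW b1)).
have ha : -1 <= a <= 1 by apply: in1; rewrite lexx ltW.
have hb : -1 <= b <= 1 by apply: in1; rewrite lexx ltW.
have K0 : 0 <= K by apply: (le_trans (normr_ge0 _) (hK a _)).
pose S := 2 * K.
have S0 : 0 <= S by rewrite mulr_ge0.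
have far v t : -1 <= v <= 1 -> -1 <= t <= 1 -> `|eta t - eta v| <= S.
  move=> hv ht; rewrite (le_trans (ler_normB _ _)) // /S mulr_natl mulr2n.
  by rewrite lerD ?hK.
apply/cvgrPdist_le => e e0.
pose e' := e / 4.
have e'0 : 0 < e' by rewrite divr_gt0.
have [ra ra0 Ha] := within_continuousP ceta ha e'0.
have [rb rb0 Hb] := within_continuousP ceta hb e'0.
pose r := Num.min (Num.min (ra / 2) (rb / 2)) ((b - a) / 4).
have [r0 r1 r2 r3] : [/\ 0 < r, r < ra, r < rb & r <= (b - a) / 4].
  split; first by rewrite !lt_min !divr_gt0 // subr_gt0.
  - have : r <= ra / 2 by rewrite !ge_min lexx.
    by clear -ra0; lra.
  - have : r <= rb / 2 by rewrite !ge_min lexx !orbT.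
    by clear -rb0; lra.
  - by rewrite !ge_min lexx !orbT.
pose V := 2 * S + `|eta a - eta b| + 1.
have V0 : 0 < V by rewrite ltr_wpDl // addr_ge0 // mulr_ge0.
pose d := e' / V.
have d0 : 0 < d by rewrite divr_gt0.
have lim t : a < t < b -> \forall n \near \oo, 1 - bump (cn n) a b t <= d.
  move=> /bump_cvg /cvgrPdist_le /(_ d d0); apply: filterS => n.
  by apply: le_trans; exact: ler_norm.
have [h1 [h2 h3]] : a < a + r < b /\ a < b - r < b /\ a < (a + b) / 2 < b.
  by clear -r0 r3 ab; do ![apply/andP; split|split]; lra.
have h1' : forall t, a <= t <= a + r -> a <= t <= b.
  by move=> t /andP[-> /le_trans]; apply; case/andP: h1 => _ /ltW.
have h2' : forall t, b - r <= t <= b -> a <= t <= b.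
  by move=> t /andP[h ->]; rewrite andbT; apply: le_trans h; case/andP: h2 => /ltW.
near=> n.
have L1 : 1 - bump (cn n) a b (a + r) <= d by near: n; apply: lim.
have L2 : 1 - bump (cn n) a b (b - r) <= d by near: n; apply: lim.
have L3 : 1 - bump (cn n) a b ((a + b) / 2) <= d by near: n; apply: lim.
have := @bump_deriv_estimate eta a b (cn n) r e' S he (cn0 n) a1 ab b1 r0 r3
  (ltW e'0) S0.
move=> /(_ _ _ _)/wrap[].
- move=> t ht; apply/ltW/Ha; first by apply: in1; exact: h1'.
  case/andP: ht => t1 t2; rewrite ger0_norm ?subr_ge0 //.
  by rewrite ltrBlDl (le_lt_trans t2) // ltrD2l.
- move=> t ht; apply/ltW/Hb; first by apply: in1; exact: h2'.
  case/andP: ht => t1 t2; rewrite distrC ger0_norm ?subr_ge0 //.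
  by rewrite ltrBlDr -ltrBlDl (lt_le_trans _ t1) // ltrD2l ltrN2.
- by move=> t ht; split; apply: far => //; exact: in1.
have /andP[_ k1] := bump_itv a b ((a + b) / 2) (cn0 n).
move: L1 L2 L3 k1; move: (itg _ _ _) (bump _ _ _ _) (bump _ _ _ _) (bump _ _ _ _).
move=> I k q p L1 L2 L3 k1 H.
have -> : eta a - eta b - I = (eta a - eta b) * (1 - k) - (I - (eta a - eta b) * k) by ring.
apply: (le_trans (ler_normB _ _)); apply: (le_trans (lerD (lexx _) H)).
have h4 : `|(eta a - eta b) * (1 - k)| <= `|eta a - eta b| * d.
  by rewrite normrM ler_wpM2l // ger0_norm // subr_ge0.
have h5 : S * (1 - p + (1 - q)) <= 2 * S * d.
  by rewrite mulrC -mulrA [2 * _]mulrC -mulrA mulrC mulr_natr mulr2n ler_wpM2l // lerD.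
apply: (le_trans (lerD h4 (lerD (lexx _) h5))).
have Vd : V * d = e' by rewrite /d mulrC divfK // lt0r_neq0.
have : `|eta a - eta b| * d + 2 * S * d <= e'.
  by rewrite -mulrDl -Vd ler_wpM2r ?(ltW d0) // /V addrC lerDl.
have -> : e = 4 * e' by rewrite /e'; field.
clear -e'0; move: (_ * d) (_ * d) => x y; lra.
Unshelve. all: by end_near. Qed.

Lemma itg_open f : bmeas f -> \int[mu]_(t in `](-1 : R), 1[) f t = itg (-1) 1 f.
Proof.
move=> hf; rewrite /itg -Rintegral_itv_obnd_cbnd; last first.
  apply: integrableS (bmeas_integrable hf (lexx _) (lexx _)) => //.
  by apply: subset_itv; rewrite bnd_simp.
apply: Rintegral_itv_bndo_bndc.
apply: integrableS (bmeas_integrable hf (lexx _) (lexx _)) => //.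
by apply: subset_itv; rewrite bnd_simp.
Qed.

Lemma locally_integrable_itv f a b : locally_integrable `](-1 : R), 1[ f ->
  -1 < a -> b < 1 -> mu.-integrable `[a, b] (EFin \o f).
Proof.
move=> [mf _ If] a1 b1.
have sub : `[a, b] `<=` `](-1 : R), 1[ by apply: subset_itv; rewrite bnd_simp.
apply/integrableP; split.
  by apply/measurable_EFinP; apply: measurable_funS mf.
exact: If (@segment_compact _ a b).
Qed.

Lemma bump_cvg_integral zeta a b : locally_integrable `](-1 : R), 1[ zeta ->
  -1 < a -> a < b -> b < 1 ->
  \int[mu]_(t in `](-1 : R), 1[) (zeta t * bump (cn n) a b t) @[n --> \oo]
    --> \int[mu]_(t in `[a, b]) zeta t.
Proof.
move=> lz a1 ab b1; have iz := locally_integrable_itv lz a1 b1.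
have sub : `[a, b] `<=` `](-1 : R), 1[ by apply: subset_itv; rewrite bnd_simp.
have -> : (fun n => \int[mu]_(t in `](-1 : R), 1[) (zeta t * bump (cn n) a b t)) =
    (fun n => \int[mu]_(t in `[a, b]) (zeta t * bump (cn n) a b t)).
  apply/funext => n.
  have -> : `[a, b] = `](-1 : R), 1[ `&` `[a, b] by rewrite setIidr.
  rewrite Rintegral_mkcondr; apply: eq_Rintegral => t _.
  rewrite patchE; case: ifPn => // tab; rewrite bump_out ?mulr0 //.
  apply: contra tab => /andP[h1 h2]; rewrite inE /= in_itv /=.
  by rewrite !ltW.
have mz : measurable_fun `[a, b] zeta by apply/measurable_EFinP; case/integrableP: iz.
have [] := @dominated_convergence _ _ R mu `[a, b] (measurable_itv _)
  (fun n t => (zeta t * bump (cn n) a b t)%:E) (EFin \o zeta) (EFin \o (fun t => `|zeta t|)).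
- move=> n; apply/measurable_EFinP; apply: measurable_funM => //.
  apply: measurable_funTS; apply: continuous_measurable_fun; exact: bump_continuous.
- exact/measurable_EFinP.
- have : mu.-negligible ([set a] `|` [set b]).
    have n1 x : mu.-negligible [set x].
      exists [set x]; split => //; exact: lebesgue_measure_set1.
    exact: negligibleU.
  apply: negligibleS => t /= H; apply: contrapT => tab; apply: H => tI.
  apply/cvg_EFin; first by near=> n.
  rewrite /= -[X in _ --> X]mulr1; apply: cvgMr; apply: bump_cvg.
  move: tI; rewrite /= in_itv /= => /andP[].
  by rewrite !le_eqVlt => /predU1P[?|->] /predU1P[?|->] //; exfalso; apply: tab; [left|left|right].
- exact: integrable_norm.
- apply: aeW => t n tI; rewrite /= lee_fin normrM ler_piMr //.
  by have /andP[h1 h2] := bump_itv a b t (cn0 n); rewrite ger0_norm.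
move=> iz' _ H; rewrite /Rintegral; apply: fine_cvg.
rewrite fineK; first exact: H.
exact: integrable_fin_num.
Unshelve. all: by end_near. Qed.

(** Test against bumps and let c tend to 0: the derivative of the bump evaluates eta
    at a minus eta at b, and the bump itself integrates zeta over [a, b]. *)
Lemma weak_derivative_integral eta zeta : {within `[(-1 : R), 1], continuous eta} ->
  locally_integrable `](-1 : R), 1[ zeta ->
  (forall phi, test_function phi ->
     \int[mu]_(t in `](-1 : R), 1[) (eta t * derive1 phi t) =
     - \int[mu]_(t in `](-1 : R), 1[) (zeta t * phi t)) ->
  forall a b, -1 < a -> a < b -> b < 1 ->
  eta b - eta a = \int[mu]_(t in `[a, b]) zeta t.
Proof.
move=> ce lz H a b a1 ab b1.
have := bump_deriv_cvg ce a1 ab b1.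
have -> : (fun n => itg (-1) 1 (fun t => eta t * derive1 (bump (cn n) a b) t)) =
    (fun n => - \int[mu]_(t in `](-1 : R), 1[) (zeta t * bump (cn n) a b t)).
  apply/funext => n; rewrite -H ?itg_open //; last exact: bump_test.
  apply: bmeasM; first exact: bmeas_cont.
  by apply: bmeas_continuous; exact: bump_continuous_deriv.
move=> h1; have h2 := cvgN (bump_cvg_integral lz a1 ab b1).
have E := cvg_unique (@Rhausdorff R) h1 (h2 _).
by rewrite -[LHS]opprK opprB E opprK.
Qed.

End WeakToStrong.

(** * Almost everywhere properties and chains of weak derivatives *)

Section Regularity.
Context {R : realType}.
Notation mu := (@lebesgue_measure R).
Implicit Types (a b c s t : R) (d : R -> R).

Lemma ae_imp (P Q : R -> Prop) : {ae mu, forall t, P t} ->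
  (forall t, P t -> Q t) -> {ae mu, forall t, Q t}.
Proof.
move=> [A [mA A0 sub]] PQ; exists A; split => // t /= nQ.
by apply: sub => Pt; apply: nQ; exact: PQ.
Qed.

Lemma ae_imp2 (P P' Q : R -> Prop) : {ae mu, forall t, P t} ->
  {ae mu, forall t, P' t} ->
  (forall t, P t -> P' t -> Q t) -> {ae mu, forall t, Q t}.
Proof.
move=> aP aP' PQ; have := negligibleU aP aP'; apply: negligibleS => t /= nQ.
apply: contrapT => h; apply: nQ; apply: PQ; apply: contrapT => h'; apply: h; [left|right] => //.
Qed.

(** Lebesgue's differentiation theorem on the compact intervals that exhaust
    ]-1, 1[, on each of which d is integrable. *)
Lemma ae_eq0_of_integrals d : locally_integrable `](-1 : R), 1[ d ->
  (forall a b, -1 < a -> a < b -> b < 1 -> \int[mu]_(t in `[a, b]) d t = 0) ->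
  {ae mu, forall t, -1 < t < 1 -> d t = 0}.
Proof.
move=> ld H; pose a (n : nat) : R := -1 + n.+2%:R^-1; pose b (n : nat) : R := 1 - n.+2%:R^-1.
have e0 n : 0 < n.+2%:R^-1 :> R by rewrite invr_gt0.
have e1 n : n.+2%:R^-1 <= 2^-1 :> R by rewrite lef_pV2 ?posrE // ler_nat.
have a1 n : -1 < a n by rewrite ltrDl.
have b1 n : b n < 1 by rewrite gtrBl.
have main n : {ae mu, forall t, a n < t < b n -> d t = 0}.
  pose K := `[a n, b n]%classic : set R; pose g := d \_ K.
  have iK : mu.-integrable K (EFin \o d) by exact: locally_integrable_itv.
  have lg : locally_integrable setT g by apply: integrable_locally => //; exact: measurable_itv.
  have ig y : mu.-integrable [set` Interval (BLeft (a n)) (BRight y)] (EFin \o g).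
    have := (@integrable_mkcond _ _ R mu K (EFin \o d) (measurable_itv _)).1 iK.
    rewrite restrict_EFin.
    by apply: integrableS => //; exact: subsetT.
  apply: (ae_imp (FTC1 ig lg)) => t /= Ht /andP[t1 t2].
  have [|_] := Ht; first by rewrite lte_fin.
  set F := (fun y => _) => E.
  have F0 : \near t, F t = cst 0 t.
    have tab : t \in `](a n), (b n)[%R by rewrite in_itv /= t1.
    near=> y; have : y \in `](a n), (b n)[%R by near: y; exact: near_in_itvoo.
    rewrite in_itv /= => /andP[y1 y2].
    rewrite /F -[RHS](H (a n) y) ?(lt_trans y2) //.
    apply: eq_Rintegral => z; rewrite inE /= in_itv /= => /andP[z1 z2].
    by rewrite /g patchE mem_set // /K /= in_itv /= z1 (le_trans z2) // ltW.
  have : derive1 F t = 0.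
    by rewrite derive1E (near_eq_derive _ F0) derive_cst.
  rewrite E /g patchE mem_set // /K /= in_itv /= !ltW //.
apply: (ae_imp (ae_foralln main)) => t H' /andP[t1 t2].
pose x := Num.min (t + 1) (1 - t).
have x0 : 0 < x by rewrite lt_min; apply/andP; split; lra.
pose n := Num.truncn x^-1.
have nx : n.+2%:R^-1 < x.
  rewrite -[ltRHS]invrK ltf_pV2 ?posrE ?invr_gt0 //.
  by apply: (lt_trans (@real_truncnS_gt _ x^-1 (num_real _))); rewrite ltr_nat.
apply: (H' n); apply/andP; split.
  have h : x <= t + 1 by rewrite ge_min lexx.
  by rewrite /a -ltrBrDl opprK (lt_le_trans nx).
have h : x <= 1 - t by rewrite ge_min lexx orbT.
by rewrite /b ltrBrDl -ltrBrDr (lt_le_trans nx).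
Unshelve. all: by end_near. Qed.

(** How almost everywhere properties of continuous functions become pointwise ones. *)
Lemma ae_dense (Q : R -> Prop) : {ae mu, forall t, t \in `[(-1 : R), 1] -> Q t} ->
  forall s r, -1 <= s <= 1 -> 0 < r ->
  exists t, [/\ -1 <= t <= 1, `|t - s| < r & Q t].
Proof.
move=> [A [mA A0 sub]] s r /andP[s1 s2] r0.
apply: contrapT => none.
pose a := Num.min (1 / 2) (r / 2).
have a0 : 0 < a by rewrite lt_min !divr_gt0.
have ar : a < r by rewrite gt_min; apply/orP; right; clear -r0; lra.
have a1 : a <= 1 / 2 by rewrite ge_min lexx.
have [x [y [xy H]]] : exists x y, x < y /\ forall t, x <= t <= y -> -1 <= t <= 1 /\ `|t - s| < r.
  have [s0|s0] := leP s 0.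
    exists s, (s + a); split; first by rewrite ltrDl.
    move=> t /andP[t1 t2]; split; first by clear -s1 s2 s0 t1 t2 a1; apply/andP; split; lra.
    by rewrite ger0_norm ?subr_ge0 // ltrBlDl (le_lt_trans t2) // ltrD2l.
  exists (s - a), s; split; first by rewrite ltrBlDr ltrDl.
  move=> t /andP[t1 t2]; split; first by clear -s1 s2 s0 t1 t2 a1; apply/andP; split; lra.
  by rewrite distrC ger0_norm ?subr_ge0 // ltrBlDr -ltrBlDl (lt_le_trans _ t1) // ltrD2l ltrN2.
have xyA : `[x, y]%classic `<=` A.
  move=> t /=; rewrite in_itv /= => /H [t1 t2]; apply: sub => /= Qt; apply: none.
  by exists t; split => //; apply: Qt; rewrite in_itv.
have : (mu `[x, y]%classic <= mu A)%E by apply: le_measure; rewrite ?inE //.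
by rewrite A0 /= lebesgue_measure_itv /= lte_fin xy lee_fin subr_le0 leNgt xy.
Qed.

Lemma ae_open_closed (Q : R -> Prop) : {ae mu, forall t, -1 < t < 1 -> Q t} ->
  {ae mu, forall t, t \in `[(-1 : R), 1] -> Q t}.
Proof.
move=> H; have n1 x : mu.-negligible [set x].
  by exists [set x]; split => //; exact: lebesgue_measure_set1.
have : {ae mu, forall t, t != -1 /\ t != 1}.
  have : mu.-negligible ([set (-1 : R)] `|` [set 1]) by exact: negligibleU.
  apply: negligibleS => t /= h; apply: contrapT => h'; apply: h.
  by split; apply/eqP => e; apply: h'; [left|right].
move=> H'; apply: (ae_imp2 H H') => t {}H [/eqP h1 /eqP h2]; rewrite in_itv /= => /andP[t1 t2].
apply: H; rewrite !lt_neqAle t1 t2 !andbT; apply/andP; split; apply/eqP => //.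
by move/esym.
Qed.

Lemma bmeas_of_locally_integrable f C : locally_integrable `](-1 : R), 1[ f ->
  (forall t, -1 <= t <= 1 -> `|f t| <= C) -> bmeas f.
Proof.
move=> [mf _ _] fC; split; last by exists C.
by apply/measurable_fun_itv_bndo_bndcP/measurable_fun_itv_obnd_cbndP.
Qed.

Lemma test_function_derive (phi : R -> R) : test_function phi -> test_function (derive1 phi).
Proof.
move=> [dphi [a [b [a1 b1 H]]]]; split.
  move=> n t; have := dphi n.+1 t.
  by rewrite /derive1n iterSr.
exists a, b; split => // t tab.
have : \near t, phi t = cst 0 t.
  have : nbhs t (~` `[a, b]%classic : set R).
    apply: open_nbhs_nbhs; split; first by apply: closed_openC; exact: itv_closed.
    by move=> /= h; move: tab; rewrite h.
  by apply: filterS => x /= /negP h; rewrite H.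
by move=> e; rewrite derive1E (near_eq_derive _ e) derive_cst.
Qed.

(** Weak derivatives live on the open interval; the continuity of eta and the
    boundedness of zeta carry the relation to the end points. *)
Lemma extend_closed (eta zeta : R -> R) : {within `[(-1 : R), 1], continuous eta} ->
  bmeas zeta ->
  (forall a b, -1 < a -> a < b -> b < 1 -> eta b - eta a = itg a b zeta) ->
  forall s t, -1 <= s -> s <= t -> t <= 1 -> eta t - eta s = itg s t zeta.
Proof.
move=> ce hz H s t s1; rewrite le_eqVlt => /predU1P[->|st] t1.
  by rewrite subrr itg_same.
apply/eqP; rewrite -subr_eq0 -normr_le0 leNgt; apply/negP => e0.
set e := `|_| in e0.
have hs : -1 <= s <= 1 by rewrite s1 (le_trans (ltW st)).
have ht : -1 <= t <= 1 by rewrite t1 (le_trans s1 (ltW st)).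
have e40 : 0 < e / 4 by rewrite divr_gt0.
have [rs rs0 Hs] := within_continuousP ce hs e40.
have [rt rt0 Ht] := within_continuousP ce ht e40.
have [_ [C hC]] := hz.
have C0 : 0 <= C by apply: (le_trans (normr_ge0 _) (hC s hs)).
pose r := Num.min (Num.min (rs / 2) (rt / 2)) (Num.min ((t - s) / 4) (e / 4 / (C + 1))).
have [r0 r1 r2 r3 r4] : [/\ 0 < r, r < rs, r < rt, r <= (t - s) / 4 & r <= e / 4 / (C + 1)].
  have c1 : 0 < C + 1 by rewrite ltr_wpDl.
  split; first by rewrite !lt_min !divr_gt0 // subr_gt0.
  - have : r <= rs / 2 by rewrite !ge_min lexx.
    by clear -rs0; lra.
  - have : r <= rt / 2 by rewrite !ge_min lexx !orbT.
    by clear -rt0; lra.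
  - by rewrite !ge_min lexx !orbT.
  - by rewrite !ge_min lexx !orbT.
have Cr : C * r <= e / 4.
  have c1 : 0 < C + 1 by rewrite ltr_wpDl.
  move: r4; rewrite ler_pdivlMr // => r4; apply: le_trans r4.
  by rewrite mulrC ler_wpM2l ?(ltW r0) // lerDl.
have [x1 [x2 x3]] : -1 < s + r /\ s + r < t - r /\ t - r < 1.
  by clear -s1 st t1 r0 r3; split; [|split]; lra.
have E := H _ _ x1 x2 x3.
have [y1 y2] : s <= s + r /\ t - r <= t by clear -r0; split; lra.
have y3 := le_trans s1 y1; have y4 := le_trans (ltW x2) (ltW x3).
have y5 := le_trans y3 (ltW x2).
have I : itg s t zeta = itg s (s + r) zeta + itg (s + r) (t - r) zeta + itg (t - r) t zeta.
  rewrite (itg_chasles hz s1 y1 (le_trans (ltW x2) y2) t1).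
  by rewrite (itg_chasles hz y3 (ltW x2) y2 t1) addrA.
have B1 : `|itg s (s + r) zeta| <= e / 4.
  apply: le_trans Cr; apply: (le_trans (norm_itg_le (C := C) s1 y1 y4 hz _)).
    by move=> v /andP[v1 v2]; apply: hC; rewrite (le_trans s1) // (le_trans v2).
  by rewrite addrC addKr.
have B2 : `|itg (t - r) t zeta| <= e / 4.
  apply: le_trans Cr; apply: (le_trans (norm_itg_le (C := C) y5 y2 t1 hz _)).
    by move=> v /andP[v1 v2]; apply: hC; rewrite (le_trans y5) // (le_trans v2).
  by rewrite opprB addrC subrK.
have D1 : `|eta (s + r) - eta s| < e / 4.
  by apply: Hs; [rewrite y3 y4|rewrite addrC addKr gtr0_norm].
have D2 : `|eta (t - r) - eta t| < e / 4.
  by apply: Ht; [rewrite y5 ltW|rewrite addrC addKr normrN gtr0_norm].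
have : e < e.
  rewrite {1}/e I -E.
  have -> : eta t - eta s - (itg s (s + r) zeta + (eta (t - r) - eta (s + r)) + itg (t - r) t zeta)
    = (eta (s + r) - eta s) - (eta (t - r) - eta t) - itg s (s + r) zeta
      - itg (t - r) t zeta by ring.
  apply: (le_lt_trans (ler_normB _ _)); apply: (le_lt_trans (lerD (ler_normB _ _) (lexx _))).
  apply: (le_lt_trans (lerD (lerD (ler_normB _ _) (lexx _)) (lexx _))).
  have -> : e = e / 4 + e / 4 + e / 4 + e / 4 by field.
  by apply: ltr_leD => //; apply: ltr_leD => //; exact: ltrD.
by rewrite ltxx.
Qed.

(** The derivative of a test function is a test function, so that y j.+1 is the weak
    derivative of y j as well. *)
Lemma weak_chain (m : nat) (xi : R -> R) (y : nat -> R -> R) j : weak_derivatives m xi y ->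
  (j < m)%N -> bmeas (y j.+1) ->
  forall s t, -1 <= s -> s <= t -> t <= 1 -> y j t - y j s = itg s t (y j.+1).
Proof.
move=> [wd cont] jm hb; apply: extend_closed => //; first exact: cont.
have [_ lz H1] := wd j.+1 jm; have [_ _ H0] := wd j (ltnW jm).
apply: weak_derivative_integral => //; first exact: cont.
move=> phi tphi; have := H1 phi tphi; have := H0 _ (test_function_derive tphi).
rewrite /derive1n -iterSr => -> /eqP; rewrite exprS -mulrA => /eqP E.
have s0 : (-1) ^+ j != 0 :> R by rewrite expf_neq0 // oppr_eq0 oner_eq0.
by apply: (mulfI s0); rewrite E mulN1r mulrN.
Qed.

(** The difference is a weak derivative of the zero function, so that its integrals
    vanish: it is zero almost everywhere, hence everywhere by continuity. *)
Lemma weak0_eq (xi y0 : R -> R) : {within `[(-1 : R), 1], continuous xi} ->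
  {within `[(-1 : R), 1], continuous y0} -> weak_derivative 0 xi y0 ->
  forall t, -1 <= t <= 1 -> xi t = y0 t.
Proof.
move=> cx cy [lx ly H]; have hx := bmeas_cont cx; have hy := bmeas_cont cy.
pose d t := xi t - y0 t.
have ld : locally_integrable `](-1 : R), 1[ d by exact: locally_integrableB.
have ae0 : {ae mu, forall t, -1 < t < 1 -> d t = 0}.
  apply: ae_eq0_of_integrals => // a b a1 ab b1.
  rewrite -(@weak_derivative_integral _ (cst 0) d) //; first by rewrite /= subrr.
    by move=> ?; exact: cst_continuous.
  move=> phi tphi; have := H phi tphi; rewrite /= expr0 mul1r => E.
  have [dphi _] := tphi.
  have hphi : bmeas phi.
    apply: bmeas_continuous => t; apply/differentiable_continuous/derivable1_diffP.
    exact: (dphi 0%N t).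
  have -> : (fun t => d t * phi t) = (fun t => xi t * phi t - y0 t * phi t).
    by apply/funext => t; rewrite mulrBl.
  rewrite (_ : (fun t => cst 0 t * _) = cst 0); last by apply/funext => t; rewrite /= mul0r.
  rewrite Rintegral_cst // mul0r itg_open; last by bmeas_tac.
  rewrite itgB //; try bmeas_tac.
  by rewrite -!itg_open ?E ?subrr ?oppr0 //; bmeas_tac.
have cd : {within `[(-1 : R), 1], continuous d} by move=> t; apply: cvgB; [exact: cx|exact: cy].
move=> t ht; apply/eqP; rewrite -subr_eq0 -normr_le0 leNgt; apply/negP => h.
have [r r0 Hr] := within_continuousP cd ht h.
have [s [s1 s2 s3]] := ae_dense (ae_open_closed ae0) ht r0.
by have := Hr s s1 s2; rewrite s3 sub0r normrN ltxx.
Qed.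

End Regularity.

(** * Legendre series *)

Section LegendreSeries.
Context {R : realType}.
Notation mu := (@lebesgue_measure R).
Local Notation L := (@leg R).
Implicit Types (z w : R -> R) (n k K : nat).

Let ler11 : -1 <= 1 :> R. Proof. by lra. Qed.

Definition lcoef z n : R := (n%:R + 1 / 2) * itg (-1) 1 (fun t => z t * (L n).[t]).

Definition partial_sum z K : {poly R} := \sum_(n < K.+1) lcoef z n *: L n.

Lemma size_partial_sum z K : (size (partial_sum z K) <= K.+1)%N.
Proof.
apply: (leq_trans (size_sum _ _ _)); apply/bigmax_leqP => i _.
by rewrite (leq_trans (size_scale_leq _ _)) // size_legendre.
Qed.

Definition integral_of (z z' : R -> R) : Prop :=
  forall s t, -1 <= s -> s <= t -> t <= 1 -> z t - z s = itg s t z'.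

(** T plays the part of the variation of w on [-1, t].  Only its increments matter,
    and stating bounds by them avoids suprema over subdivisions. *)
Definition varies_by (T w : R -> R) : Prop :=
  forall s t, -1 <= s -> s <= t -> t <= 1 -> `|w t - w s| <= T t - T s.

Lemma lcoef_diff z n : bmeas z ->
  lcoef z n.+1 = 1 / 2 * itg (-1) 1 (fun t => z t * (L n.+2 - L n)^`().[t]).
Proof.
move=> hz; rewrite derivB legendreS2_deriv addrK /lcoef.
rewrite (_ : (fun t => z t * (_ *: _).[t]) = (fun t => (2 * n.+1%:R + 1) * (z t * (L n.+1).[t]))).
  rewrite itgZ //; last by bmeas_tac.
  by move: (itg _ _ _) => x; field.
by apply/funext => t; rewrite hornerZ; ring.
Qed.

(** One integration by parts after writing (2 n + 3) L n.+1 as the derivative of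
    L n.+2 - L n: the coefficients gain a factor 1 / n on those of z'. *)
Lemma lcoef_step z z' n : bmeas z -> bmeas z' -> integral_of z z' ->
  lcoef z n.+1 = lcoef z' n / (2 * n%:R + 1) - lcoef z' n.+2 / (2 * n.+2%:R + 1).
Proof.
move=> hz hz' zz'; rewrite lcoef_diff // (itg_parts _ hz hz' zz').
rewrite !legendre_diff_ends !mulr0 subrr sub0r.
rewrite (_ : (fun t => z' t * _.[t]) = (fun t => z' t * (L n.+2).[t] - z' t * (L n).[t])).
  rewrite itgB //; [|by bmeas_tac|by bmeas_tac].
  rewrite /lcoef; move: (itg _ _ _) (itg _ _ _) => x y.
  have : 2 * n%:R + 1 != 0 :> R by rewrite lt0r_neq0 // ltr_wpDl // mulr_ge0.
  have : 2 * n.+2%:R + 1 != 0 :> R by rewrite lt0r_neq0 // ltr_wpDl // mulr_ge0.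
  by move: (n%:R) (n.+2%:R) => a b ha hb; field; rewrite ha hb.
by apply/funext => t; rewrite hornerD hornerN mulrBr.
Qed.

Lemma lcoef_bv w T n : bmeas w -> varies_by T w ->
  `|lcoef w n.+1| <= (T 1 - T (-1)) / Num.sqrt n.+1%:R.
Proof.
move=> hw wT; rewrite lcoef_diff // normrM ger0_norm //.
have := itg_variation (B := L n.+2 - L n) (beta := 2 / Num.sqrt n.+1%:R) hw wT.
rewrite !legendre_diff_ends => /(_ erefl erefl) H.
have : `|itg (-1) 1 (fun t => w t * (L n.+2 - L n)^`().[t])| <=
    2 / Num.sqrt n.+1%:R * (T 1 - T (-1)).
  by apply: H => t ht; rewrite hornerD hornerN legendre_diff_bound.
move: (Num.sqrt _)^-1 (T 1 - T (-1)) (itg _ _ _) => a b c h.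
have -> : b * a = 1 / 2 * (2 * a * b) by field.
by rewrite ler_wpM2l // divr_ge0.
Qed.

Fixpoint chain_bv k (F : nat -> R -> R) (T : R -> R) : Prop :=
  if k is k'.+1 then [/\ bmeas (F 0%N), bmeas (F 1%N), integral_of (F 0%N) (F 1%N)
    & chain_bv k' (fun j => F j.+1) T]
  else bmeas (F 0%N) /\ varies_by T (F 0%N).

(** The last function contributes n^(-1/2) by lcoef_bv, each integration n^(-1) by
    lcoef_step. *)
Lemma lcoef_decay k F T : chain_bv k F T ->
  exists2 C : R, 0 <= C & forall n, (k < n)%N ->
    `|lcoef (F 0%N) n| <= C / (Num.sqrt n%:R * n%:R ^+ k).
Proof.
elim: k F => [|k IH] F /=.
  move=> [hw wT]; exists (T 1 - T (-1)).
    exact: le_trans (normr_ge0 _) (wT _ _ (lexx _) ler11 (lexx _)).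
  move=> [//|n] _; rewrite expr0 mulr1; exact: lcoef_bv.
move=> [h0 h1 h01 /IH [C C0 HC]].
exists (C * (2 ^+ k.+2 + 1)).
  by rewrite mulr_ge0 // addr_ge0 // exprn_ge0.
move=> [//|n] kn; rewrite (lcoef_step _ h0 h1 h01).
rewrite ltnS in kn; have n0 : (0 < n)%N by exact: leq_ltn_trans (leq0n k) kn.
have N0 : 0 < n%:R :> R by rewrite ltr0n.
have S0 : 0 < Num.sqrt n%:R :> R by rewrite sqrtr_gt0.
have S1 : 0 < Num.sqrt n.+1%:R :> R by rewrite sqrtr_gt0.
have nn : n.+1%:R <= 2 * n%:R :> R by rewrite -natrM ler_nat; lia.
have ss : Num.sqrt n.+1%:R <= 2 * Num.sqrt n%:R :> R.
  apply: (le_trans (ler_wsqrtr nn)); rewrite sqrtrM //.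
  rewrite ler_wpM2r ?sqrtr_ge0 // -[leRHS]ger0_norm // -sqrtr_sqr ler_wsqrtr //.
  by rewrite -natrX ler_nat.
set P := Num.sqrt n.+1%:R * n.+1%:R ^+ k.+1.
have P0 : 0 < P by rewrite mulr_gt0 ?exprn_gt0.
have t1 : `|lcoef (F 1%N) n / (2 * n%:R + 1)| <= C * 2 ^+ k.+2 / P.
  have d1 : 0 < 2 * n%:R + 1 :> R by rewrite ltr_wpDl // mulr_ge0.
  rewrite normrM normfV (gtr0_norm d1).
  apply: (@le_trans _ _ (C / (Num.sqrt n%:R * n%:R ^+ k) / n.+1%:R)).
    rewrite ler_pM ?invr_ge0 ?(ltW d1) ?HC // lef_pV2 ?posrE //.
    by rewrite -natr1 lerD2r ler_peMl // (ler_nat _ 1 2).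
  set X := Num.sqrt n%:R * n%:R ^+ k.
  have X0 : 0 < X by rewrite mulr_gt0 ?exprn_gt0.
  have PX : P <= 2 ^+ k.+2 * (X * n.+1%:R).
    have -> : 2 ^+ k.+2 * (X * n.+1%:R) =
        (2 * Num.sqrt n%:R) * ((2 * (2 * n%:R) ^+ k) * n.+1%:R) :> R.
      by rewrite /X exprMn !exprS; ring.
    have h : n.+1%:R ^+ k <= 2 * (2 * n%:R) ^+ k :> R.
      apply: (@le_trans _ _ ((2 * n%:R) ^+ k)); last first.
        by rewrite ler_peMl ?exprn_ge0 ?mulr_ge0 // (ler_nat _ 1 2).
      by apply: lerXn2r => //; rewrite nnegrE ?mulr_ge0.
    by rewrite /P exprSr ler_pM ?sqrtr_ge0 ?mulr_ge0 ?exprn_ge0 // ler_wpM2r.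
  rewrite -mulrA -invfM -mulrA ler_wpM2l // ler_pdivlMr // mulrC ler_pdivrMr //.
  by rewrite mulr_gt0.
have t2 : `|lcoef (F 1%N) n.+2 / (2 * n.+2%:R + 1)| <= C / P.
  have d1 : 0 < 2 * n.+2%:R + 1 :> R by rewrite ltr_wpDl // mulr_ge0.
  rewrite normrM normfV (gtr0_norm d1).
  apply: (@le_trans _ _ (C / (Num.sqrt n.+2%:R * n.+2%:R ^+ k) / n.+1%:R)).
    have le1 : n.+1%:R <= 2 * n.+2%:R + 1 :> R.
      by rewrite -(natr1 n.+1); have : 0 <= n.+1%:R :> R by []; lra.
    have knn : (k < n.+2)%N by rewrite (leq_trans kn) // ltnW // ltnW.
    by apply: ler_pM => //; rewrite ?HC ?invr_ge0 ?(ltW d1) ?lef_pV2 ?posrE.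
  rewrite -mulrA ler_wpM2l // -invfM lef_pV2 ?posrE ?mulr_gt0 ?exprn_gt0 ?sqrtr_gt0 //.
  rewrite /P exprSr mulrA ler_wpM2r // ler_pM ?exprn_ge0 ?sqrtr_ge0 //.
    by rewrite ler_wsqrtr // ler_nat.
  by rewrite lerXn2r ?nnegrE // ler_nat.
apply: (le_trans (ler_normB _ _)); apply: (le_trans (lerD t1 t2)).
by rewrite mulrDr mulr1 mulrDl.
Qed.

(** Lets sums of n^(-3/2) telescope. *)
Lemma inv_sqrt_telescope n :
  (Num.sqrt n.+2%:R * n.+2%:R)^-1 <= 2 * ((Num.sqrt n.+1%:R)^-1 - (Num.sqrt n.+2%:R)^-1) :> R.
Proof.
set a := Num.sqrt n.+1%:R; set b := Num.sqrt n.+2%:R : R.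
have a0 : 0 < a by rewrite sqrtr_gt0.
have b0 : 0 < b by rewrite sqrtr_gt0.
have ab : a <= b by rewrite ler_wsqrtr // ler_nat.
have a2 : a ^+ 2 = n.+1%:R by rewrite sqr_sqrtr.
have b2 : b ^+ 2 = n.+2%:R by rewrite sqr_sqrtr.
have E : b ^+ 2 = a ^+ 2 + 1 by rewrite a2 b2 natr1.
have h : a^-1 - b^-1 = (a * b * (a + b))^-1.
  have ha : a != 0 by rewrite lt0r_neq0.
  have hb : b != 0 by rewrite lt0r_neq0.
  have hab : a + b != 0 by rewrite lt0r_neq0 // addr_gt0.
  have e1 : 1 = (b - a) * (a + b) by transitivity (b ^+ 2 - a ^+ 2); [rewrite E|]; ring.
  apply: (mulfI (mulf_neq0 (mulf_neq0 ha hb) hab)).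
  rewrite divff ?mulf_neq0 // e1; field; by rewrite ha hb.
have le : a * b * (a + b) <= 2 * (b * b ^+ 2).
  have -> : 2 * (b * b ^+ 2) = b * b * (b + b) by ring.
  have [a0' b0'] := (ltW a0, ltW b0).
  by apply: ler_pM; [exact: mulr_ge0|exact: addr_ge0|exact: ler_wpM2r|exact: lerD].
have Y0 : 0 < a * b * (a + b) by rewrite !mulr_gt0 ?addr_gt0.
have X0 : 0 < b * b ^+ 2 by rewrite mulr_gt0 ?exprn_gt0.
by rewrite h -b2 ler_pdivlMr // mulrC ler_pdivrMr.
Qed.

Lemma lcoef_tail k F T : chain_bv k.+1 F T ->
  exists2 C : R, 0 <= C & forall K K', (k < K)%N -> (K <= K')%N ->
    \sum_(K <= n < K') `|lcoef (F 0%N) n.+1| <= C / (Num.sqrt K%:R * K%:R ^+ k).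
Proof.
move=> /lcoef_decay [C C0 HC]; exists (2 * C); first by rewrite mulr_ge0.
move=> K K' kK KK'.
have K0 : (0 < K)%N by apply: leq_ltn_trans kK.
have KR : 0 < K%:R :> R by rewrite ltr0n.
have SK : 0 < Num.sqrt K%:R :> R by rewrite sqrtr_gt0.
pose g n : R := (Num.sqrt n%:R)^-1.
have main : \sum_(K <= n < K') `|lcoef (F 0%N) n.+1| <=
    \sum_(K <= n < K') (2 * C / K%:R ^+ k) * (g n - g n.+1).
  rewrite big_seq [leRHS]big_seq; apply: ler_sum => -[|n]; rewrite mem_index_iota.
    by move=> /andP[]; rewrite leqn0 => /eqP e; rewrite e in K0.
  move=> /andP[Kn _]; apply: (le_trans (HC _ _)); first by rewrite ltnS (leq_trans kK Kn).
  have -> : C / (Num.sqrt n.+2%:R * n.+2%:R ^+ k.+1) =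
      C * ((n.+2%:R ^+ k)^-1 * (Num.sqrt n.+2%:R * n.+2%:R)^-1).
    by rewrite -invfM exprS; congr (_ / _); ring.
  have -> : 2 * C / K%:R ^+ k * (g n.+1 - g n.+2) =
      C * ((K%:R ^+ k)^-1 * (2 * (g n.+1 - g n.+2))) by ring.
  apply: ler_wpM2l => //; apply: ler_pM.
  - by rewrite invr_ge0 exprn_ge0.
  - by rewrite invr_ge0 mulr_ge0 ?sqrtr_ge0.
  - rewrite lef_pV2 ?posrE ?exprn_gt0 //; apply: lerXn2r; rewrite ?nnegrE //.
    by rewrite ler_nat (leq_trans Kn).
  - exact: inv_sqrt_telescope.
apply: (le_trans main); rewrite -mulr_sumr.
have -> : \sum_(K <= n < K') (g n - g n.+1) = g K - g K'.
  rewrite -[g K - _]opprB -(telescope_sumr g KK').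
  by rewrite -sumrN; apply: eq_bigr => i _; rewrite opprB.
apply: (@le_trans _ _ (2 * C / K%:R ^+ k * g K)).
  by rewrite ler_wpM2l ?divr_ge0 ?mulr_ge0 ?exprn_ge0 // gerBl invr_ge0 sqrtr_ge0.
by rewrite le_eqVlt /g; apply/orP; left; apply/eqP; rewrite -mulrA -invfM [_ ^+ k * _]mulrC.
Qed.

Lemma partial_sum_diff z K K' t : (K <= K')%N -> -1 <= t <= 1 ->
  `|(partial_sum z K').[t] - (partial_sum z K).[t]| <= \sum_(K <= n < K') `|lcoef z n.+1|.
Proof.
move=> KK' ht; rewrite /partial_sum -!(big_mkord xpredT (fun n => lcoef z n *: L n)).
rewrite (@big_cat_nat _ _ _ K.+1 0 K'.+1) //= hornerD addrC addKr big_add1 /=.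
rewrite horner_sum; apply: (le_trans (ler_norm_sum _ _ _)); apply: ler_sum => n _.
by rewrite hornerZ normrM ler_piMr // norm_legendre_le1.
Qed.

Lemma partial_sum_orth z K (p : {poly R}) : bmeas z -> (size p <= K.+1)%N ->
  itg (-1) 1 (fun t => (z t - (partial_sum z K).[t]) * p.[t]) = 0.
Proof.
move=> hz; have hd : bmeas (fun t => z t - (partial_sum z K).[t]) by bmeas_tac.
have orth n : (n <= K)%N ->
    itg (-1) 1 (fun t => (z t - (partial_sum z K).[t]) * (L n).[t]) = 0.
  move=> nK.
  rewrite (_ : (fun t => _) = (fun t => z t * (L n).[t] - (partial_sum z K * L n).[t])); last first.
    by apply/funext => t; rewrite hornerM mulrBl.
  rewrite itgB //; [|by bmeas_tac|exact: bmeas_poly].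
  rewrite itg_integ /partial_sum mulr_suml (raddf_sum (@integ R)) /=.
  rewrite (bigD1 (Ordinal (nK : (n < K.+1)%N))) //= big1 ?addr0; last first.
    move=> i ni; rewrite -scalerAl integZ.
    have [lt|] := ltnP i n.
      by rewrite (mulrC (L i)) legendre_orth ?mulr0 // size_legendre.
    rewrite leq_eqVlt => /predU1P[e|lt]; last by rewrite legendre_orth ?mulr0 // size_legendre.
    by exfalso; move: ni => /eqP; apply; apply: val_inj.
  rewrite -scalerAl integZ legendre_norm /lcoef; move: (itg _ _ _) => x.
  have : 2 * n%:R + 1 != 0 :> R by rewrite lt0r_neq0 // ltr_wpDl // mulr_ge0.
  by move: (n%:R) => a ha; field; rewrite ha.
elim: {p}(size p) {-2}p (leqnn (size p)) => [|s IH] p sp sK.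
  move: sp; rewrite size_poly_leq0 => /eqP ->.
  rewrite (_ : (fun t => _) = (fun t => 0)) ?itg_cst ?mul0r //.
  by apply/funext => t; rewrite horner0 mulr0.
have [ps|ps] := leqP (size p) s; first exact: IH.
have {ps} sps : size p = s.+1 by apply/eqP; rewrite eqn_leq sp.
have c0 : (L s)`_s != 0 by have [_ /lt0r_neq0] := @legendre_size_coef R s.
pose a := p`_s / (L s)`_s; pose q := p - a *: L s.
have sq : (size q <= s)%N.
  apply/leq_sizeP => j; rewrite leq_eqVlt => /predU1P[<-|sj].
    by rewrite coefB coefZ /a divfK // subrr.
  by rewrite coefB coefZ !nth_default ?size_legendre ?sps // mulr0 subrr.
have -> : p = q + a *: L s by rewrite subrK.
rewrite (_ : (fun t => _) = (fun t => (z t - (partial_sum z K).[t]) * q.[t] +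
    a * ((z t - (partial_sum z K).[t]) * (L s).[t]))); last first.
  by apply/funext => t; rewrite hornerD hornerZ; ring.
rewrite itgD //; [|by bmeas_tac|by bmeas_tac].
rewrite itgZ //; last by bmeas_tac.
rewrite IH // ?(leq_trans sq) //; last by (rewrite sps in sK; apply: ltnW).
rewrite orth ?mulr0 ?addr0 //; by rewrite sps in sK.
Qed.

(** That the partial sums are Cauchy does not identify their limit.  Against a
    nonnegative polynomial p, the error of the K'-th partial sum integrates to 0 once K' is
    at least the degree of p, so that the error of the K-th one integrates to at most tau
    times the mass of p, up to sign; poly_test_le0 makes this bound pointwise. *)
Lemma partial_sum_uniform z K tau : {within `[(-1 : R), 1], continuous z} ->
  (forall K' t, (K <= K')%N -> -1 <= t <= 1 ->
    `|(partial_sum z K').[t] - (partial_sum z K).[t]| <= tau) ->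
  forall t, -1 <= t <= 1 -> `|z t - (partial_sum z K).[t]| <= tau.
Proof.
move=> cz H; have hz := bmeas_cont cz.
have main (sg : R) : sg = 1 \/ sg = -1 -> forall t, -1 <= t <= 1 ->
    sg * (z t - (partial_sum z K).[t]) - tau <= 0.
  move=> hsg; have sgle (x : R) : sg * x <= `|x|.
    case: hsg => ->; first by rewrite mul1r ler_norm.
    by rewrite mulN1r -normrN ler_norm.
  apply: poly_test_le0.
    move=> t; apply: cvgB; last exact: cvg_cst.
    apply: cvgMr; apply: cvgB; first exact: cz.
    exact: (continuous_subspaceT (@continuous_horner _ _)).
  move=> p p0; pose K' := maxn K (size p).
  have E := @partial_sum_orth z K' p hz _.
  rewrite (_ : (fun t => _) = (fun t => sg * ((z t - (partial_sum z K').[t]) * p.[t]) +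
    (sg * ((partial_sum z K').[t] - (partial_sum z K).[t]) - tau) * p.[t])); last first.
    by apply/funext => t; ring.
  rewrite itgD //; [|by bmeas_tac|by bmeas_tac].
  rewrite itgZ // ?E ?mulr0 ?add0r; [|by rewrite ltnW // ltnS leq_maxr|by bmeas_tac].
  have -> : (0 : R) = itg (-1) 1 (fun=> 0) by rewrite itg_cst // mul0r.
  apply: le_itg => //; [by bmeas_tac|by bmeas_tac|].
  move=> t ht; rewrite mulr_le0_ge0 ?p0 // subr_le0 (le_trans (sgle _)) //.
  by rewrite H // leq_maxl.
move=> t ht; rewrite ler_norml.
have := main 1 (or_introl erefl) t ht; have := main (-1) (or_intror erefl) t ht.
rewrite mul1r mulN1r !subr_le0 => h1 ->; rewrite andbT.
by rewrite lerNl.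
Qed.

End LegendreSeries.

(** * Bounded variation, norms and explicit constants *)

Section Auxiliary.
Context {R : realType}.
Notation mu := (@lebesgue_measure R).

Lemma varies_by_BV (T f : R -> R) : varies_by T f -> bounded_variation (-1) 1 f.
Proof.
move=> H.
have T1 : bounded_variation (-1) 1 T.
  apply: nondecreasing_bounded_variation => x y; rewrite !in_itv /= => /andP[x1 x2] /andP[y1 y2] xy.
  by have := H x y x1 xy y2 => /(le_trans (normr_ge0 _)); rewrite subr_ge0.
have T2 : bounded_variation (-1) 1 (f \+ T).
  apply: nondecreasing_bounded_variation => x y; rewrite !in_itv /= => /andP[x1 x2] /andP[y1 y2] xy.
  have := H x y x1 xy y2; rewrite ler_norml => /andP[h _] /=.
  by rewrite -subr_ge0; lra.
have -> : f = (f \+ T) \+ (\- T) by apply/funext => x; rewrite /= addrK.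
have h : -1 < 1 :> R by lra.
by apply: (bounded_variationD h T2); exact/bounded_variationN.
Qed.

Lemma BV_varies_by (f : R -> R) : bounded_variation (-1) 1 f ->
  varies_by (fun t => fine (total_variation (-1) t f)) f.
Proof.
move=> bf s t s1 st t1.
have t0 := le_trans s1 st.
have fin a b : -1 <= a -> a <= b -> b <= 1 -> total_variation a b f \is a fin_num.
  move=> a1 ab b1; apply/bounded_variationP => //.
  apply: (bounded_variationl ab b1).
  exact: (bounded_variationr a1 (le_trans ab b1)).
rewrite -lee_fin EFinB !fineK ?fin // ?(le_trans st) //.
rewrite (total_variationD f s1 st) addeAC subee ?fin ?add0e // ?(le_trans st) //.
exact: total_variation_ge.
Qed.

Lemma BV_bounded (f : R -> R) : bounded_variation (-1) 1 f ->
  exists C, forall t, -1 <= t <= 1 -> `|f t| <= C.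
Proof.
move=> bf; have H := BV_varies_by bf.
exists (`|f (-1)| + fine (total_variation (-1) 1 f)) => t /andP[t1 t2].
rewrite -[f t](subrK (f (-1))) addrC (le_trans (ler_normD _ _)) // lerD2l.
have h1 := H _ _ (lexx _) t1 t2; have h2 := H _ _ t1 t2 (lexx _).
apply: (le_trans h1); rewrite total_variationxx subr0.
by move: h2 => /(le_trans (normr_ge0 _)); rewrite subr_ge0.
Qed.

Lemma powR32 (x : R) : 0 < x -> x `^ (3 / 2) = Num.sqrt x * x.
Proof.
move=> x0; have -> : 3 / 2 = 2^-1 + 1 :> R by field.
by rewrite powRD ?lt0r_neq0 ?implybT // powR12_sqrt ?powRr1 ?ltW.
Qed.

Lemma zeta32_partial n :
  \sum_(1 <= k < n) ((k%:R : R) `^ (- (3 / 2))) <= 3.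
Proof.
have H m : \sum_(1 <= k < m.+2) ((k%:R : R) `^ (- (3 / 2))) <= 3 - 2 / Num.sqrt m.+1%:R.
  elim: m => [|m IH].
    rewrite big_nat1 powR1 sqrtr1 /=; lra.
  rewrite big_nat_recr //= (le_trans (lerD IH (lexx _))) //.
  have := @inv_sqrt_telescope R m; rewrite powRN powR32 //.
  by move: (_^-1) (_^-1) (_^-1) => x y w h; lra.
case: n => [|[|n]]; [by rewrite big_geq| by rewrite big_geq|].
apply: (le_trans (H n)); rewrite gerBl divr_ge0 ?sqrtr_ge0 //.
Qed.

Lemma zeta32_le : (zeta (3 / 2 : R) <= 3%:E)%E.
Proof.
rewrite /zeta; apply: lime_le.
  by apply: is_cvg_nneseries => k _ _; rewrite lee_fin powR_ge0.
by apply: nearW => n; rewrite sumEFin lee_fin zeta32_partial.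
Qed.

Lemma zeta32_ge0 : (0 <= zeta (3 / 2 : R))%E.
Proof. by apply: nneseries_ge0 => k _ _; rewrite lee_fin powR_ge0. Qed.

Lemma sqrt_pi_le2 : Num.sqrt (pi : R) <= 2.
Proof.
have -> : (2 : R) = Num.sqrt (2 ^+ 2) by rewrite sqrtr_sqr ger0_norm.
by rewrite ler_wsqrtr //; have := @pihalf_lt2 R; lra.
Qed.

Lemma lipschitz_ex (V W : normedModType R) (f : V -> W) : lipschitz f ->
  exists2 k : R, 0 <= k & forall a b, `|f a - f b| <= k * `|a - b|.
Proof.
move=> /pinfty_ex_gt0[k k0 H]; exists k; first exact: ltW.
by move=> a b; apply: (H (a, b)).
Qed.

Lemma cV_norm_le n (M : 'cV[R]_n) e : 0 <= e -> (forall i, `|M i ord0| <= e) -> `|M| <= e.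
Proof.
move=> e0 H; have -> : `|M| = mx_norm M by [].
rewrite mx_normrE; apply: bigmax_le => // -[i j] _ /=.
by rewrite (ord1 j).
Qed.

Lemma cV_norm_ge n (M : 'cV[R]_n) i : `|M i ord0| <= `|M|.
Proof.
have -> : `|M| = mx_norm M by [].
rewrite mx_normrE.
exact: (le_bigmax _ (fun ij : 'I_n * 'I_1 => `|M ij.1 ij.2|) (i, ord0)).
Qed.

Lemma Linf_le (f : R -> R) c : 0 <= c ->
  {ae mu, forall t, t \in `[-1, 1] -> `|f t| <= c} -> (Lp_norm +oo f <= c%:E)%E.
Proof.
move=> c0 H; rewrite /Lp_norm unlock /Lnorm; case: ifP => _; last by rewrite lee_fin.
apply/ess_supP; apply: (ae_imp H) => t ht /=.
rewrite lee_fin patchE; case: ifPn; last by rewrite normr0.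
by rewrite inE => /ht.
Qed.

(** For n > 1 this is lcoef_step followed by lcoef_bv.  The first coefficient involves
    the mean value of w, which the variation does not control, hence the bound U. *)
Lemma lcoef_explicit (z w T : R -> R) (U : R) n : bmeas z -> bmeas w ->
  integral_of z w -> varies_by T w -> (forall t, -1 <= t <= 1 -> `|w t| <= U) ->
  (0 < n)%N ->
  `|lcoef z n| <= 3 * (U + (T 1 - T (-1))) / (Num.sqrt n%:R * n%:R).
Proof.
move=> hz hw zw wT wU.
have m11 : -1 <= 1 :> R by lra.
have U0 : 0 <= U by apply: (le_trans (normr_ge0 _) (wU 1 _)); rewrite m11 lexx.
set V := T 1 - T (-1).
have V0 : 0 <= V by apply: le_trans (normr_ge0 _) (wT _ _ (lexx _) m11 (lexx _)).
case: n => [//|[|k]] _.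
  rewrite sqrtr1 mulr1 divr1 lcoef_diff // (itg_parts _ hz hw zw).
  rewrite !legendre_diff_ends !mulr0 subrr sub0r normrM normrN.
  have : `|itg (-1) 1 (fun t => w t * (leg 2 - leg 0).[t])| <= U * 2 * (1 - -1).
    apply: norm_itg_le => //; first by apply: bmeasM => //; exact: bmeas_poly.
    move=> t ht; rewrite normrM ler_pM ?wU //.
    rewrite hornerD hornerN (le_trans (ler_normB _ _)) //.
    have := norm_legendre_le1 2 ht; have := norm_legendre_le1 0 ht.
    by move: (`|_|) (`|_|) => x y; lra.
  have -> : `|1 / 2 : R| = 1 / 2 by rewrite ger0_norm // divr_ge0.
  by move=> h; clear -h U0 V0; lra.
rewrite (lcoef_step _ hz hw zw).
set s := Num.sqrt k.+2%:R; have s0 : 0 < s by rewrite sqrtr_gt0.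
have x0 : 0 < k.+2%:R :> R by [].
have B0 := lcoef_bv k hw wT; have B2 := lcoef_bv k.+2 hw wT.
rewrite -/V in B0 B2.
have t1 : `|lcoef w k.+1 / (2 * k.+1%:R + 1)| <= 2 * V / (s * k.+2%:R).
  have d0 : 0 < 2 * k.+1%:R + 1 :> R by rewrite ltr_wpDl // mulr_ge0.
  rewrite normrM normfV (gtr0_norm d0).
  have sq : (Num.sqrt k.+1%:R)^-1 <= 2 / s.
    have a0 : 0 < Num.sqrt k.+1%:R :> R by rewrite sqrtr_gt0.
    rewrite ler_pdivlMr // mulrC ler_pdivrMr //.
    have -> : (2 : R) = Num.sqrt (2 ^+ 2) by rewrite sqrtr_sqr ger0_norm.
    rewrite -sqrtrM // ler_wsqrtr // -natrX -natrM ler_nat; lia.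
  have -> : 2 * V / (s * k.+2%:R) = V * (2 / s) / k.+2%:R by rewrite invfM; ring.
  apply: ler_pM; rewrite ?normr_ge0 ?invr_ge0 ?(ltW d0) //.
    by apply: (le_trans B0); rewrite ler_wpM2l.
  rewrite lef_pV2 ?posrE // -(natr1 k.+1); have : 1 <= k.+1%:R :> R by rewrite (ler_nat _ 1).
  lra.
have t2 : `|lcoef w k.+3 / (2 * k.+3%:R + 1)| <= V / (s * k.+2%:R).
  have d0 : 0 < 2 * k.+3%:R + 1 :> R by rewrite ltr_wpDl // mulr_ge0.
  rewrite normrM normfV (gtr0_norm d0) invfM mulrA.
  apply: ler_pM; rewrite ?normr_ge0 ?invr_ge0 ?(ltW d0) //.
    apply: (le_trans B2); rewrite ler_wpM2l // lef_pV2 ?posrE ?sqrtr_gt0 //.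
    by rewrite ler_wsqrtr // ler_nat.
  rewrite lef_pV2 ?posrE // -(natr1 k.+2); have : 0 <= k.+2%:R :> R by [].
  lra.
apply: (le_trans (ler_normB _ _)); apply: (le_trans (lerD t1 t2)).
rewrite -mulrDl ler_wpM2r ?invr_ge0 ?mulr_ge0 ?(ltW s0) //; lra.
Qed.

End Auxiliary.

(** * The given trajectory *)

Section WithinContinuous.
Context {R : realType} {V W : topologicalType}.

Lemma within_comp (A : set R) (f : R -> V) (g : V -> W) :
  {within A, continuous f} -> continuous g -> {within A, continuous (fun t => g (f t))}.
Proof.
move=> cf cg; have := @continuous_comp (subspace A) V W f g.
by move=> H t; apply: H; [exact: cf|exact: cg].
Qed.

End WithinContinuous.

Section FeasibleTrajectory.
Context {R : realType} {q Ne Nh : nat} (P : problemB R q Ne Nh).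
Notation mu := (@lebesgue_measure R).
Variables (x : R -> 'cV[R]_q.+1) (u : R -> R) (m : nat) (y : nat -> R -> R).
Hypotheses (feas : feasible P x u) (m2 : (2 <= m)%N).
Hypothesis wd : weak_derivatives m (fun t => x t ord_max ord0) y.

Lemma lipschitz_cont (V W : normedModType R) (f : V -> W) : lipschitz f -> continuous f.
Proof.
move=> /lipschitz_ex [k k0 H] a; apply/cvgrPdist_lt => e e0.
have k1 : 0 < k + 1 by rewrite ltr_wpDl.
near=> b; apply: (le_lt_trans (H a b)).
apply: (@le_lt_trans _ _ ((k + 1) * `|a - b|)).
  by rewrite ler_wpM2r // lerDl.
rewrite mulrC -ltr_pdivlMr //; near: b.
by apply: (@cvgr_dist_lt _ _ _ _ _ id); [exact: cvg_id|rewrite divr_gt0].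
Unshelve. all: by end_near. Qed.

Let cx : {within `[-1, 1], continuous x}. Proof. by case: feas. Qed.

Lemma state_continuous i : {within `[-1, 1], continuous (fun t => x t i ord0)}.
Proof.
apply: (within_comp (g := fun M : 'cV[R]_q.+1 => M i ord0)) cx _.
exact: coord_continuous.
Qed.

Lemma state_integral (i j : 'I_q.+1) : j = i.+1 :> nat ->
  integral_of (fun t => x t i ord0) (fun t => x t j ord0).
Proof.
move=> ij; have [_ H _ _ _] := feas; have [_ lz {}H] := H i j ij.
have bj : bmeas (fun t => x t j ord0) by apply: bmeas_cont; exact: state_continuous.
apply: extend_closed => //; first exact: state_continuous.
apply: weak_derivative_integral => //; first exact: state_continuous.
by move=> phi tphi; have := H phi tphi; rewrite derive1n1 expr1 mulN1r.
Qed.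

Lemma last_state t : -1 <= t <= 1 -> x t ord_max ord0 = y 0%N t.
Proof.
move=> ht; have [wd0 cy] := wd.
apply: (@weak0_eq _ (fun t => x t ord_max ord0)) => //; first exact: state_continuous.
  by apply: cy; exact: leq_trans m2.
exact: wd0.
Qed.

(** The state equation determines the control up to a null set; this is its continuous
    representative. *)
Definition control t : R := (y 1%N t - dynf P (x t)) / dyng P (x t).

(** The last state is the integral both of y 1 and of the right-hand side of the state
    equation, which therefore agree almost everywhere. *)
Lemma control_ae : {ae mu, forall t, t \in `[-1, 1] -> u t = control t}.
Proof.
have [_ _ wu _ _] := feas; have [wd0 cy] := wd.
have [_ lz H] := wu.
have c1 : {within `[-1, 1], continuous (y 1%N)} by exact: cy.
have b1 := bmeas_cont c1.
have [_ l1 _] := wd0 1%N (ltnW m2).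
have H' phi : test_function phi ->
    \int[mu]_(t in `](-1 : R), 1[) (x t ord_max ord0 * derive1 phi t) =
    - \int[mu]_(t in `](-1 : R), 1[) ((dynf P (x t) + dyng P (x t) * u t) * phi t).
  by move=> tphi; have := H phi tphi; rewrite derive1n1 expr1 mulN1r.
have ld : locally_integrable `](-1 : R), 1[
    (fun t => (dynf P (x t) + dyng P (x t) * u t) - y 1%N t).
  exact: locally_integrableB.
apply: ae_open_closed; apply: (ae_imp (@ae_eq0_of_integrals _ _ ld _)).
  move=> a b a1 ab b1'.
  have E1 := weak_derivative_integral (@state_continuous ord_max) lz H' a1 ab b1'.
  have E2 := weak_chain wd (ltnW m2) b1 (ltW a1) (ltW ab) (ltW b1').
  rewrite RintegralB //; last 2 first.
  - exact: locally_integrable_itv lz a1 b1'.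
  - exact: locally_integrable_itv l1 a1 b1'.
  rewrite -E1.
  rewrite !last_state ?(ltW a1) ?(ltW b1') ?(ltW (lt_trans a1 ab)) ?(ltW (lt_trans ab b1')) //.
  by rewrite E2 subrr.
move=> t h ht; have := h ht; rewrite /control => /eqP; rewrite subr_eq0 => /eqP <-.
by rewrite addrC addKr mulrC mulKf // dyng_neq0.
Qed.

Lemma dyng_continuous : {within `[-1, 1], continuous (fun t => dyng P (x t))}.
Proof.
apply: within_comp cx _; apply: lipschitz_cont; exact: dyng_lipschitz.
Qed.

Lemma dynf_continuous : {within `[-1, 1], continuous (fun t => dynf P (x t))}.
Proof.
apply: within_comp cx _; apply: lipschitz_cont; exact: dynf_lipschitz.
Qed.

Lemma control_continuous : {within `[-1, 1], continuous control}.
Proof.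
have [_ cy] := wd; move=> t.
apply: cvgM; first by apply: cvgB; [exact: cy|exact: dynf_continuous].
by apply: cvgV; [exact: dyng_neq0|exact: dyng_continuous].
Qed.

Lemma control_bounded : exists2 C : R, 0 <= C & forall t, -1 <= t <= 1 -> `|control t| <= C.
Proof.
have [_ [C HC]] := bmeas_cont control_continuous; exists C => //.
by apply: (le_trans (normr_ge0 (control 0))); apply: HC; apply/andP; split; lra.
Qed.

Lemma dyng_lower : exists2 g0 : R, 0 < g0 & forall t, -1 <= t <= 1 -> g0 <= `|dyng P (x t)|.
Proof.
have cg : {within `[-1, 1], continuous (fun t => `|dyng P (x t)|)}.
  apply: (within_comp (g := fun r : R => `|r|)) dyng_continuous _.
  exact: norm_continuous.
have m11 : -1 <= 1 :> R by lra.
have [c _ H] := EVT_min m11 cg.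
exists `|dyng P (x c)|; first by rewrite normr_gt0 dyng_neq0.
by move=> t ht; apply: H; rewrite in_itv.
Qed.

Lemma state_bounded : exists2 C : R, 0 <= C &
  forall t i, -1 <= t <= 1 -> `|x t i ord0| <= C.
Proof.
have [M [_ HM]] := compact_bounded (continuous_compact cx (@segment_compact _ (-1) 1)).
have H t : -1 <= t <= 1 -> `|x t| <= M + 1.
  by move=> ht; apply: (HM (M + 1)); [rewrite ltrDl|exists t => //=; rewrite in_itv].
exists (M + 1).
  by apply: (le_trans (normr_ge0 (x 0))); apply: H; apply/andP; split; lra.
by move=> t i ht; apply: le_trans (cV_norm_ge _ _) _; exact: H.
Qed.

(** The constraint holds on a dense set, on which u is the continuous control. *)
Lemma path_everywhere t j : -1 <= t <= 1 -> pathh P (x t, control t) j ord0 <= 0.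
Proof.
move=> ht; have [_ _ _ _ hp] := feas.
have ch : {within `[-1, 1], continuous (fun t => pathh P (x t, control t) j ord0)}.
  apply: (within_comp (f := fun t => pathh P (x t, control t))
    (g := fun M : 'cV[R]_Nh => M j ord0)).
    apply: (within_comp (f := fun t => (x t, control t)) (g := pathh P)).
      by move=> s; exact: (cvg_pair (@cx s) (@control_continuous s)).
    by apply: lipschitz_cont; exact: pathh_lipschitz.
  exact: coord_continuous.
have ae : {ae mu, forall t, t \in `[-1, 1] -> pathh P (x t, control t) j ord0 <= 0}.
  by apply: (ae_imp2 control_ae hp) => s e h hs; rewrite -e //; exact: h.
rewrite leNgt; apply/negP => h.
have [r r0 H] := within_continuousP ch ht h.
have [s [s1 s2 s3]] := ae_dense ae ht r0.
have := H s s1 s2; rewrite ltr_norml => /andP[h' _]; lra.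
Qed.

End FeasibleTrajectory.

(** * Approximation by repeated integration *)

Section Approximants.
Context {R : realType}.
Local Notation L := (@leg R).
Implicit Types (p : {poly R}) (F : nat -> R -> R).

Definition antider p (v : R) : {poly R} := primp p + (v - (primp p).[-1])%:P.

Lemma deriv_antider p v : (antider p v)^`() = p.
Proof. by rewrite /antider derivD deriv_primp derivC addr0. Qed.

Lemma antider_start p v : (antider p v).[-1] = v.
Proof. by rewrite /antider hornerD hornerC addrC subrK. Qed.

Lemma size_antider p v : (size (antider p v) <= (size p).+1)%N.
Proof.
rewrite (leq_trans (size_polyD _ _)) // geq_max size_primp.
by rewrite (leq_trans (size_polyC_leq1 _)).
Qed.

(** Polynomial counterpart of a chain F of successive integrals: F 0 is approximated
    by p, and the chain is then integrated rather than approximated again, so that the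
    derivatives of an approximant are the preceding approximants. *)
Fixpoint approx F p k : {poly R} :=
  if k is k'.+1 then antider (approx F p k') (F k (-1)) else p.

Lemma derivn_approx F p k l : (l <= k)%N -> derivn l (approx F p k) = approx F p (k - l).
Proof.
elim: l => [|l IH] lk; first by rewrite subn0.
rewrite derivnS IH ?(ltnW lk) // subnS; case: (k - l)%N (subn_gt0 l k) => [|j].
  by rewrite lk.
by rewrite /= deriv_antider.
Qed.

Lemma size_approx F p k : (size (approx F p k) <= size p + k)%N.
Proof.
elim: k => [|k IH] /=; first by rewrite addn0.
by rewrite (leq_trans (size_antider _ _)) // addnS ltnS.
Qed.

(** Both sequences start from the same value at -1, and the interval of integration
    has length at most 2. *)
Lemma approx_error F p n (tau : R) :
  (forall k, (k < n)%N -> bmeas (F k)) ->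
  (forall k, (k < n)%N -> integral_of (F k.+1) (F k)) -> 0 <= tau ->
  (forall t, -1 <= t <= 1 -> `|p.[t] - F 0%N t| <= tau) ->
  forall k, (k <= n)%N -> forall t, -1 <= t <= 1 ->
  `|(approx F p k).[t] - F k t| <= 2 ^+ k * tau.
Proof.
move=> bF iF tau0 H0; elim=> [_ t ht|k IH kn t /andP[t1 t2]].
  by rewrite expr0 mul1r; exact: H0.
have E : (approx F p k.+1).[t] - F k.+1 t = itg (-1) t (fun s => (approx F p k).[s] - F k s).
  have bp := bmeas_poly (approx F p k).
  have := @itgB R (-1) t (lexx _) t2 _ _ bp (bF k kn) => ->.
  have e1 : itg (-1) t (horner (approx F p k)) = (approx F p k.+1).[t] - (approx F p k.+1).[-1].
    by rewrite -itg_deriv // /= deriv_antider.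
  by rewrite e1 -(iF k kn) // [X in _ = _ - X - _]antider_start; ring.
rewrite E; apply: (le_trans (norm_itg_le (C := 2 ^+ k * tau) _ t1 t2 _ _)) => //.
- by apply: bmeasB; [exact: bmeas_poly|exact: bF].
- by move=> s /andP[s1 s2]; apply: IH; [exact: ltnW|rewrite s1 (le_trans s2)].
rewrite exprS -[leRHS]mulrA [leRHS]mulrC ler_wpM2l ?mulr_ge0 ?exprn_ge0 //.
by clear -t2; lra.
Qed.

(** The product of L n and of the partial sum has degree less than 2 N, which the
    quadrature integrates exactly; beyond K the partial sum has no coefficient. *)
Lemma spectral_coef_approx N m1 p (z : R -> R) K n : (0 < N)%N -> bmeas z ->
  (size p <= N.+1)%N -> derivn m1 p = partial_sum z K ->
  (n + K < 2 * N)%N ->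
  spectral_coef m1 (nodal_values N p) n = if (n <= K)%N then lcoef z n else 0.
Proof.
move=> N0 hz sp dp nK; rewrite spectral_coefE // dp.
have sS := size_partial_sum z K.
rewrite quadrature_exact //; last first.
  rewrite (leq_trans (size_polyMleq _ _)) // size_legendre addSn /=.
  by rewrite (leq_trans _ nK) // -addnS leq_add2l.
case: leqP => [le|lt]; last by rewrite legendre_orth ?mulr0 // (leq_trans sS).
rewrite -itg_integ /lcoef; congr (_ * _).
have := @partial_sum_orth _ z K (L n) hz; rewrite size_legendre ltnS => /(_ le).
rewrite (_ : (fun t => _) = (fun t => z t * (L n).[t] - (L n * partial_sum z K).[t])); last first.
  by apply/funext => t; rewrite hornerM; ring.
rewrite itgB //; [|by apply: bmeasM => //; exact: bmeas_poly|exact: bmeas_poly].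
by move=> /eqP; rewrite subr_eq0 => /eqP.
Qed.

Lemma powR_half_le (K k : nat) (alpha : R) : (0 < K)%N -> alpha <= k%:R + 1 / 2 ->
  K%:R `^ alpha <= Num.sqrt K%:R * K%:R ^+ k.
Proof.
move=> K0 h; have K1 : 1 <= K%:R :> R by rewrite ler1n.
apply: (le_trans (ler_powR K1 h)).
rewrite powRD ?(lt0r_neq0 (lt_le_trans ltr01 K1)) ?implybT //.
by rewrite powR_mulrn // div1r powR12_sqrt // mulrC.
Qed.

(** With w = (a0 - b0) / g0, the difference is
    ((a - a0) - (b - b0) - w (g - g0)) / g, and |g| stays above gm / 2. *)
Lemma quotient_error (a a0 b b0 g g0 e Lf Lg Bu gm : R) :
  0 < gm -> 0 <= e -> 0 <= Lf -> 0 <= Lg -> 0 <= Bu ->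
  `|a - a0| <= e -> `|b - b0| <= Lf * e -> `|g - g0| <= Lg * e ->
  gm <= `|g0| -> Lg * e <= gm / 2 -> `|(a0 - b0) / g0| <= Bu ->
  `|(a - b) / g - (a0 - b0) / g0| <= (1 + Lf + Bu * Lg) * (2 / gm) * e.
Proof.
move=> gm0 e0 Lf0 Lg0 Bu0 ha hb hg hg0 small; set w := (a0 - b0) / g0 => hw.
have g00 : g0 != 0 by rewrite -normr_gt0 (lt_le_trans gm0).
have gl : gm / 2 <= `|g|.
  have : `|g0| <= `|g| + `|g - g0|.
    by have := ler_normB g (g - g0); rewrite subKr.
  by move=> h; clear -h hg hg0 small; lra.
have gp : 0 < `|g| by apply: lt_le_trans gl; rewrite divr_gt0.
have g1 : g != 0 by rewrite -normr_gt0.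
have -> : (a - b) / g - w = ((a - a0) - (b - b0) - w * (g - g0)) / g.
  by rewrite /w; field; rewrite g00 g1.
rewrite normrM normfV ler_pdivrMr //.
have num : `|(a - a0) - (b - b0) - w * (g - g0)| <= (1 + Lf + Bu * Lg) * e.
  apply: (le_trans (ler_normB _ _)); apply: (le_trans (lerD (ler_normB _ _) (lexx _))).
  rewrite normrM !mulrDl mul1r; apply: lerD; first exact: lerD.
  by rewrite -mulrA ler_pM.
apply: (le_trans num).
have -> : (1 + Lf + Bu * Lg) * (2 / gm) * e * `|g| =
   (1 + Lf + Bu * Lg) * e * (`|g| * 2 / gm) by ring.
rewrite ler_peMr ?mulr_ge0 ?addr_ge0 ?mulr_ge0 // ler_pdivlMr // mul1r.
by clear -gl; lra.
Qed.

(** K is at least half of N - q - 2, and beta < alpha leaves room for any constant. *)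
Lemma growth (c alpha beta : R) (q m1 k0 : nat) : 0 <= c -> 0 < beta -> beta < alpha ->
  exists2 N0 : nat, (0 < N0)%N & forall N, (N0 <= N)%N ->
  let K := (N - q - m1)%N in
  [/\ (k0 < K)%N, (q + m1 < N)%N, c / K%:R `^ alpha <= (N%:R - q.+1%:R - 1) `^ (- beta)
    & (N%:R - q.+1%:R - 1 : R) `^ (- beta) <= 1].
Proof.
move=> c0 b0 ba; have s0 : 0 < alpha - beta by rewrite subr_gt0.
have a0 : 0 < alpha by apply: lt_trans ba.
pose A := (c * 2 `^ alpha) `^ (alpha - beta)^-1.
pose n := Num.truncn A.
exists (q + 2 + 2 * m1 + k0 + n + 1)%N; first by rewrite addn1.
move=> N hN K.
have [d Nd] : exists d, N = (q + 2 + d)%N by exists (N - (q + 2))%N; lia.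
have hd : (2 * m1 + k0 + n + 1 <= d)%N by lia.
have KE : K = (d + 2 - m1)%N by rewrite /K; lia.
have dE : N%:R - q.+1%:R - 1 = d%:R :> R by rewrite Nd !natrD -natr1; ring.
have d1 : 1 <= d%:R :> R by rewrite ler1n; lia.
have d0 : 0 < d%:R :> R by apply: lt_le_trans d1.
have K2 : d%:R / 2 <= K%:R :> R.
  by rewrite ler_pdivrMr // -natrM ler_nat KE; lia.
have K0 : 0 < K%:R :> R by apply: lt_le_trans K2; rewrite divr_gt0.
split; [by clear -hd KE; lia|by clear -hN; lia| |].
  rewrite dE ler_pdivrMr ?powR_gt0 //.
  have h1 : (d%:R / 2) `^ alpha <= K%:R `^ alpha.
    by apply: ge0_ler_powR; rewrite ?nnegrE ?divr_ge0 // ltW.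
  have h2 : c * 2 `^ alpha <= d%:R `^ (alpha - beta).
    have Ad : A <= d%:R.
      apply: ltW; apply: (lt_le_trans (@real_truncnS_gt _ A (num_real _))).
      by rewrite ler_nat -/n; clear -hd; lia.
    have : A `^ (alpha - beta) <= d%:R `^ (alpha - beta).
      by apply: ge0_ler_powR; rewrite ?nnegrE ?powR_ge0 ?(ltW s0) ?(ltW d0).
    rewrite /A -powRrM mulVf ?lt0r_neq0 // powRr1 // mulr_ge0 // powR_ge0.
  rewrite powRN mulrC ler_pdivlMr ?powR_gt0 //.
  apply: le_trans h1; rewrite powRM ?invr_ge0 //.
  have -> : d%:R `^ alpha = d%:R `^ (alpha - beta) * d%:R `^ beta :> R.
    by rewrite -powRD ?subrK // (lt0r_neq0 d0) implybT.
  have -> : 2^-1 `^ alpha = (2 `^ alpha)^-1 :> R.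
    by rewrite -powR_inv1 // -powRrM mulN1r powRN.
  by rewrite mulrAC ler_wpM2r ?powR_ge0 // ler_pdivlMr ?powR_gt0.
rewrite dE powRN invf_le1 ?powR_gt0 //.
by have := ler_powR d1 (ltW b0); rewrite powRr0.
Qed.

(** S is a fixed number, possibly infinite: it can be absorbed in M unless it is 0. *)
Lemma absorb_norm (Ct : R) (S : \bar R) : 0 <= Ct -> (0 <= S)%E -> (S = 0%E -> Ct = 0) ->
  exists2 M : R, 0 < M & forall rho, 0 < rho -> ((Ct / rho)%:E <= (M / rho)%:E * S)%E.
Proof.
move=> Ct0; case: S => [s|_ _|//].
  rewrite lee_fin le_eqVlt => /predU1P[<-|s0] H.
    by exists 1 => // rho _; rewrite H // mul0r mule0.
  have s1 : s != 0 by rewrite lt0r_neq0.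
  exists (Ct / s + 1); first by rewrite ltr_wpDl // divr_ge0 // ltW.
  move=> rho r0; rewrite -EFinM lee_fin mulrAC ler_wpM2r ?invr_ge0 ?(ltW r0) //.
  by rewrite mulrDl divfK // mul1r lerDl ltW.
exists 1 => // rho r0; by rewrite gt0_muley ?leey // lte_fin divr_gt0.
Qed.

End Approximants.

(** * Derivatives of the last state *)

Section Assembly.
Context {R : realType} {q Ne Nh : nat} (P : problemB R q Ne Nh).
Notation mu := (@lebesgue_measure R).
Variables (x : R -> 'cV[R]_q.+1) (u : R -> R) (m : nat) (y : nat -> R -> R) (m1 : nat).
Hypotheses (feas : feasible P x u) (m2 : (2 <= m)%N).
Hypothesis wd : weak_derivatives m (fun t => x t ord_max ord0) y.
Hypothesis bv : bounded_variation (-1) 1 (y m).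
Hypotheses (m1_gt0 : (1 <= m1)%N) (m1_lt : (m1 <= m - 1)%N).

Let m1m : (m1 < m)%N. Proof. by move: m1_lt m2; clear; lia. Qed.

Lemma bmeas_derivative j : (j <= m)%N -> bmeas (y j).
Proof.
have [wd0 cy] := wd; rewrite leq_eqVlt => /predU1P[->|jm]; last exact: bmeas_cont (cy _ jm).
have [C HC] := BV_bounded bv; apply: (@bmeas_of_locally_integrable _ _ C) => //.
by have [] := wd0 m (leqnn _).
Qed.

Lemma derivative_integral j : (j < m)%N -> integral_of (y j) (y j.+1).
Proof. by move=> jm s t; apply: (weak_chain wd) => //; exact: bmeas_derivative. Qed.

Lemma derivative_chain : exists T, chain_bv (m - m1) (fun j => y (m1 + j)%N) T.
Proof.
exists (fun t => fine (total_variation (-1) t (y m))).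
suff H k i : (i + k)%N = m -> chain_bv k (fun j => y (i + j)%N)
    (fun t => fine (total_variation (-1) t (y m))).
  by apply: H; rewrite subnKC // ltnW.
elim: k i => [|k IH] i ik /=.
  rewrite addn0 in ik *; rewrite ik; split; [exact: bmeas_derivative|exact: BV_varies_by].
have lt : (i < m)%N by rewrite -ik -addSnnS leq_addr.
rewrite addn0 addn1; split.
- exact: bmeas_derivative (ltnW lt).
- exact: bmeas_derivative.
- exact: derivative_integral.
have -> : (fun j => y (i + j.+1)%N) = (fun j => y (i.+1 + j)%N).
  by apply/funext => j; rewrite addSnnS.
by apply: IH; rewrite addSnnS.
Qed.

(** Either y m1.+1 is y m, or it is Lipschitz continuous. *)
Lemma next_derivative_varies : exists2 T, varies_by T (y m1.+1) &
  total_variation (-1) 1 (y m1.+1) = (T 1 - T (-1))%:E.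
Proof.
have bw : bounded_variation (-1) 1 (y m1.+1).
  have := m1m; rewrite leq_eqVlt => /predU1P[->//|lt].
  have [_ [C HC]] := bmeas_derivative lt.
  apply: (@varies_by_BV _ (fun t => C * t)) => s t s1 st t1.
  rewrite (derivative_integral lt) // -mulrBr.
  apply: norm_itg_le => //; first exact: bmeas_derivative.
  by move=> r /andP[r1 r2]; apply: HC; rewrite (le_trans s1) ?(le_trans r2).
exists (fun t => fine (total_variation (-1) t (y m1.+1))); first exact: BV_varies_by.
rewrite total_variationxx subr0 fineK //.
by apply/bounded_variationP => //; lra.
Qed.

(** The derivatives of the last state from order m1 down to 1, followed by the states
    from the last one to the first: each is an integral of the previous one. *)
Definition ladder (k : nat) : R -> R :=
  if (k < m1)%N then y (m1 - k)%N else fun t => x t (inord (m1 + q - k)) ord0.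

Lemma ladder_continuous k : {within `[-1, 1], continuous (ladder k)}.
Proof.
rewrite /ladder; case: ifP => km; last exact: state_continuous feas _.
have [_ cy] := wd; apply: cy; apply: leq_ltn_trans m1m; exact: leq_subr.
Qed.

Lemma ladder_integral k : (k < m1 + q)%N -> integral_of (ladder k.+1) (ladder k).
Proof.
move=> kq; rewrite /ladder; case: ltnP => h1.
  rewrite (ltnW h1) -(subnSK (ltnW h1)); apply: derivative_integral.
  by apply: leq_ltn_trans m1m; exact: leq_subr.
case: ltnP => h2.
  have e : m1 = k.+1 by apply/eqP; rewrite eqn_leq h1 h2.
  rewrite e addKn (subSnn k).
  have -> : (inord q : 'I_q.+1) = ord_max by apply: val_inj; rewrite /= inordK.
  move=> s t s1 st t1.
  have hs : -1 <= s <= 1 by rewrite s1 (le_trans st).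
  have ht : -1 <= t <= 1 by rewrite t1 (le_trans s1).
  rewrite !(last_state feas m2 wd) //.
  by apply: derivative_integral => //; apply: leq_trans m2.
apply: (state_integral feas); rewrite !inordK; move: h2 kq; clear; lia.
Qed.

Lemma ladder0 : ladder 0 = y m1.
Proof. by rewrite /ladder m1_gt0 subn0. Qed.

Lemma ladder_state (i : 'I_q.+1) : ladder (m1 + (q - i)) = fun t => x t i ord0.
Proof.
rewrite /ladder ltnNge leq_addr /=; apply/funext => t; congr (x t _ _).
apply: val_inj; rewrite /= inordK; have := ltn_ord i; clear; lia.
Qed.

Let alpha : R := (m%:R - m1%:R) - 3 / 4.

(** The exponent m - m1 - 1/2 given by lcoef_tail is larger than the required one.
    The constant is 0 when y m1 vanishes, which is the case of a zero Sobolev norm. *)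
Lemma projection_rate : exists2 C : R, 0 <= C &
  ((forall t, -1 <= t <= 1 -> y m1 t = 0) -> C = 0) /\
  forall K, (m < K)%N -> forall t, -1 <= t <= 1 ->
    `|(partial_sum (y m1) K).[t] - y m1 t| <= C / K%:R `^ alpha.
Proof.
have [_ cy] := wd; have cz := cy m1 m1m.
have [z0|z0] := pselect (forall t, -1 <= t <= 1 -> y m1 t = 0).
  exists 0 => //; split => // K _ t ht; rewrite mul0r z0 // subr0.
  have -> : partial_sum (y m1) K = 0.
    rewrite /partial_sum big1 // => i _.
    have -> : lcoef (y m1) i = 0; last by rewrite scale0r.
    rewrite /lcoef (@eq_itg _ _ _ _ (fun=> 0)); last by move=> s hs; rewrite z0 // mul0r.
    by rewrite itg_cst ?mul0r ?mulr0 //; lra.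
  by rewrite horner0 normr0.
have [T] := derivative_chain; have -> : (m - m1)%N = (m - m1.+1).+1 by rewrite subnSK.
move=> /lcoef_tail [C C0]; rewrite addn0 => HC.
exists C => //; split => // K mK t ht.
have K0 : (0 < K)%N by apply: leq_ltn_trans mK.
have kK : (m - m1.+1 < K)%N by apply: leq_ltn_trans mK; exact: leq_subr.
have H := @partial_sum_uniform _ (y m1) K (C / (Num.sqrt K%:R * K%:R ^+ (m - m1.+1))) cz.
rewrite distrC (le_trans (H _ t ht)) //.
  move=> K' s KK' hs; apply: (le_trans (partial_sum_diff _ KK' hs)).
  exact: HC.
rewrite ler_wpM2l // lef_pV2 ?posrE ?powR_gt0 ?mulr_gt0 ?exprn_gt0 ?sqrtr_gt0 ?ltr0n //.
apply: powR_half_le => //.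
rewrite natrB // -natr1 /alpha; lra.
Qed.

(** The bound must be uniform in K, for the discrete sums are compared with a
    constant chosen before N. *)
Lemma coef_sum_bounded : exists C : R, forall K, (m < K)%N ->
  \sum_(n < K.+1) `|lcoef (y m1) n| <= C.
Proof.
have [T] := derivative_chain; have -> : (m - m1)%N = (m - m1.+1).+1 by rewrite subnSK.
move=> /lcoef_tail [C C0]; rewrite addn0 => HC.
exists (\sum_(0 <= n < m.+1) `|lcoef (y m1) n| + C / (Num.sqrt m%:R * m%:R ^+ (m - m1.+1))).
move=> K mK; rewrite -(big_mkord xpredT (fun n => `|lcoef (y m1) n|)).
rewrite (@big_cat_nat _ _ _ m.+1 0 K.+1) //=; last exact: ltnW.
rewrite lerD2l big_add1 /=; apply: HC; last exact: ltnW.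
by move: m1m; clear; lia.
Qed.

Lemma derivatives_bounded : exists2 C : R, 0 <= C &
  forall j t, (j <= m)%N -> -1 <= t <= 1 -> `|y j t| <= C.
Proof.
suff H k : (k <= m.+1)%N -> exists2 C : R, 0 <= C &
  forall j t, (j < k)%N -> -1 <= t <= 1 -> `|y j t| <= C by exact: H (leqnn _).
elim: k => [|k IH] km; first by exists 0.
have [C C0 HC] := IH (ltnW km); have [_ [D HD]] := bmeas_derivative km.
exists (Num.max C D); first by rewrite le_max C0.
move=> j t; rewrite ltnS leq_eqVlt => /predU1P[->|jk] ht; rewrite le_max.
  by rewrite HD // orbT.
by rewrite HC.
Qed.

Lemma sobolev_eq0 : sobolev_norm m 2%:E y = 0%E -> forall t, -1 <= t <= 1 -> y m1 t = 0.
Proof.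
rewrite /sobolev_norm => S0.
have Lp_ge0 p f : (0 <= Lp_norm p f :> \bar R)%E by rewrite /Lp_norm; exact: Lnorm_ge0.
have Lp0 : Lp_norm 2%:E (y m1) = 0%E.
  have := S0; rewrite (bigD1 (inord m1)) //= inordK ?ltnS 1?ltnW // => E.
  by apply/eqP; rewrite eq_le Lp_ge0 andbT -E leeDl // sume_ge0.
have [_ cy] := wd; have cz := cy m1 m1m.
have [mz _] := bmeas_cont cz.
have lt02 : (0 < 2%:E :> \bar R)%E by rewrite lte_fin.
have ae0 := @Lnorm_eq0_eq0 _ _ R mu _ 2%:E _ lt02 Lp0.
have ae : {ae mu, forall t, t \in `[-1, 1] -> y m1 t = 0}.
  have mf : measurable_fun `[(-1 : R), 1] (EFin \o y m1) by exact/measurable_EFinP.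
  apply: (ae_imp (ae0 _)) => [|t /= h ht]; last have := h I.
    rewrite -restrict_EFin.
    exact: (measurable_restrictT (EFin \o y m1) (measurable_itv `[(-1 : R), 1])).1 mf.
  by rewrite patchE mem_set // => -[].
move=> t ht; apply/eqP; rewrite -normr_eq0 eq_le normr_ge0 andbT.
rewrite leNgt; apply/negP => h.
have [r r0 Hr] := within_continuousP cz ht h.
have [s [s1 s2 s3]] := ae_dense ae ht r0.
by have := Hr s s1 s2; rewrite s3 sub0r normrN ltxx.
Qed.

End Assembly.

(** * The discrete trajectory *)

Section Candidate.
Context {R : realType} {q Ne Nh : nat} (P : problemB R q Ne Nh).
Notation mu := (@lebesgue_measure R).
Variables (x : R -> 'cV[R]_q.+1) (u : R -> R) (m : nat) (y : nat -> R -> R) (m1 : nat).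
Hypotheses (feas : feasible P x u) (m2 : (2 <= m)%N).
Hypothesis wd : weak_derivatives m (fun t => x t ord_max ord0) y.
Hypothesis bv : bounded_variation (-1) 1 (y m).
Hypotheses (m1_gt0 : (1 <= m1)%N) (m1_lt : (m1 <= m - 1)%N).
Variables (N K : nat).
Hypothesis NE : N = (K + m1 + q)%N.

Local Notation Q := (approx (ladder x y m1) (partial_sum (y m1) K)).

(** The state of index i is m1 + (q - i) antiderivatives above the partial sum of
    order K, which brings the degree to at most K + m1 + q = N. *)
Definition candidate (i : 'I_q.+1) : {poly R} := Q (m1 + (q - i)).

Definition candidate_states : 'M[R]_(q.+1, N.+1) := \matrix_(i, k) (candidate i).[node k].

Definition candidate_controls : 'rV[R]_N.+1 :=
  \row_k interp_control P candidate (node k).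

Let N0 : (0 < N)%N. Proof. by move: NE m1_gt0; clear; lia. Qed.

Lemma size_candidate i : (size (candidate i) <= N.+1)%N.
Proof.
rewrite (leq_trans (size_approx _ _ _)) //.
rewrite (leq_trans (leq_add (size_partial_sum _ _) (leqnn _))) //.
by rewrite NE; clear; lia.
Qed.

Lemma deriv_candidate (i j : 'I_q.+1) : j = i.+1 :> nat -> (candidate i)^`() = candidate j.
Proof.
move=> ij; rewrite /candidate; have jq := ltn_ord j.
have -> : (m1 + (q - i))%N = (m1 + (q - j)).+1 by clear -ij jq; lia.
by rewrite /= deriv_antider.
Qed.

Lemma derivn_candidate l : (l <= m1)%N -> derivn l (candidate ord_max) = Q (m1 - l).
Proof. by move=> lm; rewrite /candidate subnn addn0 derivn_approx. Qed.

Lemma ladder_derivative l : (1 <= l)%N -> (l <= m1)%N -> ladder x y m1 (m1 - l) = y l.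
Proof. by move=> l1 lm; rewrite /ladder ltn_subrL l1 m1_gt0 /= subKn. Qed.

Lemma candidate_interpolates : interpolates candidate_states candidate.
Proof. by move=> i; split=> [|k]; [exact: size_candidate|rewrite mxE]. Qed.

Lemma row_candidate i : (row i candidate_states)^T = nodal_values N (candidate i).
Proof. by apply/colP => k; rewrite !mxE. Qed.

Lemma col_candidate k : col k candidate_states = interp_state candidate (node k).
Proof. by apply/colP => i; rewrite !mxE. Qed.

(** Exactness of the matrix reduces the chain to identities between polynomials; the
    last equation is the definition of the control. *)
Lemma candidate_dynamics :
  (forall i j : 'I_q.+1, j = i.+1 :> nat ->
     lgl_diff N *m (row i candidate_states)^T = (row j candidate_states)^T) /\
  forall k, (lgl_diff N *m (row ord_max candidate_states)^T) k ord0 =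
    dynf P (col k candidate_states) + dyng P (col k candidate_states) * candidate_controls ord0 k.
Proof.
split=> [i j ij|k]; rewrite row_candidate (lgl_diff_correct N0 (size_candidate _)).
  by rewrite (deriv_candidate ij) row_candidate.
by rewrite mxE col_candidate mxE /interp_control mulrC divfK ?dyng_neq0 // addrC subrK.
Qed.

Lemma candidate_start j : (1 <= j)%N -> (j <= m1 - 1)%N ->
  (lgl_diff N ^+ j *m (row ord_max candidate_states)^T) ord0 ord0 = y j (-1).
Proof.
move=> j1 jm; have jm1 : (j < m1)%N by move: jm m1_gt0; clear; lia.
rewrite row_candidate (lgl_diff_iter N0 j (size_candidate _)) mxE node_first.
rewrite derivn_candidate ?(ltnW jm1) // -(subnSK jm1) /= antider_start.
by rewrite (subnSK jm1) ladder_derivative ?(ltnW jm1).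
Qed.

Lemma candidate_spectral n : bmeas (y m1) -> (n + K < 2 * N)%N ->
  spectral_coef m1 (row ord_max candidate_states)^T n =
  if (n <= K)%N then lcoef (y m1) n else 0.
Proof.
move=> bz nK; rewrite row_candidate; apply: spectral_coef_approx => //.
  exact: size_candidate.
by rewrite derivn_candidate // subnn.
Qed.

Variable tau : R.
Hypothesis tau0 : 0 <= tau.
Hypothesis proj : forall t, -1 <= t <= 1 -> `|(partial_sum (y m1) K).[t] - y m1 t| <= tau.
Local Notation e := (2 ^+ (m1 + q) * tau).

Lemma ladder_error k t : (k <= m1 + q)%N -> -1 <= t <= 1 ->
  `|(Q k).[t] - ladder x y m1 k t| <= e.
Proof.
move=> kn ht.
apply: le_trans (@approx_error _ (ladder x y m1) _ (m1 + q) tau _ _ tau0 _ k kn t ht) _.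
- by move=> j jn; apply: bmeas_cont; exact: (ladder_continuous feas m2 wd).
- by move=> j jn; exact: (ladder_integral feas m2 wd bv).
- by rewrite ladder0.
by rewrite ler_wpM2r // ler_weXn2l // ler1n.
Qed.

Lemma candidate_error i t : -1 <= t <= 1 -> `|(candidate i).[t] - x t i ord0| <= e.
Proof.
move=> ht; rewrite /candidate.
have := @ladder_error (m1 + (q - i)) t; rewrite ladder_state; apply => //.
by rewrite leq_add2l leq_subr.
Qed.

Lemma derivative_error l t : (1 <= l)%N -> (l <= m1)%N -> -1 <= t <= 1 ->
  `|(derivn l (candidate ord_max)).[t] - y l t| <= e.
Proof.
move=> l1 lm ht; rewrite derivn_candidate // -(ladder_derivative l1 lm).
by apply: ladder_error => //; rewrite (leq_trans (leq_subr _ _)) // leq_addr.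
Qed.

Lemma state_error t : -1 <= t <= 1 -> `|interp_state candidate t - x t| <= e.
Proof.
move=> ht; apply: cV_norm_le => [|i]; first by rewrite mulr_ge0 ?exprn_ge0.
by rewrite !mxE; exact: candidate_error.
Qed.

Lemma control_error (Lf Lg Bu gm : R) t : 0 < gm -> 0 <= Lf -> 0 <= Lg -> 0 <= Bu ->
  (forall a b, `|dynf P a - dynf P b| <= Lf * `|a - b|) ->
  (forall a b, `|dyng P a - dyng P b| <= Lg * `|a - b|) ->
  -1 <= t <= 1 -> gm <= `|dyng P (x t)| -> `|control P x y t| <= Bu ->
  Lg * e <= gm / 2 ->
  `|interp_control P candidate t - control P x y t| <= (1 + Lf + Bu * Lg) * (2 / gm) * e.
Proof.
move=> gm0 Lf0 Lg0 Bu0 Hf Hg ht Hgm HB small.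
have se := state_error ht.
apply: quotient_error => //; first by rewrite mulr_ge0 ?exprn_ge0.
- by rewrite -derivn1; exact: derivative_error.
- by apply: (le_trans (Hf _ _)); rewrite ler_wpM2l.
- by apply: (le_trans (Hg _ _)); rewrite ler_wpM2l.
Qed.

Lemma pair_norm_le (V W : normedModType R) (a a' : V) (b b' : W) (r : R) :
  `|a - a'| <= r -> `|b - b'| <= r -> `|(a, b) - (a', b')| <= r.
Proof. by move=> ha hb; rewrite prod_normE /= ge_max ha hb. Qed.

(** Both endpoint and path constraints hold for the given trajectory and are Lipschitz
    continuous; the box leaves a margin of 1; the derivatives at -1 are the exact ones; and
    the spectral coefficients are those of y m1. *)
Lemma candidate_feasible (beta r Le Lh Bx Bu Dy CS : R) (B : bounds R q) :
  (forall t, -1 <= t <= 1 -> `|interp_state candidate t - x t| <= r) ->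
  (forall t, -1 <= t <= 1 -> `|interp_control P candidate t - control P x y t| <= r) ->
  r <= 1 ->
  0 <= Le -> (forall a b, `|ende P a - ende P b| <= Le * `|a - b|) ->
  0 <= Lh -> (forall a b, `|pathh P a - pathh P b| <= Lh * `|a - b|) ->
  Le * r <= (N%:R - q.+1%:R - 1) `^ (- beta) ->
  Lh * r <= (N%:R - q.+1%:R - 1) `^ (- beta) ->
  (forall t i, -1 <= t <= 1 -> `|x t i ord0| <= Bx) ->
  (forall t, -1 <= t <= 1 -> `|control P x y t| <= Bu) ->
  (forall j, (j <= m)%N -> `|y j (-1)| <= Dy) ->
  \sum_(n < K.+1) `|lcoef (y m1) n| <= CS ->
  beyond m1 (Bounds (const_mx (- (Bx + 1)), - (Bu + 1)) (const_mx (Bx + 1), Bu + 1)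
    (fun=> - Dy) (fun=> Dy) CS) B ->
  feasibleN P m1 beta B candidate_states candidate_controls.
Proof.
move=> hs hc r1 Le0 He Lh0 Hh dE dH hBx hBu hDy hCS [[lo1 lo2] [hi1 hi2] der dC].
have nd := @node_bound R N N0.
have b1 := nd ord0; rewrite node_first in b1.
have b2 := nd ord_max; rewrite node_last // in b2.
have ce k : candidate_controls ord0 k = interp_control P candidate (node k) by rewrite mxE.
have hst t i : -1 <= t <= 1 -> `|interp_state candidate t i ord0 - x t i ord0| <= 1.
  move=> ht; have := cV_norm_ge (interp_state candidate t - x t) i.
  by rewrite !mxE => /le_trans; apply; apply: le_trans r1; exact: hs.
split.
- exact: candidate_dynamics.
- apply: le_trans dE; rewrite !col_candidate node_first node_last //.
  have [_ _ _ e0 _] := feas.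
  rewrite -[X in `|X|]subr0 -e0; apply: le_trans (He _ _) _.
  by apply: ler_wpM2l => //; apply: pair_norm_le; exact: hs.
- move=> k j; apply: le_trans dH; rewrite col_candidate ce.
  have pe := path_everywhere feas m2 wd j (nd k).
  apply: le_trans (_ : `|pathh P (interp_state candidate (node k),
    interp_control P candidate (node k)) -
    pathh P (x (node k), control P x y (node k))| <= _).
    apply: le_trans _ (cV_norm_ge _ j); rewrite !mxE.
    by apply: le_trans (ler_norm _); rewrite lerBrDl gerDr.
  apply: le_trans (Hh _ _) _; apply: ler_wpM2l => //.
  by apply: pair_norm_le; [exact: hs|exact: hc].
- move=> k; rewrite col_candidate ce.
  have hk := nd k.
  have uk : `|interp_control P candidate (node k)| <= Bu + 1.
    rewrite -(subrK (control P x y (node k)) (interp_control P candidate (node k))).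
    rewrite addrC (le_trans (ler_normD _ _)) // lerD ?hBu //.
    by rewrite (le_trans (hc _ hk)).
  have xk i : `|interp_state candidate (node k) i ord0| <= Bx + 1.
    rewrite -(subrK (x (node k) i ord0) (interp_state candidate (node k) i ord0)).
    by rewrite addrC (le_trans (ler_normD _ _)) // lerD ?hBx ?hst.
  move: uk; rewrite ler_norml => /andP[u1 u2].
  split; split=> /=.
  + move=> i; have := xk i; rewrite ler_norml => /andP[x1 _].
    by apply: le_trans x1; have := lo1 i; rewrite /= mxE.
  + by apply: le_trans u1.
  + move=> i; have := xk i; rewrite ler_norml => /andP[_ x2].
    by apply: (le_trans x2); have := hi1 i; rewrite /= mxE.
  + by apply: (le_trans u2).
split=> [j j1 jm|].
  rewrite candidate_start //; have [d1 d2] := der j j1 jm.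
  have : `|y j (-1)| <= Dy by apply: hDy; move: jm m1_lt; clear; lia.
  by rewrite ler_norml => /andP[y1 y2]; rewrite (le_trans d1 y1) (le_trans y2 d2).
have -> : (N.+2 - (q.+1 + m1) = K.+1)%N by rewrite NE; clear; lia.
apply: le_trans dC; apply: le_trans hCS; apply: ler_sum => n _.
have nK : (n <= K)%N by rewrite -ltnS.
rewrite candidate_spectral ?nK //; last by move: nK NE m1_gt0; clear; lia.
by apply: (bmeas_derivative wd bv); move: m1_lt; clear; lia.
Qed.
End Candidate.

(** * Existence and error bounds *)

Section Constants.
Context {R : realType}.

Lemma sobolev_norm_ge0 m p (y : nat -> R -> R) : (0 <= sobolev_norm m p y)%E.
Proof. by apply: sume_ge0 => j _; exact: Lnorm_ge0. Qed.

Lemma zeta32_fin : exists z : R, zeta (3 / 2) = z%:E.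
Proof.
exists (fine (@zeta R (3 / 2))); rewrite fineK // ge0_fin_numE ?zeta32_ge0 //.
by apply: le_lt_trans zeta32_le _; rewrite ltry.
Qed.

Lemma lcoef_bound (z w T : R -> R) (U : R) (n : nat) : bmeas z -> bmeas w ->
  integral_of z w -> varies_by T w ->
  (forall t, -1 <= t <= 1 -> `|w t| <= U) -> (0 < n)%N ->
  `|lcoef z n| <= 6 * (U + (T 1 - T (-1))) * (Num.sqrt pi * n%:R `^ (3 / 2))^-1.
Proof.
move=> bz bw iz vT hU n0; have n1 : 0 < n%:R :> R by rewrite ltr0n.
apply: (le_trans (lcoef_explicit bz bw iz vT hU n0)).
set S := U + _; have S0 : 0 <= S.
  have h := lcoef_explicit bz bw iz vT hU n0; move: (le_trans (normr_ge0 _) h).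
  rewrite pmulr_lge0 ?invr_gt0 ?mulr_gt0 ?sqrtr_gt0 //.
  by rewrite pmulr_rge0.
have p0 : 0 < Num.sqrt pi :> R by rewrite sqrtr_gt0 pi_gt0.
rewrite powR32 //; set D := Num.sqrt n%:R * n%:R.
rewrite (invfM _ D) [leRHS]mulrA ler_wpM2r ?invr_ge0 ?mulr_ge0 ?sqrtr_ge0 //.
rewrite ler_pdivlMr //.
have -> : 6 * S = 3 * S * 2 by ring.
by rewrite ler_wpM2l ?mulr_ge0 // sqrt_pi_le2.
Qed.

End Constants.

Theorem theorem3 (R : realType) (q Ne Nh : nat) (P : problemB R q Ne Nh)
  (x : R -> 'cV[R]_q.+1) (u : R -> R) (m : nat) (y : nat -> R -> R)
  (m1 : nat) (U : R) :
  feasible P x u ->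
  (2 <= m)%N ->
  weak_derivatives m (fun t => x t ord_max ord0) y ->
  bounded_variation (-1) 1 (y m) ->
  (1 <= m1)%N -> (m1 <= m - 1)%N ->
  (forall t, t \in `[-1, 1] -> `|y m1.+1 t| <= U) ->
  exists T : bounds R q,
    admits m1 T x u y U /\
    forall (beta : R) (B : bounds R q),
      0 < beta -> beta < (m%:R - m1%:R) - 3 / 4 ->
      beyond m1 T B ->
      exists (N1 : nat) (M : R), [/\ (0 < N1)%N, 0 < M &
        forall N : nat, (N1 <= N)%N ->
          let err := ((M / (N%:R - q.+1%:R - m1%:R + 1)
                             `^ ((m%:R - m1%:R) - 3 / 4))%:E
                      * sobolev_norm m 2%:E y)%E in
          exists (X : 'M[R]_(q.+1, N.+1)) (ub : 'rV[R]_N.+1)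
                 (p : 'I_q.+1 -> {poly R}),
            feasibleN P m1 beta B X ub /\
            interpolates X p /\
            [/\ (forall i, (Lp_norm +oo
                   (fun t => interp_state p t i ord0 - x t i ord0)%R
                   <= err)%E),
                (forall l, (1 <= l)%N -> (l <= m1)%N ->
                   (Lp_norm +oo (fun t => (derivn l (p ord_max)).[t] - y l t)%R
                    <= err)%E),
                (Lp_norm +oo (fun t => interp_control P p t - u t)%R <= err)%E
              & forall n, (1 <= n)%N -> (n <= N - q.+1 - 1)%N ->
                  (`|spectral_coef m1 (row ord_max X)^T n|%:E
                   <= 6%:E * (U%:E + total_variation (-1) 1 (y m1.+1))
                      * ((Num.sqrt pi * n%:R `^ (3 / 2))^-1)%:E)%E]].
Proof.
move=> feas m2 wd bv m1_gt0 m1_lt hU.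
have m1m : (m1 < m)%N by move: m1_lt m2; clear; lia.
have [Bx Bx0 hBx] := state_bounded feas.
have [Bu Bu0 hBu] := control_bounded feas m2 wd.
have [Dy Dy0 hDy] := derivatives_bounded wd bv.
have [CS hCS] := coef_sum_bounded m2 wd bv m1_lt.
have [TV vT tvE] := next_derivative_varies m2 wd bv m1_lt.
have [z zE] := @zeta32_fin R.
have b0 : -1 <= (-1 : R) <= 1 by rewrite lexx; lra.
have bz : bmeas (y m1) := bmeas_derivative wd bv (ltnW m1m).
have bw : bmeas (y m1.+1) := bmeas_derivative wd bv m1m.
have iz : integral_of (y m1) (y m1.+1) := derivative_integral wd bv m1m.
have hU' t : -1 <= t <= 1 -> `|y m1.+1 t| <= U by move=> ht; apply: hU; rewrite in_itv.
pose Z := 6 / Num.sqrt pi * (U + (TV 1 - TV (-1))) * z.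
(* CS bounds the discrete coefficient sums; Z + 1 is there for the strict bound
   required of an admissible threshold. *)
exists (Bounds (const_mx (- (Bx + 1)), - (Bu + 1)) (const_mx (Bx + 1), Bu + 1)
    (fun=> - (Dy + 1)) (fun=> Dy + 1) (Num.max CS (Z + 1))).
split.
  split.
  - apply: (ae_imp (control_ae feas m2 wd)) => t h ht; rewrite h //.
    have ht' : -1 <= t <= 1 by move: ht; rewrite in_itv.
    have := hBu t ht'; rewrite ler_norml => /andP[u1 u2].
    split; split=> [i|] /=; rewrite ?mxE.
    + have := hBx t i ht'; rewrite ler_norml => /andP[x1 _].
      by clear -x1; lra.
    + by clear -u1; lra.
    + have := hBx t i ht'; rewrite ler_norml => /andP[_ x2].
      by clear -x2; lra.
    + by clear -u2; lra.
  - move=> j j1 jm t ht /=.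
    have jm' : (j <= m)%N by move: jm m1m; clear; lia.
    have := hDy j t jm'; rewrite in_itv in ht => /(_ ht).
    by rewrite ler_norml => /andP[y1 y2]; apply/andP; split; clear -y1 y2; lra.
  - rewrite tvE zE /= -EFinD -!EFinM lte_fin lt_max -/Z ltrDl ltr01 orbT //.
move=> beta B be0 bea beyB.
set alpha := m%:R - m1%:R - 3 / 4 in bea *.
have [C C0 [Cz hC]] := projection_rate m2 wd bv m1_lt.
have [Lf Lf0 hLf] := lipschitz_ex (dynf_lipschitz P).
have [Lg Lg0 hLg] := lipschitz_ex (dyng_lipschitz P).
have [Le Le0 hLe] := lipschitz_ex (ende_lipschitz P).
have [Lh Lh0 hLh] := lipschitz_ex (pathh_lipschitz P).
have [gm gm0 hgm] := dyng_lower feas.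
pose Cu := (1 + Lf + Bu * Lg) * (2 / gm).
have Cu0 : 0 <= Cu by rewrite mulr_ge0 ?divr_ge0 ?(ltW gm0) // !addr_ge0 ?mulr_ge0.
(* 2 ^+ (m1 + q) is the loss in the repeated integrations; 1 + Cu covers the control. *)
pose Ct := 2 ^+ (m1 + q) * C * (1 + Cu).
have Ct0 : 0 <= Ct by rewrite !mulr_ge0 ?exprn_ge0 ?addr_ge0.
have G0 : 0 <= 2 * Lg / gm by rewrite divr_ge0 ?mulr_ge0 ?(ltW gm0).
(* The four terms make the error at most 1, the endpoint and path violations at
   most the tolerance, and the error on dyng at most gm / 2. *)
pose c := Ct * (1 + Le + Lh + 2 * Lg / gm).
have c0 : 0 <= c by rewrite mulr_ge0 ?addr_ge0.
have [N1 N10 hN1] := growth q m1 m c0 be0 bea.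
have [M M0 hM] : exists2 M : R, 0 < M & forall rho, 0 < rho ->
    ((Ct / rho)%:E <= (M / rho)%:E * sobolev_norm m 2%:E y)%E.
  apply: absorb_norm Ct0 (sobolev_norm_ge0 _ _ _) _ => S0.
  rewrite /Ct (Cz _) ?mulr0 ?mul0r // => t ht.
  exact: (sobolev_eq0 m2 wd m1_lt S0).
exists N1, M; split=> // N NN1 err.
have [mK qN dc d1] := hN1 N NN1.
set K := (N - q - m1)%N in mK dc.
have NE : N = (K + m1 + q)%N by rewrite /K; move: qN; clear; lia.
have K0 : 0 < K%:R :> R by rewrite ltr0n; apply: leq_ltn_trans mK.
pose rho : R := K%:R `^ alpha; have rho0 : 0 < rho by rewrite powR_gt0.
have errE : err = ((M / rho)%:E * sobolev_norm m 2%:E y)%E.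
  rewrite /err; have -> // : N%:R - q.+1%:R - m1%:R + 1 = K%:R :> R.
  by rewrite NE !natrD -natr1; ring.
have tau0 : 0 <= C / rho by rewrite divr_ge0 // ltW.
have proj : forall t, -1 <= t <= 1 ->
    `|(partial_sum (y m1) K).[t] - y m1 t| <= C / rho by exact: hC.
pose r := Ct / rho; have r0 : 0 <= r by rewrite divr_ge0 // ltW.
pose e := 2 ^+ (m1 + q) * (C / rho); have e0 : 0 <= e by rewrite mulr_ge0 ?exprn_ge0.
have rE : r = e + Cu * e by rewrite /r /Ct /e; ring.
have er : e <= r by rewrite rE lerDl mulr_ge0.
have Cur : Cu * e <= r by rewrite rE lerDr.
have scale a : 0 <= a -> a <= 1 + Le + Lh + 2 * Lg / gm -> a * r <= c / rho.
  move=> a0 ha; have -> : c / rho = (1 + Le + Lh + 2 * Lg / gm) * r.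
    by rewrite /c /r; ring.
  exact: ler_wpM2r.
have small : c / rho <= 1 by apply: le_trans d1.
have re1 : Lg * e <= gm / 2.
  have h : 2 * Lg / gm * r <= 1.
    apply: le_trans small; apply: scale => //; rewrite lerDr !addr_ge0 //.
  have -> : gm / 2 = gm / 2 * 1 by rewrite mulr1.
  have -> : Lg * e = gm / 2 * (2 * Lg / gm * e) by field; rewrite lt0r_neq0.
  rewrite ler_wpM2l ?divr_ge0 ?(ltW gm0) //; apply: le_trans h.
  by rewrite ler_wpM2l.
pose X := @candidate_states R q x y m1 N K; pose ub := candidate_controls P x y m1 N K.
pose p := @candidate R q x y m1 K.
have se t : -1 <= t <= 1 -> `|interp_state p t - x t| <= r.
  by move=> ht; apply: le_trans er; exact: (state_error feas m2 wd bv).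
have ce t : -1 <= t <= 1 -> `|interp_control P p t - control P x y t| <= r.
  move=> ht; apply: le_trans Cur.
  by apply: (control_error feas m2 wd bv) => //; [exact: hgm|exact: hBu].
(* The control is known almost everywhere only, hence the two forms. *)
have close f : {ae @lebesgue_measure R, forall t, t \in `[-1, 1] -> `|f t| <= r} ->
    (Lp_norm +oo f <= err)%E.
  by move=> H; rewrite errE; apply: le_trans (hM _ rho0); apply: Linf_le.
have ev f : (forall t, -1 <= t <= 1 -> `|f t| <= r) -> (Lp_norm +oo f <= err)%E.
  by move=> H; apply: close; apply: aeW => t; rewrite in_itv; exact: H.
exists X, ub, p; split; [|split].
- apply: (candidate_feasible feas m2 wd bv m1_gt0 m1_lt NE (r := r) se ce _ Le0 hLe Lh0 hLh
    _ _ hBx hBu (Dy := Dy + 1) _ _ beyB).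
  + apply: le_trans small; rewrite -[leLHS]mul1r; apply: scale => //.
    by rewrite -!addrA lerDl !addr_ge0.
  + apply: le_trans dc; apply: scale => //.
    have -> : 1 + Le + Lh + 2 * Lg / gm = Le + (1 + Lh + 2 * Lg / gm) by ring.
    by rewrite lerDl !addr_ge0.
  + apply: le_trans dc; apply: scale => //.
    have -> : 1 + Le + Lh + 2 * Lg / gm = Lh + (1 + Le + 2 * Lg / gm) by ring.
    by rewrite lerDl !addr_ge0.
  + by move=> j jm; rewrite (le_trans (hDy j _ jm b0)) // lerDl.
  + by rewrite le_max hCS.
- exact: (candidate_interpolates x y NE).
split.
- move=> i; apply: ev => t ht; have := cV_norm_ge (interp_state p t - x t) i.
  by rewrite !mxE => /le_trans; apply; exact: se.
- move=> l l1 lm; apply: ev => t ht; apply: le_trans er.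
  exact: (derivative_error feas m2 wd bv).
- apply: close; apply: (ae_imp (control_ae feas m2 wd)) => t h ht.
  by rewrite h //; apply: ce; move: ht; rewrite in_itv.
move=> n n1 nN; rewrite tvE -EFinD -!EFinM lee_fin.
have nK : (n + K < 2 * N)%N by move: nN qN NE m1_gt0; clear; lia.
rewrite (candidate_spectral x m1_gt0 NE bz nK).
have lb := lcoef_bound bz bw iz vT hU' n1.
by case: ifP => // _; rewrite normr0 (le_trans _ lb).
Qed.
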